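(* Let $\{X_n\}_{n\in\mathbf{Z}}$ be a purely nondeterministic stationary process with MA coefficients $c_n$ and AR coefficients $a_n$. Assume that one of the following holds: (A1) $\sum_{n=0}^{\infty}|a_n|<\infty$ and $\sum_{n=0}^{\infty}|c_n|<\infty$; (A2) for some $d\in(0,1/2)$ and some slowly varying function $\ell$ at infinity, $c_n\sim n^{-(1-d)}\ell(n)$ and $a_n\sim n^{-(1+d)}\frac{1}{\ell(n)}\cdot\frac{d\sin(\pi d)}{\pi}$ as $n\to\infty$. Then for $n\in\mathbf{N}$ and $j=1,\ldots,n$, $$\phi_{n,j}=\lim_{M\to\infty}\sum_{k=1}^{M}g_k(n,j),$$ where $g_k(n,j)=b_k(n,j)$ for $k=1,3,\ldots$, $g_k(n,j)=b_k(n,n+1-j)$ for $k=2,4,\ldots$, and $$b_1(n,v)=c_0a_v\quad(v\ge0),\qquad b_k(n,v)=c_0\sum_{u=0}^{\infty}a_{v+u}\,d_{k-1}(n+1,u)\quad(k\ge2,\ v\ge0),$$ the sum on the right-hand side converging absolutely.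
   Context: $\mathbf{N}=\{1,2,\ldots\}$. A stationary process $\{X_k:k\in\mathbf{Z}\}$ is a real, zero-mean, weakly stationary process on a probability space $(\Omega,\mathcal{F},P)$, with autocovariance $\gamma(n)=E[X_nX_0]$. $H$ is the closed real linear span of $\{X_k:k\in\mathbf{Z}\}$ in $L^2(\Omega,\mathcal{F},P)$, with inner product $(Y,Z)=E[YZ]$. For an interval $I$, $H_I$ is the closed linear span of $\{X_k:k\in I\cap\mathbf{Z}\}$ and $P_I$ is the orthogonal projection of $H$ onto $H_I$. $\{X_n\}$ is purely nondeterministic (PND) if $\bigcap_{n=-\infty}^{\infty}H_{(-\infty,n]}=\{0\}$; equivalently, it has a positive spectral density $\Delta$ (an even, nonnegative, integrable function on $[-\pi,\pi]$ with $\gamma(n)=\int_{-\pi}^{\pi}e^{in\lambda}\Delta(\lambda)\,d\lambda$) such that $\int_{-\pi}^{\pi}|\log\Delta(\lambda)|\,d\lambda<\infty$. For PND $\{X_n\}$ define $$h(z)=\sqrt{2\pi}\exp\Big\{\frac{1}{4\pi}\int_{-\pi}^{\pi}\frac{e^{i\lambda}+z}{e^{i\lambda}-z}\log\Delta(\lambda)\,d\lambda\Big\},\qquad |z|<1.$$ The MA coefficients $c_n$ and AR coefficients $a_n$ are the real sequences defined by $h(z)=\sum_{n\ge0}c_nz^n$ and $-1/h(z)=\sum_{n\ge0}a_nz^n$ for $|z|<1$. A slowly varying function at infinity is a positive measurable function $\ell$ on some $[A,\infty)$ with $\lim_{x\to\infty}\ell(\lambda x)/\ell(x)=1$ for all $\lambda>0$.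 The finite predictor coefficients $\phi_{n,j}$ ($n\in\mathbf{N}$, $1\le j\le n$) are the uniquely determined real numbers with $P_{[-n,-1]}X_0=\sum_{j=1}^{n}\phi_{n,j}X_{-j}$. For $n\in\mathbf{N}\cup\{0\}$ put $\beta_n=\sum_{v=0}^{\infty}c_va_{v+n}$, and define recursively for $k,n,j\in\mathbf{N}\cup\{0\}$ $$d_0(n,j)=\delta_{j0},\qquad d_{k+1}(n,j)=\sum_{v=0}^{\infty}\beta_{n+j+v}\,d_k(n,v)$$ (these sums converge absolutely under either (A1) or (A2)). The quantities $b_k(n,j)$ are originally defined as $b_k(n,j)=b_k^0(n,j)$, where, for $n\in\mathbf{N}$ and $m,j\in\mathbf{N}\cup\{0\}$, $b_j^m=\sum_{k=0}^{m}c_ka_{j+m-k}$, $b_1^m(n,j)=b_j^m$ and $b_{k+1}^m(n,j)=\sum_{m_1=0}^{\infty}b_{n+1+m_1}^m\,b_k^{m_1}(n,j)$ for $k\ge1$ (absolutely convergent sums); the formulas for $b_k(n,v)$ in the claim are part of the assertion. *)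

(* Defs.v *)
From HB Require Import structures.
From mathcomp Require Import all_boot all_order all_algebra.
From mathcomp Require Import all_classical all_reals all_analysis.
From mathcomp.real_closed Require Import complex.

Set Implicit Arguments.
Unset Strict Implicit.
Unset Printing Implicit Defensive.

Import Order.TTheory GRing.Theory Num.Theory.
Import numFieldNormedType.Exports.

Local Open Scope classical_set_scope.
Local Open Scope ring_scope.
Local Open Scope complex_scope.

(* Elements of L^2 are represented by functions [T -> R] in [Lfun P 2%:E];
   equality in L^2 is equality almost everywhere. *)

Definition stationary disp (T : measurableType disp) (R : realType)
    (P : probability T R) (X : int -> T -> R) : Prop :=
  [/\ forall k : int, X k \in Lfun P 2%:E,
      forall k : int, ('E_P[X k] = 0)%E &
      forall j k m : int, ('E_P[X (j + m)%R * X (k + m)%R] = 'E_P[X j * X k])%E ].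

Definition autocovariance disp (T : measurableType disp) (R : realType)
    (P : probability T R) (X : int -> T -> R) (n : int) : R :=
  fine ('E_P[X n * X 0%R])%E.

(* The space H_I, as a set of representatives: a square-integrable Y belongs to
   it when it is an L^2-limit of finite linear combinations of the X_k,
   k in I. *)
Definition closed_span disp (T : measurableType disp) (R : realType)
    (P : probability T R) (X : int -> T -> R) (I : set int) : set (T -> R) :=
  [set Y | Y \in Lfun P 2%:E /\
    forall e : R, 0 < e -> exists (s : seq int) (w : int -> R),
      (forall k, k \in s -> I k) /\
      ('N[P]_2%:E[EFin \o (fun t => Y t - \sum_(k <- s) w k * X k t)%R]
         < e%:E)%E ].

(* Z is (a version of) the orthogonal projection of Y onto H_I. *)
Definition is_projection disp (T : measurableType disp) (R : realType)
    (P : probability T R) (X : int -> T -> R) (I : set int)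
    (Y Z : T -> R) : Prop :=
  closed_span P X I Z /\
  forall W : T -> R, closed_span P X I W -> ('E_P[(Y - Z) * W] = 0)%E.

Definition purely_nondeterministic disp (T : measurableType disp)
    (R : realType) (P : probability T R) (X : int -> T -> R) : Prop :=
  forall Y : T -> R,
    (forall n : int, closed_span P X [set` `]-oo, n] ] Y) ->
    {ae P, forall t, Y t = 0}.

Definition expC (R : realType) (z : R[i]) : R[i] :=
  (expR (complex.Re z))%:C * (cos (complex.Im z) +i* sin (complex.Im z)).

Definition expi (R : realType) (t : R) : R[i] := expC (0 +i* t).

Definition Cintegral (R : realType) (f : R -> R[i]) : R[i] :=
  (\int[@lebesgue_measure R]_(t in `[- pi, pi]) complex.Re (f t)) +i*
  (\int[@lebesgue_measure R]_(t in `[- pi, pi]) complex.Im (f t)).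

Definition is_spectral_density disp (T : measurableType disp) (R : realType)
    (P : probability T R) (X : int -> T -> R) (Delta : R -> R) : Prop :=
  [/\ forall t, t \in `[- pi, pi] -> Delta (- t) = Delta t,
      forall t, t \in `[- pi, pi] -> 0 <= Delta t,
      (@lebesgue_measure R).-integrable `[- pi, pi] (EFin \o Delta) &
      forall n : int, (autocovariance P X n)%:C =
        Cintegral (fun t => expi (n%:~R * t) * (Delta t)%:C) ].

Definition positive_log_integrable (R : realType) (Delta : R -> R) : Prop :=
  {ae @lebesgue_measure R, forall t, t \in `[- pi, pi] -> 0 < Delta t} /\
  (@lebesgue_measure R).-integrable `[- pi, pi]
    (EFin \o (fun t => ln (Delta t))).

Definition szego_function (R : realType) (Delta : R -> R) (z : R[i]) : R[i] :=
  (Num.sqrt (2 * pi))%:C *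
  expC (((4 * pi)^-1)%:C *
    Cintegral (fun t => (expi t + z) / (expi t - z) * (ln (Delta t))%:C)).

(* sum_n u_n z^n = f z on the open unit disc; [R[i]^o] carries the topology of
   the modulus. *)
Definition power_series_of (R : realType) (f : R[i] -> R[i]) (u : nat -> R) :
    Prop :=
  forall z : R[i], (`|z| : R[i]) < 1 ->
    (series (fun n => (u n)%:C * z ^+ n) : nat -> R[i]^o) @ \oo
      --> (f z : R[i]^o).

Definition MA_coefficients (R : realType) (Delta : R -> R) (c : nat -> R) :=
  power_series_of (szego_function Delta) c.

Definition AR_coefficients (R : realType) (Delta : R -> R) (a : nat -> R) :=
  power_series_of (fun z => - (szego_function Delta z)^-1) a.

Definition slowly_varying (R : realType) (l : R -> R) : Prop :=
  (exists A : R, measurable_fun `[A, +oo[ l /\ forall x, A <= x -> 0 < l x) /\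
  forall lambda : R, 0 < lambda -> l (lambda * x) / l x @[x --> +oo] --> (1 : R).

Definition condA1 (R : realType) (c a : nat -> R) : Prop :=
  cvgn [normed series a] /\ cvgn [normed series c].

Definition condA2 (R : realType) (c a : nat -> R) : Prop :=
  exists (d : R) (l : R -> R), [/\ 0 < d < 2^-1, slowly_varying l,
    c ~_\oo (fun n : nat => n%:R `^ (- (1 - d)) * l n%:R) &
    a ~_\oo (fun n : nat =>
      n%:R `^ (- (1 + d)) * (l n%:R)^-1 * (d * sin (pi * d) / pi)) ].

Definition finite_predictor disp (T : measurableType disp) (R : realType)
    (P : probability T R) (X : int -> T -> R) (phi : nat -> nat -> R) : Prop :=
  forall n : nat, (0 < n)%N ->
    is_projection P X [set` `[- n%:Z, - 1] ] (X 0)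
      (fun t => \sum_(1 <= j < n.+1) phi n j * X (- j%:Z) t).

(* When a series diverges, [limn (series _)] is a junk value; under the summability
   assumptions considered here all the series below converge absolutely. *)

Definition beta_coef (R : realType) (c a : nat -> R) (n : nat) : R :=
  limn (series (fun v => c v * a (v + n)%N)).

Fixpoint dcoef (R : realType) (c a : nat -> R) (k n j : nat) : R :=
  if k is k'.+1 then
    limn (series (fun v => beta_coef c a (n + j + v) * dcoef c a k' n v))
  else (j == 0%N)%:R.

Definition bmcoef1 (R : realType) (c a : nat -> R) (m j : nat) : R :=
  \sum_(0 <= k < m.+1) c k * a (j + m - k)%N.

(* [bmcoef c a k m n j] is b_k^m(n, j) for k >= 1; its value at k = 0 is a
   placeholder. *)
Fixpoint bmcoef (R : realType) (c a : nat -> R) (k m n j : nat) : R :=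
  match k with
  | 0 => 0
  | k'.+1 =>
      if k' == 0%N then bmcoef1 c a m j
      else limn (series (fun m1 =>
        bmcoef1 c a m (n + 1 + m1)%N * bmcoef c a k' m1 n j))
  end.

Definition bcoef (R : realType) (c a : nat -> R) (k n j : nat) : R :=
  bmcoef c a k 0 n j.

Definition gcoef (R : realType) (c a : nat -> R) (k n j : nat) : R :=
  if odd k then bcoef c a k n j else bcoef c a k n (n + 1 - j)%N.

(* Main.v *)
(* On the analytic side, the moduli of the AR power series on the circles |z| = r
   are exponentials of Poisson integrals of ln Delta, so letting r tend to 1 gives
   2 pi |A|^2 Delta = 1 almost everywhere, where A = sum a_n e^{int} (recall that
   a is in l^1).  Hence h has boundary value -1/A, it is the L^2 sum of the
   c_n e^{int}, and gamma(k) = sum_v c_v c_{v+k}; also a * c = - delta.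

   The rest is about sequences.  Let B be the Hankel operator with entries
   beta_{n+1+j+v}, so that d_k = B^k d_0 and the claimed formula for b_k follows
   from the recursion by factoring B.  Splitting sum_s a_s gamma(s-m) = 0 shows
   that the sum of the first M terms g_k solves the normal equations of the
   predictor up to the error c_0 (d_M, r), where r in l^2 depends only on the parity of M.  For x in l^2,
   Bessel's inequality for the shifts of c gives
   |Bx|^2 + (c * x)(t)^2 / |c|^2 <= |x|^2; hence |d_k| decreases, c * d_k and
   therefore d_k = - a * c * d_k tend to 0 termwise, and d_k tends weakly to 0.
   So the errors vanish in the limit, and the Gram matrix of the normal equations
   is invertible.  Under (A2), the summability used here follows from Potter
   bounds. *)

Require Import Defs.
From HB Require Import structures.
From mathcomp Require Import all_boot all_order all_algebra.
From mathcomp Require Import all_classical all_reals all_analysis measurable_realfun.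
From mathcomp.real_closed Require Import complex.
From mathcomp Require Import ring lra zify.

Set Implicit Arguments.
Unset Strict Implicit.
Unset Printing Implicit Defensive.

Import Order.TTheory GRing.Theory Num.Theory.
Import numFieldNormedType.Exports.

Local Open Scope classical_set_scope.
Local Open Scope ring_scope.

(** * Absolutely convergent series *)

Section summable_series.
Context {R : realType}.
Implicit Types f g : nat -> R.

(** Bessel's inequality with this constant has a simple source. On the circle A C = -1 for C = sum
    c_n e^{int}, so conj(A) C is unimodular and conj(A) C x has the norm of x. Its negative
    frequencies carry Bx, and its nonnegative ones determine c * x. This function is never formed:
    reversing a finite block of coefficients leaves a symmetric Toeplitz Gram matrix unchanged,
    which does the work of conjugating A and keeps the argument in l^2.

    On the analytic side the obstacle is that c is only known to be in l^2, so its series need not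
    converge on the circle. But a is in l^1, so A is reached by Abel summation at every point; it is
    then enough that the Poisson integrals converge in L^1, which follows from the density of
    continuous functions, and the statements about c come from Fatou's lemma.

    Under (A2) the autocovariance need not be absolutely summable. The exchanges of sums in the
    normal equations therefore rest on a bound for sums of |a_{u+t}| against a majorant of
    |gamma(t)|, square summable in u. *)

Definition abs_summable f :=
  exists M : R, forall n, \sum_(0 <= i < n) `|f i| <= M.

(** The same term as the limits in [beta_coef] and [dcoef], so those unfold to it by conversion; it
    is meaningful only for convergent series. *)
Definition tsum f : R := limn (series f).

Lemma nneg_series_cvg f (M : R) : (forall n, 0 <= f n) ->
  (forall n, \sum_(0 <= i < n) f i <= M) -> cvgn (series f).
Proof.
move=> f0 fM; apply: nondecreasing_is_cvgn; first exact: nondecreasing_series.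
by exists M => _ [n _ <-]; exact: fM.
Qed.

Lemma abs_summableP f : abs_summable f <-> cvgn [normed series f].
Proof.
split=> [[M fM]|/cvg_seq_bounded/bounded_fun_has_ubound[M fM]].
  by apply: (@nneg_series_cvg _ M) => // n; exact: normr_ge0.
by exists M => n; apply: fM; exists n.
Qed.

Lemma tsum_cvg f : abs_summable f -> series f @ \oo --> tsum f.
Proof. by move=> /abs_summableP/normed_cvg. Qed.

Lemma tsum_eq f (l : R) : series f @ \oo --> l -> tsum f = l.
Proof. exact: cvg_lim. Qed.

Lemma eq_tsum f g : f =1 g -> tsum f = tsum g.
Proof. by move=> /funext ->. Qed.

Lemma asum_norm f : abs_summable f -> abs_summable (fun n => `|f n|).
Proof. by move=> [M fM]; exists M => n; under eq_bigr do rewrite normr_id. Qed.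

Lemma asum_le g f : (forall n, `|f n| <= g n) -> abs_summable g ->
  abs_summable f.
Proof.
move=> fg [M gM]; exists M => n; apply: le_trans (gM n).
by apply: ler_sum => i _; rewrite (le_trans (fg i)) ?ler_norm.
Qed.

Lemma asum_fin K f : (forall n, (K <= n)%N -> f n = 0) -> abs_summable f.
Proof.
move=> f0; exists (\sum_(0 <= i < K) `|f i|) => n.
have [nK|/ltnW Kn] := leqP n K.
  by rewrite (big_cat_nat (leq0n _) nK)/= lerDl sumr_ge0.
rewrite (big_cat_nat (leq0n _) Kn)/= gerDl big_nat big1// => i /andP[Ki _].
by rewrite f0 ?normr0.
Qed.

Lemma tsum_fin K f : (forall n, (K <= n)%N -> f n = 0) ->
  tsum f = \sum_(0 <= i < K) f i.
Proof.
move=> f0; apply: tsum_eq; apply: cvg_near_cst.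
near=> n; rewrite /series/=.
have Kn : (K <= n)%N by near: n; exact: nbhs_infty_ge.
rewrite (big_cat_nat (leq0n _) Kn)/= [X in _ + X]big_nat.
by rewrite [X in _ + X]big1 ?addr0//; move=> i /andP[Ki _]; rewrite f0.
Unshelve. all: by end_near. Qed.

Lemma asumD f g : abs_summable f -> abs_summable g ->
  abs_summable (fun n => f n + g n).
Proof.
move=> [M fM] [L gL]; exists (M + L) => n.
apply: le_trans (lerD (fM n) (gL n)); rewrite -big_split/=.
by apply: ler_sum => i _; exact: ler_normD.
Qed.

Lemma asumZ k f : abs_summable f -> abs_summable (fun n => k * f n).
Proof.
move=> [M fM]; exists (`|k| * M) => n.
under eq_bigr do rewrite normrM.
by rewrite -mulr_sumr ler_wpM2l.
Qed.

Lemma asumN f : abs_summable f -> abs_summable (fun n => - f n).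
Proof. by move=> [M fM]; exists M => n; under eq_bigr do rewrite normrN. Qed.

Lemma asum_sum (F : nat -> nat -> R) (s : seq nat) :
  (forall i, i \in s -> abs_summable (F i)) ->
  abs_summable (fun n => \sum_(i <- s) F i n).
Proof.
elim: s => [|x s ih] sF.
  by apply: (@asum_fin 0) => n _; rewrite big_nil.
have := asumD (sF x (mem_head _ _)) (ih (fun i si => sF i (mem_behead (s := x :: s) si))).
by congr abs_summable; apply/funext => n; rewrite big_cons.
Qed.

Lemma cvg_sum_seq (s : seq nat) (u : nat -> nat -> R) (l : nat -> R) :
  (forall i, i \in s -> u i @ \oo --> l i) ->
  (fun n => \sum_(i <- s) u i n) @ \oo --> \sum_(i <- s) l i.
Proof.
elim: s => [|x s ih] ul.
  by under eq_fun do rewrite big_nil; rewrite big_nil; exact: cvg_cst.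
under eq_fun do rewrite big_cons; rewrite big_cons; apply: cvgD.
  by apply: ul; rewrite inE eqxx.
by apply: ih => i si; apply: ul; rewrite inE si orbT.
Qed.

Lemma tsumD f g : abs_summable f -> abs_summable g ->
  tsum (fun n => f n + g n) = tsum f + tsum g.
Proof.
move=> /tsum_cvg sf /tsum_cvg sg; apply: tsum_eq.
rewrite (_ : series _ = series f + series g) ?seriesD//; exact: cvgD.
Qed.

Lemma tsumZ k f : abs_summable f -> tsum (fun n => k * f n) = k * tsum f.
Proof.
move=> /tsum_cvg sf; apply: tsum_eq.
rewrite (_ : series _ = k *: series f); first exact: cvgZr.
by rewrite -seriesZ.
Qed.

Lemma tsumN f : abs_summable f -> tsum (fun n => - f n) = - tsum f.
Proof.
move=> /tsum_cvg sf; apply: tsum_eq.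
by rewrite (_ : series _ = - series f); [exact: cvgN|rewrite -seriesN].
Qed.

Lemma tsumB f g : abs_summable f -> abs_summable g ->
  tsum (fun n => f n - g n) = tsum f - tsum g.
Proof. by move=> sf sg; rewrite tsumD ?tsumN//; exact: asumN. Qed.

Lemma tsum_sum (F : nat -> nat -> R) (s : seq nat) :
  (forall i, i \in s -> abs_summable (F i)) ->
  tsum (fun n => \sum_(i <- s) F i n) = \sum_(i <- s) tsum (F i).
Proof.
elim: s => [|x s ih] sF.
  by rewrite big_nil (@tsum_fin 0) ?big_nil// => n _; rewrite big_nil.
have sF' i : i \in s -> abs_summable (F i).
  by move=> si; apply: sF; rewrite inE si orbT.
rewrite big_cons -ih// -tsumD; [|by apply: sF; rewrite inE eqxx|exact: asum_sum].
by apply: eq_tsum => n; rewrite big_cons.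
Qed.

Lemma le_tsum f g : (forall n, f n <= g n) -> abs_summable f ->
  abs_summable g -> tsum f <= tsum g.
Proof.
move=> fg /tsum_cvg sf /tsum_cvg sg.
apply: ler_lim; [exact: cvgP sf|exact: cvgP sg|].
by near=> n; apply: ler_sum.
Unshelve. all: by end_near. Qed.

Lemma tsum_ge0 f : (forall n, 0 <= f n) -> abs_summable f -> 0 <= tsum f.
Proof.
move=> f0 /tsum_cvg sf; apply: limr_ge; first exact: cvgP sf.
by near=> n; apply: sumr_ge0.
Unshelve. all: by end_near. Qed.

Lemma tsum_le_bound f M : abs_summable f ->
  (forall n, \sum_(0 <= i < n) f i <= M) -> tsum f <= M.
Proof.
move=> /tsum_cvg sf fM; apply: limr_le; first exact: cvgP sf.
by near=> n; exact: fM.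
Unshelve. all: by end_near. Qed.

Lemma psum_le_tsum f n : (forall n, 0 <= f n) -> abs_summable f ->
  \sum_(0 <= i < n) f i <= tsum f.
Proof.
move=> f0 /tsum_cvg sf.
by apply: (@nondecreasing_cvgn_le _ (series f)); [exact: nondecreasing_series|exact: cvgP sf].
Qed.

Lemma ler_norm_tsum f : abs_summable f -> `|tsum f| <= tsum (fun n => `|f n|).
Proof. by move=> /abs_summableP sf; exact: lim_series_norm. Qed.

Lemma sum_nat_shift (V : nmodType) (h : nat -> V) k n :
  \sum_(k <= i < n + k) h i = \sum_(0 <= i < n) h (i + k)%N.
Proof. by rewrite -{1}[k]add0n big_addn addnK. Qed.

Lemma asum_shift k f : abs_summable f -> abs_summable (fun n => f (n + k)%N).
Proof.
move=> [M fM]; exists M => n; apply: le_trans (fM (n + k)%N).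
rewrite (big_cat_nat (leq0n k) (leq_addl n k))/= sum_nat_shift.
by rewrite lerDr sumr_ge0.
Qed.

Lemma asum_unshift k f : abs_summable (fun n => f (n + k)%N) -> abs_summable f.
Proof.
move=> [M fM]; exists (\sum_(0 <= i < k) `|f i| + M) => n.
have [nk|/ltnW kn] := leqP n k.
  rewrite (big_cat_nat (leq0n _) nk)/= -addrA lerDl addr_ge0 ?sumr_ge0//.
  by apply: le_trans (fM 0%N); rewrite big_geq.
by rewrite (big_cat_nat (leq0n _) kn)/= lerD2l -{1}(subnK kn) sum_nat_shift.
Qed.

Lemma tsum_split k f : abs_summable f ->
  tsum f = \sum_(0 <= i < k) f i + tsum (fun n => f (n + k)%N).
Proof.
move=> sf; apply: tsum_eq; rewrite -(cvg_shiftn k).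
have -> : (fun n => series f (n + k)%N) =
    (fun n => \sum_(0 <= i < k) f i + series (fun n => f (n + k)%N) n).
  apply/funext => n; rewrite /series/= (big_cat_nat (leq0n k) (leq_addl n k))/=.
  by rewrite sum_nat_shift.
by apply: cvgD; [exact: cvg_cst|exact/tsum_cvg/asum_shift].
Qed.

Lemma tsum_tail_cvg f : abs_summable f ->
  tsum (fun n => f (n + k)%N) @[k --> \oo] --> (0 : R).
Proof.
move=> sf; have -> : (fun k => tsum (fun n => f (n + k)%N)) =
    (fun k => tsum f - series f k).
  by apply/funext => k; rewrite (tsum_split k sf) addrC addKr.
by rewrite -(subrr (tsum f)); apply: cvgB; [exact: cvg_cst|exact: tsum_cvg].
Qed.

Lemma tsum_recl f : abs_summable f -> tsum f = f 0%N + tsum (fun n => f n.+1).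
Proof.
move=> sf; rewrite (tsum_split 1 sf) big_nat1.
by congr (_ + _); apply: eq_tsum => n; rewrite addn1.
Qed.

Lemma term_le_tsum f n : (forall n, 0 <= f n) -> abs_summable f -> f n <= tsum f.
Proof.
move=> f0 sf; apply: le_trans (psum_le_tsum n.+1 f0 sf).
by rewrite big_nat_recr//= lerDr sumr_ge0.
Qed.

Lemma tsum_eq0 f : (forall n, 0 <= f n) -> abs_summable f -> tsum f = 0 ->
  forall n, f n = 0.
Proof.
move=> f0 sf t0 n; apply/eqP; rewrite eq_le f0 andbT -t0.
exact: term_le_tsum.
Qed.

End summable_series.

(** * Double series, exchange of summations and Cauchy products *)

Section double_series.
Context {R : realType}.
Implicit Types (f g p : nat -> R) (F : nat -> nat -> R).

(** The coefficients of z^s sum_n f_n z^n; padding with zeros keeps all shifts on one index set. *)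
Definition shift_seq f (s k : nat) : R := if (s <= k)%N then f (k - s)%N else 0.

Lemma shift_seq_addn f s k : shift_seq f s (k + s) = f k.
Proof. by rewrite /shift_seq leq_addl addnK. Qed.

Lemma asum_shift_seq f s : abs_summable f -> abs_summable (shift_seq f s).
Proof.
move=> sf; apply: (@asum_unshift _ s).
by under eq_fun do rewrite shift_seq_addn.
Qed.

Lemma tsum_shift_seq f s : abs_summable f -> tsum (shift_seq f s) = tsum f.
Proof.
move=> sf; rewrite (tsum_split s (asum_shift_seq s sf)) big_nat big1 ?add0r.
  by apply: eq_tsum => n; rewrite shift_seq_addn.
by move=> i /andP[_ si]; rewrite /shift_seq leqNgt si.
Qed.

Definition dsummable F := exists M : R,
  forall m n, \sum_(0 <= i < m) \sum_(0 <= j < n) `|F i j| <= M.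

Lemma dsum_row F i : dsummable F -> abs_summable (F i).
Proof.
move=> [M FM]; exists M => n; apply: le_trans (FM i.+1 n).
by rewrite big_nat_recr//= lerDr; apply: sumr_ge0 => k _; exact: sumr_ge0.
Qed.

Lemma dsumC F : dsummable F -> dsummable (fun i j => F j i).
Proof. by move=> [M FM]; exists M => m n; rewrite exchange_big. Qed.

Lemma dsum_col F j : dsummable F -> abs_summable (F ^~ j).
Proof. by move=> /dsumC/(dsum_row j). Qed.

Lemma dsum_norm F : dsummable F -> dsummable (fun i j => `|F i j|).
Proof.
move=> [M FM]; exists M => m n.
by under eq_bigr do under eq_bigr do rewrite normr_id.
Qed.

Lemma dsum_rownorms F : dsummable F ->
  abs_summable (fun i => tsum (fun j => `|F i j|)).
Proof.
move=> dF; have [M FM] := dF; exists M => m.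
rewrite (eq_bigr (fun i => tsum (fun j => `|F i j|))); last first.
  move=> i _; apply: ger0_norm; apply: tsum_ge0 => //.
  by apply: asum_norm; exact: dsum_row.
rewrite -tsum_sum; last by move=> i _; apply: asum_norm; exact: dsum_row.
apply: tsum_le_bound; last by move=> n; rewrite exchange_big.
by apply: asum_sum => i _; apply: asum_norm; exact: dsum_row.
Qed.

Lemma dsum_rows F : dsummable F -> abs_summable (fun i => tsum (F i)).
Proof.
move=> dF; apply: asum_le (dsum_rownorms dF) => i.
by apply: ler_norm_tsum; exact: dsum_row.
Qed.

Lemma dsummable_intro F (g : nat -> R) : (forall i, abs_summable (F i)) ->
  (forall i, tsum (fun j => `|F i j|) <= g i) -> abs_summable g -> dsummable F.
Proof.
move=> rF Fg [M gM]; exists M => m n; apply: le_trans (gM m).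
apply: ler_sum => i _; apply: (le_trans _ (ler_norm _)); apply: le_trans (Fg i).
by apply: psum_le_tsum => //; exact: asum_norm.
Qed.

Lemma dsumD F G : dsummable F -> dsummable G ->
  dsummable (fun i j => F i j + G i j).
Proof.
move=> [M FM] [N GN]; exists (M + N) => m n.
apply: le_trans (lerD (FM m n) (GN m n)).
rewrite -big_split/=; apply: ler_sum => i _.
by rewrite -big_split/=; apply: ler_sum => j _; exact: ler_normD.
Qed.

Lemma dsumN F : dsummable F -> dsummable (fun i j => - F i j).
Proof.
by move=> [M FM]; exists M => m n; under eq_bigr do under eq_bigr do rewrite normrN.
Qed.

Lemma tsum_exch_le F : (forall i j, 0 <= F i j) -> dsummable F ->
  tsum (fun i => tsum (F i)) <= tsum (fun j => tsum (F ^~ j)).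
Proof.
move=> F0 dF; apply: tsum_le_bound; first exact: dsum_rows.
move=> m; rewrite -tsum_sum; last by move=> i _; exact: dsum_row.
apply: le_tsum; last exact: (dsum_rows (dsumC dF)).
  by move=> j; apply: psum_le_tsum => //; exact: dsum_col.
by apply: asum_sum => i _; exact: dsum_row.
Qed.

Lemma tsum_exch_ge0 F : (forall i j, 0 <= F i j) -> dsummable F ->
  tsum (fun i => tsum (F i)) = tsum (fun j => tsum (F ^~ j)).
Proof.
move=> F0 dF; apply/eqP; rewrite eq_le tsum_exch_le//=.
by apply: (@tsum_exch_le (fun i j => F j i)) => //; exact: dsumC.
Qed.

(** Both [|F|] and [|F| - F] are nonnegative and summable, and [F] is their difference. *)
Lemma tsum_exch F : dsummable F ->
  tsum (fun i => tsum (F i)) = tsum (fun j => tsum (F ^~ j)).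
Proof.
move=> dF; pose G i j := `|F i j| - F i j.
have dG : dsummable G by apply: dsumD; [exact: dsum_norm|exact: dsumN].
have G0 i j : 0 <= G i j by rewrite subr_ge0 ler_norm.
have FE i j : F i j = `|F i j| - G i j by rewrite /G opprB addrC subrK.
have dn := dsum_norm dF.
transitivity (tsum (fun i => tsum (fun j => `|F i j|)) - tsum (fun i => tsum (G i))).
  rewrite -tsumB//; [|exact: dsum_rows|exact: dsum_rows].
  apply: eq_tsum => i; rewrite -tsumB; [|exact: (dsum_row i dn)|exact: dsum_row].
  by apply: eq_tsum => j; exact: FE.
rewrite (tsum_exch_ge0 _ dn)// (tsum_exch_ge0 G0 dG) -tsumB; [|exact: (dsum_rows (dsumC dn))|exact: (dsum_rows (dsumC dG))].
apply: eq_tsum => j; rewrite -tsumB; [|exact: (dsum_col j dn)|exact: (dsum_col j dG)].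
by apply: eq_tsum => i; rewrite -FE.
Qed.

(** Delaying column s by s steps turns the antidiagonals k + s = t into columns, so that [tsum_exch]
    sums along them. *)
Lemma dsum_diag F : dsummable F ->
  dsummable (fun s t => shift_seq (fun k => F k s) s t).
Proof.
move=> dF; apply: (@dsummable_intro _ (fun s => tsum (fun k => `|F k s|))).
- by move=> s; apply: asum_shift_seq; exact: dsum_col.
- move=> s; rewrite -(@tsum_shift_seq (fun k => `|F k s|) s).
    apply: le_tsum => [t||].
    + by rewrite /shift_seq; case: ifP => //; rewrite normr0.
    + by apply: asum_norm; apply: asum_shift_seq; exact: dsum_col.
    + by apply: asum_shift_seq; apply: asum_norm; exact: dsum_col.
  by apply: asum_norm; exact: dsum_col.
- exact: (dsum_rownorms (dsumC dF)).
Qed.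

Lemma tsum_shift_col F t : tsum (fun s => shift_seq (fun k => F k s) s t) =
  \sum_(0 <= s < t.+1) F (t - s)%N s.
Proof.
rewrite (@tsum_fin _ t.+1).
  by apply: eq_big_nat => s /andP[_ st]; rewrite /shift_seq -ltnS st.
by move=> s ts; rewrite /shift_seq leqNgt ts.
Qed.

Lemma asum_diag F : dsummable F ->
  abs_summable (fun t => \sum_(0 <= s < t.+1) F (t - s)%N s).
Proof.
move=> dF; under eq_fun do rewrite -tsum_shift_col.
exact: (dsum_rows (dsumC (dsum_diag dF))).
Qed.

Lemma tsum_diag F : dsummable F ->
  tsum (fun t => \sum_(0 <= s < t.+1) F (t - s)%N s) = tsum (fun k => tsum (F k)).
Proof.
move=> dF; under [X in tsum X = _]eq_fun do rewrite -tsum_shift_col.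
rewrite -(tsum_exch (dsum_diag dF)) (tsum_exch dF).
by apply: eq_tsum => s; rewrite tsum_shift_seq//; exact: dsum_col.
Qed.

End double_series.

(** * Square-summable sequences and the Cauchy-Schwarz inequality *)

Section square_summable.
Context {R : realType}.
Implicit Types (f g p : nat -> R).

Definition sqsummable f := abs_summable (fun n => f n ^+ 2).
Definition sqnorm f : R := tsum (fun n => f n ^+ 2).

Lemma sqnorm_ge0 f : sqsummable f -> 0 <= sqnorm f.
Proof. by move=> sf; apply: tsum_ge0 => // n; exact: sqr_ge0. Qed.

Lemma sqsum_bounded (c : nat -> R) : sqsummable c -> forall n, `|c n| <= 1 + sqnorm c.
Proof.
move=> sc n; have sc0 := sqnorm_ge0 sc.
have h : c n ^+ 2 <= sqnorm c.
  by apply: (@term_le_tsum _ (fun n => c n ^+ 2)) => // i; exact: sqr_ge0.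
have := normr_ge0 (c n); move: h; rewrite -[c n ^+ 2]real_normK ?num_real//.
by move: `|c n| (sqnorm c) sc0 => x y; nra.
Qed.

Lemma psum_sqnorm f n : sqsummable f -> \sum_(0 <= i < n) f i ^+ 2 <= sqnorm f.
Proof. by move=> sf; apply: psum_le_tsum => // k; exact: sqr_ge0. Qed.

Lemma sqsum_norm f : sqsummable f -> sqsummable (fun n => `|f n|).
Proof.
by rewrite /sqsummable => sf; under eq_fun do rewrite real_normK ?num_real//.
Qed.

Lemma sqsum_le g f : (forall n, `|f n| <= `|g n|) -> sqsummable g -> sqsummable f.
Proof.
move=> fg; apply: asum_le => n.
by rewrite ger0_norm ?sqr_ge0// -[f n ^+ 2]real_normK ?num_real//
  -[g n ^+ 2]real_normK ?num_real// lerXn2r ?nnegrE.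
Qed.

Lemma sqsum_shift k f : sqsummable f -> sqsummable (fun n => f (n + k)%N).
Proof. exact: (@asum_shift _ k (fun n => f n ^+ 2)). Qed.

Lemma asumM f g : sqsummable f -> sqsummable g -> abs_summable (fun n => f n * g n).
Proof.
move=> sf sg; apply: asum_le (asumD sf sg) => n.
rewrite normrM -[f n ^+ 2]real_normK ?num_real// -[g n ^+ 2]real_normK ?num_real//.
have := normr_ge0 (f n); have := normr_ge0 (g n).
by move: `|f n| `|g n| => x y; nra.
Qed.

Lemma sqsumD f g : sqsummable f -> sqsummable g -> sqsummable (fun n => f n + g n).
Proof.
move=> sf sg; have /= := asumZ 2 (asumD sf sg); apply: asum_le => n.
by rewrite ger0_norm ?sqr_ge0//; have := sqr_ge0 (f n - g n); nra.
Qed.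

Lemma sqsumZ k f : sqsummable f -> sqsummable (fun n => k * f n).
Proof.
move=> /(asumZ (k ^+ 2)); congr abs_summable.
by apply/funext => n; rewrite exprMn.
Qed.

Lemma sqsumN f : sqsummable f -> sqsummable (fun n => - f n).
Proof. by rewrite /sqsummable; under [in X in _ -> X]eq_fun do rewrite sqrrN. Qed.

Lemma sqsum_sum (F : nat -> nat -> R) (s : seq nat) :
  (forall i, i \in s -> sqsummable (F i)) ->
  sqsummable (fun n => \sum_(i <- s) F i n).
Proof.
elim: s => [|x s ih] sF.
  by apply: (@asum_fin _ 0) => n _; rewrite big_nil expr0n.
have := sqsumD (sF x (mem_head _ _)) (ih (fun i si => sF i (mem_behead (s := x :: s) si))).
by congr sqsummable; apply/funext => n; rewrite big_cons.
Qed.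

Lemma sqsum_asum f : abs_summable f -> sqsummable f.
Proof.
move=> [M fM]; exists (M ^+ 2) => n.
have M0 : 0 <= M by apply: le_trans (fM 0%N); rewrite big_geq.
apply: (@le_trans _ _ (M * \sum_(0 <= i < n) `|f i|)); last first.
  by rewrite expr2; apply: ler_wpM2l.
rewrite mulr_sumr; apply: ler_sum => i _.
rewrite normrX expr2; apply: ler_wpM2r => //; apply: le_trans (fM i.+1).
by rewrite big_nat_recr//= lerDr sumr_ge0.
Qed.

Lemma psum_CauchySchwarz f g n :
  (\sum_(0 <= i < n) f i * g i) ^+ 2 <=
  (\sum_(0 <= i < n) f i ^+ 2) * (\sum_(0 <= i < n) g i ^+ 2).
Proof.
set A := \sum_(0 <= i < n) f i ^+ 2; set B := \sum_(0 <= i < n) g i ^+ 2.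
set C := \sum_(0 <= i < n) f i * g i.
have A0 : 0 <= A by apply: sumr_ge0 => i _; exact: sqr_ge0.
have B0 : 0 <= B by apply: sumr_ge0 => i _; exact: sqr_ge0.
have H (t u : R) : 0 <= A * t ^+ 2 - C * (2 * t * u) + B * u ^+ 2.
  rewrite /A /B /C !mulr_suml -sumrB -big_split/=; apply: sumr_ge0 => i _.
  by rewrite (_ : _ + _ = (f i * t - g i * u) ^+ 2) ?sqr_ge0//; ring.
(* These values of the nonnegative quadratic form settle, in this order, the cases A = 0 <> B, A <>
   0 and A = B = 0. *)
have := H B C; have := H C A; have := H C 1.
have [A_eq0|A_neq0] := eqVneq A 0; last first.
  have A_gt0 : 0 < A by rewrite lt_def A_neq0.
  move=> _ + _; rewrite (_ : _ + _ = A * (A * B - C ^+ 2)); last by ring.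
  by rewrite pmulr_rge0// subr_ge0.
rewrite A_eq0 !mul0r !sub0r; have [->|B_neq0] := eqVneq B 0; first by nra.
have B_gt0 : 0 < B by rewrite lt_def B_neq0.
move=> _ _; rewrite (_ : _ + _ = B * (- C ^+ 2)); last by ring.
by rewrite pmulr_rge0// oppr_ge0.
Qed.

Lemma tsum_CauchySchwarz f g : sqsummable f -> sqsummable g ->
  tsum (fun n => `|f n * g n|) ^+ 2 <= sqnorm f * sqnorm g.
Proof.
move=> sf sg; have sfg := asum_norm (asumM sf sg).
have nn : 0 <= sqnorm f * sqnorm g by rewrite mulr_ge0 ?sqnorm_ge0.
rewrite -[leRHS]sqr_sqrtr// lerXn2r ?nnegrE ?sqrtr_ge0 ?tsum_ge0//.
apply: tsum_le_bound => // n.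
rewrite -[leLHS]ger0_norm ?sumr_ge0// -sqrtr_sqr ler_sqrt//.
under eq_bigr do rewrite normrM.
apply: le_trans (psum_CauchySchwarz _ _ _) _.
under eq_bigr do rewrite real_normK ?num_real//.
under [X in _ * X]eq_bigr do rewrite real_normK ?num_real//.
by rewrite ler_pM ?psum_sqnorm//; apply: sumr_ge0 => i _; exact: sqr_ge0.
Qed.

Lemma tsumM_CauchySchwarz f g : sqsummable f -> sqsummable g ->
  tsum (fun n => f n * g n) ^+ 2 <= sqnorm f * sqnorm g.
Proof.
move=> sf sg; apply: le_trans (tsum_CauchySchwarz sf sg).
rewrite -[leLHS]real_normK ?num_real// lerXn2r ?nnegrE//.
- by rewrite tsum_ge0//; apply: asum_norm; exact: asumM.
- by apply: ler_norm_tsum; exact: asumM.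
Qed.

(** * Schur's test for nonnegative matrices with bounded row and column sums *)

Section Schur_test.
Variables (k : nat -> nat -> R) (S : R).
Hypothesis k0 : forall i j, 0 <= k i j.
Hypothesis kr : forall i n, \sum_(0 <= j < n) k i j <= S.
Hypothesis kc : forall j n, \sum_(0 <= i < n) k i j <= S.
Variable p : nat -> R.
Hypothesis sp : sqsummable p.

Let kS i j : k i j <= S.
Proof.
by apply: le_trans (kr i j.+1); rewrite big_nat_recr//= lerDr sumr_ge0.
Qed.

Let S0 : 0 <= S. Proof. exact: le_trans (k0 0 0) (kS 0 0). Qed.

Let ks i : sqsummable (fun j => Num.sqrt (k i j)).
Proof.
exists S => n; under eq_bigr do rewrite sqr_sqrtr// ger0_norm//.
exact: kr.
Qed.

Let kps i : sqsummable (fun j => Num.sqrt (k i j) * p j).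
Proof.
have := asumZ S sp; apply: asum_le => j.
rewrite exprMn sqr_sqrtr// ger0_norm; last by rewrite mulr_ge0 ?sqr_ge0.
by apply: ler_wpM2r => //; exact: sqr_ge0.
Qed.

Lemma Schur_row i : abs_summable (fun j => k i j * p j).
Proof.
have := asumM (ks i) (kps i); congr abs_summable; apply/funext => j.
by rewrite mulrA -expr2 sqr_sqrtr.
Qed.

(** Cauchy-Schwarz with k p split as sqrt k times sqrt k p: the first factor costs a row sum, and
    the second leaves the weights whose column sums are used in [Schur_psum]. *)
Let Schur_sq i : tsum (fun j => `|k i j * p j|) ^+ 2 <=
  S * tsum (fun j => k i j * p j ^+ 2).
Proof.
have -> : (fun j => `|k i j * p j|) =
    (fun j => `|Num.sqrt (k i j) * (Num.sqrt (k i j) * p j)|).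
  by apply/funext => j; rewrite mulrA -expr2 sqr_sqrtr.
apply: le_trans (tsum_CauchySchwarz (ks i) (kps i)) _.
have -> : sqnorm (fun j => Num.sqrt (k i j) * p j) = tsum (fun j => k i j * p j ^+ 2).
  by apply: eq_tsum => j; rewrite exprMn sqr_sqrtr.
rewrite ler_wpM2r//.
  apply: tsum_ge0 => [j|]; first by rewrite mulr_ge0 ?sqr_ge0.
  by have := kps i; congr abs_summable; apply/funext => j; rewrite exprMn sqr_sqrtr.
apply: tsum_le_bound; first exact: ks.
by move=> n; under eq_bigr do rewrite sqr_sqrtr//.
Qed.

Let Schur_psum n :
  \sum_(0 <= i < n) tsum (fun j => `|k i j * p j|) ^+ 2 <= S ^+ 2 * sqnorm p.
Proof.
have skp i : abs_summable (fun j => k i j * p j ^+ 2).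
  by have := kps i; congr abs_summable; apply/funext => j; rewrite exprMn sqr_sqrtr.
apply: le_trans (ler_sum _ (fun i _ => Schur_sq i)) _.
rewrite -mulr_sumr expr2 -mulrA ler_wpM2l// -tsum_sum; last by move=> i _.
rewrite -tsumZ//; apply: le_tsum => [j||]; last exact: asumZ.
  by rewrite -mulr_suml ler_wpM2r ?sqr_ge0.
by apply: asum_sum => i _.
Qed.

Lemma Schur_sqsum : sqsummable (fun i => tsum (fun j => `|k i j * p j|)).
Proof.
exists (S ^+ 2 * sqnorm p) => n.
by under eq_bigr do rewrite ger0_norm ?sqr_ge0//.
Qed.

Lemma Schur_sqnorm :
  sqnorm (fun i => tsum (fun j => `|k i j * p j|)) <= S ^+ 2 * sqnorm p.
Proof. exact: tsum_le_bound Schur_sqsum _. Qed.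

End Schur_test.

End square_summable.

(** * Convolutions and Gram sequences *)

Section convolution.
Context {R : realType}.
Implicit Types (f g x p : nat -> R).

Definition conv f g (n : nat) : R := \sum_(0 <= s < n.+1) f s * g (n - s)%N.

(** Only finitely many terms enter a coefficient, so [conv] inherits commutativity and associativity
    from polynomials. *)
Lemma conv_coefM f g m n : (n < m)%N ->
  conv f g n = (\poly_(i < m) f i * \poly_(i < m) g i)`_n.
Proof.
move=> nm; rewrite coefM /conv big_mkord; apply: eq_bigr => -[i /=] im _.
rewrite !coef_poly (leq_ltn_trans _ nm)//=.
by rewrite (leq_ltn_trans (leq_subr _ _) nm).
Qed.

Lemma convC f g n : conv f g n = conv g f n.
Proof. by rewrite !(@conv_coefM _ _ n.+1)// mulrC. Qed.

Lemma convA f g x n : conv f (conv g x) n = conv (conv f g) x n.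
Proof.
transitivity (\poly_(i < n.+1) f i * (\poly_(i < n.+1) g i * \poly_(i < n.+1) x i))`_n.
  rewrite coefM /conv big_mkord; apply: eq_bigr => -[i /=] im _.
  by rewrite coef_poly im -conv_coefM// ltnS leq_subr.
rewrite mulrA coefM [in RHS]/conv big_mkord; apply: eq_bigr => -[i /=] im _.
by rewrite -conv_coefM// coef_poly ltnS leq_subr.
Qed.

Lemma conv_shift f g n : conv f g n = \sum_(0 <= s < n.+1) f s * shift_seq g s n.
Proof. by apply: eq_big_nat => s /andP[_]; rewrite ltnS /shift_seq => ->. Qed.

Lemma conv_shift_fin f x W n : (forall w, (W <= w)%N -> x w = 0) ->
  conv f x n = \sum_(0 <= w < W) x w * shift_seq f w n.
Proof.
move=> x0; rewrite convC conv_shift.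
transitivity (tsum (fun w => x w * shift_seq f w n)).
  by rewrite (@tsum_fin _ n.+1)// => w nw; rewrite /shift_seq leqNgt nw mulr0.
by rewrite (@tsum_fin _ W)// => w /x0 ->; rewrite mul0r.
Qed.

End convolution.

(** * Gram matrices of shifted sequences *)

Section gram.
Context {R : realType}.
Implicit Types (f g x p : nat -> R).

Lemma sqsum_shift_seq f s : sqsummable f -> sqsummable (shift_seq f s).
Proof.
move=> /(asum_shift_seq s); congr abs_summable; apply/funext => k.
by rewrite /shift_seq; case: ifP; rewrite // expr0n.
Qed.

(** For [c] this will be gamma(s - t), by [covariance_gram]; as an inner product of shifts it is
    symmetric and Toeplitz. *)
Definition gram f s t : R := tsum (fun k => shift_seq f s k * shift_seq f t k).

Lemma gramC f s t : gram f s t = gram f t s.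
Proof. by apply: eq_tsum => k; rewrite mulrC. Qed.

Lemma gram_add f s t k : sqsummable f -> gram f (s + k) (t + k) = gram f s t.
Proof.
move=> sf; rewrite /gram (@tsum_split _ k); last by apply: asumM; exact: sqsum_shift_seq.
rewrite big_nat big1 ?add0r => [|i /andP[_ ik]]; last first.
  by rewrite /shift_seq leqNgt ltn_addl// mul0r.
by apply: eq_tsum => n; rewrite /shift_seq !leq_add2r !subnDr.
Qed.

Lemma gram0E f t : sqsummable f -> gram f 0 t = tsum (fun v => f (v + t)%N * f v).
Proof.
move=> sf; rewrite -(@tsum_shift_seq _ _ t); last by apply: asumM => //; exact: sqsum_shift.
apply: eq_tsum => k; rewrite /shift_seq leq0n subn0.
by case: ifP => tk; rewrite ?subnK// mulr0.
Qed.

Lemma gram_rev f K s t : sqsummable f -> (s <= K)%N -> (t <= K)%N ->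
  gram f (K - s) (K - t) = gram f s t.
Proof.
move=> sf; wlog st : s t / (s <= t)%N => [H sK tK|sK tK].
  by have [/H->//|/ltnW/H] := leqP s t; rewrite gramC [RHS]gramC; apply.
have -> : (K - s = (t - s) + (K - t))%N by lia.
rewrite -{2}[(K - t)%N]add0n gram_add// gramC -{2}(subnK st) -{2}[s]add0n.
by rewrite gram_add.
Qed.

Definition lincomb f (K : nat) p (k : nat) : R :=
  \sum_(0 <= s < K) p s * shift_seq f s k.

Lemma sqsum_lincomb f K p : sqsummable f -> sqsummable (lincomb f K p).
Proof.
by move=> sf; apply: sqsum_sum => s _; apply: sqsumZ; exact: sqsum_shift_seq.
Qed.

Lemma sqnorm_lincomb f K p : sqsummable f ->
  sqnorm (lincomb f K p) =
  \sum_(0 <= s < K) \sum_(0 <= t < K) p s * p t * gram f s t.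
Proof.
move=> sf.
have sst s t : abs_summable (fun k => p s * p t * (shift_seq f s k * shift_seq f t k)).
  by apply: asumZ; apply: asumM; exact: sqsum_shift_seq.
transitivity (tsum (fun k => \sum_(0 <= s < K) \sum_(0 <= t < K)
    p s * p t * (shift_seq f s k * shift_seq f t k))).
  apply: eq_tsum => k; rewrite expr2 /lincomb mulr_suml; apply: eq_bigr => s _.
  by rewrite mulr_sumr; apply: eq_bigr => t _; ring.
rewrite tsum_sum => [|s _]; last by apply: asum_sum => t _.
apply: eq_bigr => s _; rewrite tsum_sum => [|t _//].
by apply: eq_bigr => t _; rewrite tsumZ//; apply: asumM; exact: sqsum_shift_seq.
Qed.

(** The norm is a quadratic form in the Gram matrix, and a symmetric Toeplitz matrix is invariant
    under reversal of both indices. Reversal plays the role of replacing A by its conjugate on the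
    circle. *)
Lemma sqnorm_lincomb_rev f K p : sqsummable f ->
  sqnorm (lincomb f K.+1 (fun s => p (K - s)%N)) = sqnorm (lincomb f K.+1 p).
Proof.
move=> sf; rewrite !sqnorm_lincomb// big_nat_rev/=.
apply: eq_big_nat => s /andP[_ sK]; rewrite big_nat_rev/=.
apply: eq_big_nat => t /andP[_ tK]; rewrite !add0n !subSS !subKn ?gram_rev//.
Qed.

End gram.

(** * Bounds on l^2 for convolution, correlation and Hankel matrices of [a] *)

Section Hankel_contraction.
Context {R : realType}.
Variables a c : nat -> R.
Hypothesis sa : abs_summable a.
Hypothesis sc : sqsummable c.
Hypothesis ac : forall n, conv a c n = - (n == 0%N)%:R.
Implicit Types x p : nat -> R.

Let sa2 : sqsummable a. Proof. exact: sqsum_asum. Qed.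

Let S := tsum (fun n => `|a n|).

(** Convolution with [a] is minus the inverse of convolution with [c]; this is how vanishing or
    decay of c * x is passed on to x. *)
Lemma conv_acK x n : conv a (conv c x) n = - x n.
Proof.
rewrite convA /conv big_nat_recl//= subn0 -/(conv a c 0) ac mulN1r.
by rewrite big1 ?addr0// => i _; rewrite -/(conv a c i.+1) ac oppr0 mul0r.
Qed.

Let psum_S m n : \sum_(m <= i < n) `|a i| <= S.
Proof.
apply: (@le_trans _ _ (\sum_(0 <= i < n) `|a i|)); last first.
  by apply: psum_le_tsum => //; exact: asum_norm.
have [mn|nm] := leqP m n; last by rewrite (big_geq (ltnW nm)) sumr_ge0.
by rewrite (big_cat_nat (leq0n _) mn)/= lerDr sumr_ge0.
Qed.

Let lower i j : R := `|shift_seq a j i|.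
Let upper i j : R := `|shift_seq a i j|.

Let upper_row i n : \sum_(0 <= j < n) upper i j <= S.
Proof.
apply: (@le_trans _ _ (tsum (fun j => `|shift_seq a i j|))).
  by apply: (@psum_le_tsum _ (fun j => `|shift_seq a i j|)) => //;
    apply: asum_norm; exact: asum_shift_seq.
rewrite /S -(tsum_shift_seq i (asum_norm sa)); apply: le_tsum => [k||].
- by rewrite /shift_seq; case: ifP => //; rewrite normr0.
- by apply: asum_norm; exact: asum_shift_seq.
- by apply: asum_shift_seq; exact: asum_norm.
Qed.

Let lower_row i n : \sum_(0 <= j < n) lower i j <= S.
Proof.
apply: (@le_trans _ _ (\sum_(0 <= j < i.+1) lower i j)).
  have [ni|/ltnW i_n] := leqP n i.+1.
    by rewrite [leRHS](big_cat_nat (leq0n _) ni)/= lerDl sumr_ge0// => j _; exact: normr_ge0.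
  rewrite (big_cat_nat (leq0n _) i_n)/= gerDl big_nat big1// => j /andP[ij _].
  by rewrite /lower /shift_seq leqNgt ij normr0.
apply: le_trans (psum_S 0 i.+1); rewrite big_nat_rev/=.
apply: ler_sum_nat => j /andP[_ ji].
by rewrite add0n subSS /lower /shift_seq leq_subr subKn.
Qed.

Let hankel_row i n : \sum_(0 <= j < n) `|a (i + j)%N| <= S.
Proof.
apply: le_trans (psum_S i (n + i)); rewrite sum_nat_shift.
by apply: ler_sum => j _; rewrite addnC.
Qed.

Let hankel_col j n : \sum_(0 <= i < n) `|a (i + j)%N| <= S.
Proof. by under eq_bigr do rewrite addnC; exact: hankel_row. Qed.

Let u0 i j : 0 <= upper i j. Proof. exact: normr_ge0. Qed.

Let l0 i j : 0 <= lower i j. Proof. exact: normr_ge0. Qed.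

Let h0 i j : 0 <= (`|a (i + j)%N| : R). Proof. exact: normr_ge0. Qed.

(** The upper and lower Toeplitz triangles of |a| and its Hankel matrix have row and column sums at
    most [S], the l^1 norm of [a], so Schur's test applies to all three. The triangles stand for
    correlation and convolution with [a]. *)
Lemma Schur_upper p : sqsummable p ->
  (forall i, abs_summable (fun j => shift_seq a i j * p j)) /\
  sqsummable (fun i => tsum (fun j => `|shift_seq a i j * p j|)).
Proof.
move=> sp.
have H (g : nat -> R) i j : `| `|shift_seq a i j| * g j| = `|shift_seq a i j * g j|.
  by rewrite !normrM normr_id.
split=> [i|].
  have /asum_norm := Schur_row u0 upper_row sp i.
  by apply: asum_le => j; rewrite H.
have := Schur_sqsum u0 upper_row lower_row sp.
by congr sqsummable; apply/funext => i; apply: eq_tsum => j; rewrite H.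
Qed.

Lemma Schur_lower p : sqsummable p ->
  [/\ forall i, abs_summable (fun j => shift_seq a j i * p j),
    sqsummable (fun i => tsum (fun j => `|shift_seq a j i * p j|)) &
    sqnorm (fun i => tsum (fun j => `|shift_seq a j i * p j|)) <= S ^+ 2 * sqnorm p].
Proof.
move=> sp.
have H (g : nat -> R) i j : `| `|shift_seq a j i| * g j| = `|shift_seq a j i * g j|.
  by rewrite !normrM normr_id.
have E : (fun i => tsum (fun j => `| `|shift_seq a j i| * p j|)) =
    (fun i => tsum (fun j => `|shift_seq a j i * p j|)).
  by apply/funext => i; apply: eq_tsum => j; rewrite H.
split=> [i||]; last 2 first.
- by rewrite -E; exact: (Schur_sqsum l0 lower_row upper_row sp).
- by rewrite -E; exact: (Schur_sqnorm l0 lower_row upper_row sp).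
have /asum_norm := Schur_row l0 lower_row sp i.
by apply: asum_le => j; rewrite H.
Qed.

Lemma Schur_hankel p : sqsummable p ->
  (forall i, abs_summable (fun j => a (i + j)%N * p j)) /\
  sqsummable (fun i => tsum (fun j => `|a (i + j)%N * p j|)).
Proof.
move=> sp.
have H (g : nat -> R) i j : `| `|a (i + j)%N| * g j| = `|a (i + j)%N * g j|.
  by rewrite !normrM normr_id.
split=> [i|].
  have /asum_norm := Schur_row h0 hankel_row sp i.
  by apply: asum_le => j; rewrite H.
have := Schur_sqsum h0 hankel_row hankel_col sp.
by congr sqsummable; apply/funext => i; apply: eq_tsum => j; rewrite H.
Qed.

End Hankel_contraction.

(** * Bessel's inequality by reversal of a finite block *)

Section Bessel.
Context {R : realType}.
Variables a c : nat -> R.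
Hypothesis sa : abs_summable a.
Hypothesis sc : sqsummable c.
Hypothesis ac : forall n, conv a c n = - (n == 0%N)%:R.

Section finite_support.
Variables (x : nat -> R) (W : nat).
Hypothesis x0 : forall w, (W <= w)%N -> x w = 0.

Let p := conv c x.

Let S := tsum (fun n => `|a n|).

Lemma sqsum_conv_fin : sqsummable p.
Proof.
have := sqsum_lincomb W x sc; congr sqsummable; apply/funext => n.
by rewrite /p (@conv_shift_fin _ _ _ W).
Qed.

Let sp := sqsum_conv_fin.

Let q K n : R := if (n < K)%N then 0 else p n.

Let sq K : sqsummable (q K).
Proof.
apply: sqsum_le sp => n; rewrite /q; case: ifP => // _.
by rewrite normr0.
Qed.

Let q_cvg : sqnorm (q K) @[K --> \oo] --> (0 : R).
Proof.
have -> : (fun K => sqnorm (q K)) = (fun K => tsum (fun n => p (n + K)%N ^+ 2)).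
  apply/funext => K; rewrite /sqnorm (tsum_split K (sq K)).
  rewrite big_nat big1 ?add0r => [|i /andP[_ iK]]; last by rewrite /q iK expr0n.
  by apply: eq_tsum => n; rewrite /q ltnNge leq_addl.
exact: (@tsum_tail_cvg _ (fun n => p n ^+ 2)).
Qed.

(** Convolving [a] with [p] cut at K gives -x below K; from K on, where x vanishes because W <= K,
    it gives minus the contribution of the omitted tail [q K]. *)
Let z_le K k : (W <= K)%N -> lincomb a K p k ^+ 2 <=
  x k ^+ 2 + tsum (fun j => `|shift_seq a j k * q K j|) ^+ 2.
Proof.
move=> WK; have conv_pa : conv p a k = - x k by rewrite convC conv_acK.
have [kK|Kk] := ltnP k K.
  have -> : lincomb a K p k = - x k.
    rewrite -conv_pa conv_shift /lincomb (big_cat_nat (leq0n k.+1) kK)/=.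
    rewrite [X in _ + X]big_nat [X in _ + X]big1 ?addr0// => i /andP[ki _].
    by rewrite /shift_seq leqNgt ki mulr0.
  by rewrite sqrrN lerDl sqr_ge0.
have xk0 : x k = 0 by apply: x0; exact: leq_trans WK Kk.
rewrite xk0 expr0n add0r.
have [srow _ _] := Schur_lower sa (sq K).
have -> : lincomb a K p k = - \sum_(K <= j < k.+1) p j * shift_seq a j k.
  apply/eqP; rewrite -subr_eq0 opprK; apply/eqP.
  rewrite /lincomb -(big_cat_nat (leq0n K) (leqW Kk))/= -conv_shift conv_pa.
  by rewrite xk0 oppr0.
rewrite sqrrN -[leLHS]real_normK ?num_real// lerXn2r ?nnegrE//.
  by apply: tsum_ge0 => //; exact: asum_norm.
apply: le_trans (psum_le_tsum k.+1 _ (asum_norm (srow k))) => //.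
rewrite [leRHS](big_cat_nat (leq0n K) (leqW Kk))/=.
apply: le_trans (ler_norm_sum _ _ _) _.
rewrite -[leLHS]add0r; apply: lerD; first exact: sumr_ge0.
apply: ler_sum_nat => j /andP[Kj _].
by rewrite /q ltnNge Kj mulrC.
Qed.

Let sqnorm_z K : (W <= K)%N ->
  sqnorm (lincomb a K p) <= sqnorm x + S ^+ 2 * sqnorm (q K).
Proof.
move=> WK; have [_ ssq Sle] := Schur_lower sa (sq K).
have sx : sqsummable x by apply: (@asum_fin _ W) => w /x0 ->; rewrite expr0n.
apply: (@le_trans _ _ (tsum (fun k => x k ^+ 2 +
    tsum (fun j => `|shift_seq a j k * q K j|) ^+ 2))).
  apply: le_tsum => [k||]; [exact: z_le|exact/sqsum_lincomb/sqsum_asum|].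
  exact: asumD.
by rewrite tsumD// lerD2l.
Qed.

(** With A and P the Fourier series of [a] and [p], the function conj(A) P has coefficient
    [pos_part m] at e^{-imt} and [neg_part k] at e^{ikt}. *)
Definition pos_part m : R := tsum (fun t => a (m + t)%N * p t).
Definition neg_part k : R := tsum (fun t => shift_seq a k t * p t).

(** Reversing the first K + 1 coefficients of [p] moves frequency 0 to index K: index K - k then
    carries a partial sum of [neg_part k], and index K + 1 + m one of [pos_part m.+1]. Both windows
    lie in one vector, so their energies add. *)
Let window K L : (W <= K)%N -> (L <= K)%N ->
  \sum_(0 <= m < L) (series (fun t => a (m.+1 + t)%N * p t) K.+1) ^+ 2 +
  \sum_(0 <= k < L) (series (fun t => shift_seq a k t * p t) K.+1) ^+ 2 <=
  sqnorm x + S ^+ 2 * sqnorm (q K.+1).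
Proof.
move=> WK LK; apply: le_trans (sqnorm_z (leqW WK)).
have sa2 := sqsum_asum sa.
rewrite -sqnorm_lincomb_rev//; set z := lincomb a K.+1 _.
apply: (@le_trans _ _ (\sum_(0 <= j < L + K.+1) z j ^+ 2)); last first.
  by apply: psum_le_tsum; [move=> n; exact: sqr_ge0|exact: sqsum_lincomb].
have zE j : z j = \sum_(0 <= t < K.+1) p t * shift_seq a (K - t)%N j.
  rewrite /z /lincomb big_nat_rev/=; apply: eq_big_nat => t /andP[_ tK].
  by rewrite add0n subSS subKn.
rewrite (big_cat_nat (leq0n K.+1) (leq_addl _ _))/= sum_nat_shift [leLHS]addrC lerD//.
  rewrite [leRHS]big_nat_rev/= [leRHS](big_cat_nat (leq0n L) (leqW LK))/=.
  rewrite -[leLHS]addr0; apply: lerD; last by apply: sumr_ge0 => i _; exact: sqr_ge0.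
  apply: ler_sum_nat => k /andP[_ kL]; rewrite add0n subSS zE.
  rewrite le_eqVlt; apply/orP; left; apply/eqP; congr (_ ^+ 2).
  apply: eq_big_nat => t /andP[_ tK]; rewrite mulrC /shift_seq; congr (_ * _).
  have kK : (k <= K)%N by apply: ltnW; exact: leq_trans LK.
  have -> : (K - t <= K - k)%N = (k <= t)%N by lia.
  by case: ifP => // kt; congr a; lia.
apply: ler_sum_nat => m _; rewrite zE.
rewrite le_eqVlt; apply/orP; left; apply/eqP; congr (_ ^+ 2).
apply: eq_big_nat => t /andP[_ tK]; rewrite mulrC /shift_seq; congr (_ * _).
by rewrite ifT; [congr a; lia|lia].
Qed.

(** In [window] the width L stays fixed while K tends to infinity, and the tail of [p] drops out. *)
Lemma Bessel_fin L :
  \sum_(0 <= m < L) pos_part m.+1 ^+ 2 + \sum_(0 <= k < L) neg_part k ^+ 2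
  <= sqnorm x.
Proof.
have [hrow _] := Schur_hankel sa sp; have [urow _] := Schur_upper sa sp.
have shiftK (u : nat -> R) (l : R) : u @ \oo --> l -> (fun K => u K.+1) @ \oo --> l.
  by move=> ul; rewrite -(cvg_shiftn 1) in ul; under eq_fun do rewrite -addn1.
have -> : sqnorm x = sqnorm x + S ^+ 2 * 0 by rewrite mulr0 addr0.
apply: (@ler_cvg_to _ \oo _ _ (fun K =>
  \sum_(0 <= m < L) (series (fun t => a (m.+1 + t)%N * p t) K.+1) ^+ 2 +
  \sum_(0 <= k < L) (series (fun t => shift_seq a k t * p t) K.+1) ^+ 2)
  (fun K => sqnorm x + S ^+ 2 * sqnorm (q K.+1))).
- apply: cvgD; apply: cvg_sum_seq => m _.
    rewrite !expr2; have := shiftK _ _ (tsum_cvg (hrow m.+1)) => h.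
    by under eq_fun do rewrite expr2; exact: cvgM.
  have := shiftK _ _ (tsum_cvg (urow m)) => h.
  by rewrite expr2; under eq_fun do rewrite expr2; exact: cvgM.
- apply: cvgD; first exact: cvg_cst.
  by apply: cvgM; [exact: cvg_cst|exact: (shiftK _ _ q_cvg)].
- near=> K; apply: window; near: K; exact: nbhs_infty_ge.
Unshelve. all: by end_near. Qed.

End finite_support.

End Bessel.

(** * The Hankel operator of the coefficients beta *)

Lemma weak_cvg0 {R : realType} (u : nat -> nat -> R) (M : R) (r : nat -> R) :
  (forall k, sqsummable (u k)) -> (forall k, sqnorm (u k) <= M) ->
  (forall i, u k i @[k --> \oo] --> (0 : R)) -> sqsummable r ->
  tsum (fun i => u k i * r i) @[k --> \oo] --> (0 : R).
Proof.
move=> su uM u0 sr; apply/cvgrPdist_le => e e0.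
have M0 : 0 <= M by apply: le_trans (uM 0%N); exact: sqnorm_ge0.
have := @tsum_tail_cvg _ (fun n => r n ^+ 2) sr.
(* By Cauchy-Schwarz the part of the sum beyond U is then at most e / 2, uniformly in k; the added 1
   allows for M = 0. *)
move=> /cvgrPdist_le/(_ (e ^+ 2 / 4 / (M + 1)))[|U _ /(_ U (leqnn U))/=].
  by rewrite !divr_gt0 ?exprn_gt0// ltr_wpDl.
rewrite sub0r normrN ler_pdivlMr ?ltr_wpDl// => tailU.
have := @cvg_sum_seq _ (index_iota 0 U) (fun i k => u k i * r i) (fun=> 0).
rewrite big1_eq => /(_ _)/cvgrPdist_le/(_ (e / 2)) [i _||N _ headU].
- by rewrite -(mul0r (r i)); apply: cvgM; [exact: u0|exact: cvg_cst].
- by rewrite divr_gt0.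
exists N => // k /headU/=; rewrite !sub0r !normrN => head.
rewrite (tsum_split U (asumM (su k) sr)) (splitr e).
apply: le_trans (ler_normD _ _) _; apply: lerD => //.
rewrite -ler_sqr ?nnegrE ?divr_ge0 ?(ltW e0)// real_normK ?num_real//.
apply: le_trans (tsumM_CauchySchwarz (sqsum_shift U (su k)) (sqsum_shift U sr)) _.
have -> : (e / 2) ^+ 2 = e ^+ 2 / 4 by field.
apply: le_trans tailU; rewrite mulrC; apply: ler_pM.
- by apply: sqnorm_ge0; exact: sqsum_shift.
- by apply: sqnorm_ge0; exact: sqsum_shift.
- exact: ler_norm.
- apply: le_trans (_ : M <= M + 1); last by rewrite lerDl.
  apply: le_trans (uM k); rewrite /sqnorm [leRHS](tsum_split U)//; last exact: su.
  by rewrite lerDr sumr_ge0// => i _; exact: sqr_ge0.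
Qed.

Section Hankel_operator.
Context {R : realType}.
Variables a c : nat -> R.
Hypothesis sa : abs_summable a.
Hypothesis sc : sqsummable c.
Hypothesis ac : forall n, conv a c n = - (n == 0%N)%:R.

Local Notation beta := (beta_coef c a).

Let sa2 : sqsummable a. Proof. exact: sqsum_asum. Qed.

Lemma asum_beta m : abs_summable (fun v => c v * a (v + m)%N).
Proof. by apply: asumM => //; exact: sqsum_shift. Qed.

(** With absolute values inside the sum: the majorant needed for double sums that involve [beta]. *)
Definition abs_beta m : R := tsum (fun v => `|c v * a (v + m)%N|).

Lemma sqsum_abs_beta : sqsummable abs_beta.
Proof.
have [_] := Schur_hankel sa sc; congr sqsummable; apply/funext => i.
by apply: eq_tsum => j; rewrite mulrC addnC.
Qed.

Lemma abs_beta_ge0 m : 0 <= abs_beta m.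
Proof. by apply: tsum_ge0 => //; apply: asum_norm; exact: asum_beta. Qed.

Lemma ler_norm_beta m : `|beta m| <= abs_beta m.
Proof. by apply: ler_norm_tsum; exact: asum_beta. Qed.

Lemma sqsum_beta : sqsummable beta.
Proof.
apply: sqsum_le sqsum_abs_beta => n.
by rewrite (ger0_norm (abs_beta_ge0 _)) ler_norm_beta.
Qed.

Lemma dsum_a_beta m : dsummable (fun w v => a w * (c v * a (v + (m + w))%N)).
Proof.
apply: (@dsummable_intro _ _ (fun w => `|a w| * abs_beta (m + w))).
- by move=> w; apply: asumZ; exact: asum_beta.
- move=> w; under eq_tsum do rewrite normrM.
  by rewrite tsumZ//; apply: asum_norm; exact: asum_beta.
- apply: asumM; first exact: sqsum_norm.
  by under eq_fun do rewrite addnC; exact: (sqsum_shift m sqsum_abs_beta).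
Qed.

Lemma asum_a_beta m : abs_summable (fun w => a w * beta (m + w)).
Proof.
apply: asumM => //.
by under eq_fun do rewrite addnC; exact: (sqsum_shift m sqsum_beta).
Qed.

(** In the double sum of a_w c_v a_{v+w+m}, the terms with v + w = t add up to a_{t+m} times the
    coefficient t of a * c = - delta, so only t = 0 remains. *)
Lemma tsum_a_beta m : tsum (fun w => a w * beta (m + w)) = - a m.
Proof.
transitivity (tsum (fun w => tsum (fun v => a w * (c v * a (v + (m + w))%N)))).
  by apply: eq_tsum => w; rewrite tsumZ//; exact: asum_beta.
rewrite -(tsum_diag (dsum_a_beta m)).
transitivity (tsum (fun t => conv a c t * a (m + t)%N)).
  apply: eq_tsum => t; rewrite convC /conv mulr_suml.
  rewrite big_nat_rev/= [in RHS]big_nat_rev/=; apply: eq_big_nat => s /andP[_ st].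
  rewrite !add0n subSS [RHS](_ : _ = c (t - s)%N * a s * a (m + t)%N); last first.
    by rewrite subKn.
  by rewrite subKn// [RHS]mulrAC [RHS]mulrC; congr (_ * (_ * a _)); lia.
rewrite (@tsum_fin _ 1); first by rewrite big_nat1 ac eqxx mulN1r addn0.
by move=> -[|n]// _; rewrite ac/= oppr0 mul0r.
Qed.

Lemma a0c0 : a 0%N * c 0%N = -1.
Proof. by have := ac 0; rewrite /conv big_nat1. Qed.

Lemma c0_neq0 : c 0%N != 0.
Proof. by apply/eqP => c0; have := a0c0; rewrite c0 mulr0 => /eqP; rewrite eq_sym oppr_eq0 oner_eq0. Qed.

Lemma sqnorm_c_gt0 : 0 < sqnorm c.
Proof.
apply: lt_le_trans (@term_le_tsum _ (fun n => c n ^+ 2) 0 _ sc).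
  by rewrite lt_def sqrf_eq0 c0_neq0 sqr_ge0.
by move=> n; exact: sqr_ge0.
Qed.

Definition Hankel (N : nat) (x : nat -> R) (j : nat) : R :=
  tsum (fun w => beta (N + j + w) * x w).

Lemma sqsum_betaD m : sqsummable (fun w => beta (m + w)).
Proof. by under eq_fun do rewrite addnC; exact: (sqsum_shift m sqsum_beta). Qed.

Lemma asum_Hankel N x j : sqsummable x ->
  abs_summable (fun w => beta (N + j + w) * x w).
Proof. by apply: asumM; exact: sqsum_betaD. Qed.

Section finite_support.
Variables (x : nat -> R) (W : nat).
Hypothesis x0 : forall w, (W <= w)%N -> x w = 0.

Let p := conv c x.
Let sp : sqsummable p := sqsum_conv_fin sc x0.

(** After expanding p = c * x, the sum over t of a_{m+t} c_{t-w} is [beta] at m + w. *)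
Let pos_partE m : pos_part a c x m = tsum (fun w => beta (m + w) * x w).
Proof.
rewrite (@tsum_fin _ W); last by move=> w /x0 ->; rewrite mulr0.
have sw w : abs_summable (fun v => c v * a (m + (v + w))%N).
  apply: asumM => //; under eq_fun do rewrite addnCA; exact: sqsum_shift.
have swE w : (fun t => shift_seq c w t * a (m + t)%N) =
    shift_seq (fun v => c v * a (m + (v + w))%N) w.
  apply/funext => t; rewrite /shift_seq.
  by case: ifP => wt; rewrite ?mul0r// subnK.
transitivity (tsum (fun t => \sum_(0 <= w < W) x w * (shift_seq c w t * a (m + t)%N))).
  apply: eq_tsum => t; rewrite (conv_shift_fin _ _ x0) mulr_sumr.
  by apply: eq_bigr => w _; ring.
rewrite tsum_sum => [|w _]; last by apply: asumZ; rewrite swE; exact: asum_shift_seq.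
apply: eq_bigr => w _; rewrite tsumZ ?swE; last exact: asum_shift_seq.
rewrite tsum_shift_seq// mulrC; congr (_ * _).
by apply: eq_tsum => v; rewrite addnCA.
Qed.

Let neg_partE i : neg_part a c x i = tsum (fun s => a s * p (s + i)%N).
Proof.
have si : abs_summable (fun s => a s * p (s + i)%N).
  by apply: asumM => //; exact: sqsum_shift.
rewrite -(tsum_shift_seq i si); apply: eq_tsum => t; rewrite /shift_seq.
by case: ifP => it; rewrite ?mul0r// subnK.
Qed.

Let sqsum_neg_abs t : sqsummable (fun k => tsum (fun s => `|a s * p (s + (k + t))%N|)).
Proof.
have [_] := Schur_upper sa sp; move/(sqsum_shift t); congr sqsummable.
apply/funext => k.
have ski : abs_summable (fun s => a s * p (s + (k + t))%N).
  by apply: asumM => //; exact: sqsum_shift.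
rewrite -(tsum_shift_seq (k + t) (asum_norm ski)); apply: eq_tsum => j.
by rewrite /shift_seq; case: ifP => kj; rewrite ?mul0r ?normr0// subnK.
Qed.

Let dsum_neg t : dsummable (fun k s => c k * (a s * p (s + (k + t))%N)).
Proof.
have ski k : abs_summable (fun s => a s * p (s + (k + t))%N).
  by apply: asumM => //; exact: sqsum_shift.
apply: (@dsummable_intro _ _
  (fun k => `|c k| * tsum (fun s => `|a s * p (s + (k + t))%N|))).
- by move=> k; apply: asumZ.
- move=> k; under eq_tsum do rewrite normrM.
  by rewrite tsumZ//; exact: asum_norm.
- by apply: asumM => //; exact: sqsum_norm.
Qed.

(** Correlation with [c] undoes correlation with [a] up to sign, again because a * c = - delta. So
    [p] is recovered from the nonnegative frequencies of conj(A) P alone. *)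
Let conv_neg t : p t = - tsum (fun k => c k * neg_part a c x (k + t)).
Proof.
have ski k : abs_summable (fun s => a s * p (s + (k + t))%N).
  by apply: asumM => //; exact: sqsum_shift.
transitivity (- tsum (fun k => tsum (fun s => c k * (a s * p (s + (k + t))%N)))).
  rewrite -(tsum_diag (dsum_neg t)).
  transitivity (- tsum (fun i => conv a c i * p (i + t)%N)).
    rewrite (@tsum_fin _ 1); first by rewrite big_nat1 ac eqxx mulN1r opprK.
    by move=> -[|n]// _; rewrite ac/= oppr0 mul0r.
  congr (- _); apply: eq_tsum => i; rewrite /conv mulr_suml.
  apply: eq_big_nat => s /andP[_ si].
  by rewrite mulrAC [LHS]mulrC; congr (_ * (_ * p _)); lia.
by congr (- _); apply: eq_tsum => k; rewrite neg_partE tsumZ.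
Qed.

Let sqsum_neg t : sqsummable (fun k => neg_part a c x (k + t)).
Proof.
apply: sqsum_le (sqsum_neg_abs t) => k; rewrite neg_partE.
have ski : abs_summable (fun s => a s * p (s + (k + t))%N).
  by apply: asumM => //; exact: sqsum_shift.
rewrite [leRHS]ger0_norm ?ler_norm_tsum//.
by apply: tsum_ge0 => //; exact: asum_norm.
Qed.

(** By [conv_neg] and Cauchy-Schwarz, the square of c * x at t is at most |c|^2 times the energy of
    [neg_part], while [Hankel N x] is a stretch of [pos_part] starting at N >= 1. Bessel's
    inequality bounds both energies together. *)
Lemma Hankel_contraction_fin N t L : (0 < N)%N ->
  sqnorm c * (\sum_(0 <= m < L) Hankel N x m ^+ 2) + conv c x t ^+ 2 <=
  sqnorm c * sqnorm x.
Proof.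
move=> N0; rewrite -/p conv_neg sqrrN.
apply: le_trans (lerD (lexx _) (tsumM_CauchySchwarz sc (sqsum_neg t))) _.
rewrite -mulrDr ler_pM2l ?sqnorm_c_gt0//.
rewrite -lerBrDl; apply: tsum_le_bound; first exact: sqsum_neg.
move=> n; rewrite lerBrDl.
(* Long enough for both stretches: [pos_part m.+1] with m below L + N - 1, and [neg_part] below n +
   t. *)
apply: le_trans (Bessel_fin sa sc ac x0 (L + N + n + t)); apply: lerD.
  have -> : \sum_(0 <= m < L) Hankel N x m ^+ 2 =
      \sum_(N.-1 <= m < L + N.-1) pos_part a c x m.+1 ^+ 2.
    rewrite sum_nat_shift; apply: eq_bigr => m _; rewrite pos_partE /Hankel.
    by rewrite -addnS prednK// [(m + N)%N]addnC.
  rewrite [leRHS](@big_cat_nat _ _ _ (L + N.-1))//=; last by lia.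
  rewrite (big_cat_nat (leq0n N.-1) (leq_addl _ _))/= -addrA -[leLHS]add0r.
  apply: lerD; first by apply: sumr_ge0 => i _; exact: sqr_ge0.
  by rewrite lerDl; apply: sumr_ge0 => i _; exact: sqr_ge0.
rewrite -(sum_nat_shift (fun k => neg_part a c x k ^+ 2)).
rewrite [leRHS](@big_cat_nat _ _ _ (n + t))//=; last by lia.
rewrite (big_cat_nat (leq0n t) (leq_addl _ _))/= -addrA -[leLHS]add0r.
apply: lerD; first by apply: sumr_ge0 => i _; exact: sqr_ge0.
by rewrite lerDl; apply: sumr_ge0 => i _; exact: sqr_ge0.
Qed.

End finite_support.

End Hankel_operator.

(** * Contraction on all of l^2 and decay of the iterates *)

Section Hankel_iterates.
Context {R : realType}.
Variables a c : nat -> R.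
Hypothesis sa : abs_summable a.
Hypothesis sc : sqsummable c.
Hypothesis ac : forall n, conv a c n = - (n == 0%N)%:R.

Local Notation beta := (beta_coef c a).
Local Notation Hankel := (Hankel a c).

(** Truncate x at W and let W tend to infinity: [conv c x t] involves only the first t + 1 entries
    of x, so it is unchanged as soon as t < W. *)
Lemma Hankel_defect_psum N t L x : (0 < N)%N -> sqsummable x ->
  sqnorm c * (\sum_(0 <= m < L) Hankel N x m ^+ 2) + conv c x t ^+ 2 <=
  sqnorm c * sqnorm x.
Proof.
move=> N0 sx; pose xt W n := if (n < W)%N then x n else 0.
have xt0 W n : (W <= n)%N -> xt W n = 0 by rewrite /xt ltnNge => ->.
have HtE W m : Hankel N (xt W) m = series (fun w => beta (N + m + w) * x w) W.
  rewrite /Hankel (@tsum_fin _ W) => [|w /xt0->]; last by rewrite mulr0.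
  by apply: eq_big_nat => w /andP[_ wW]; rewrite /xt wW.
have Ht_cvg m : Hankel N (xt W) m @[W --> \oo] --> Hankel N x m.
  under eq_fun do rewrite HtE.
  exact: (tsum_cvg (asum_Hankel sa sc N m sx)).
have ct W : (t < W)%N -> conv c (xt W) t = conv c x t.
  move=> tW; apply: eq_big_nat => s /andP[_ st].
  by rewrite /xt (leq_ltn_trans (leq_subr _ _) tW).
have xt_le W : sqnorm (xt W) <= sqnorm x.
  rewrite /sqnorm (@tsum_fin _ W) => [|w /xt0->]; last by rewrite expr0n.
  apply: le_trans (psum_sqnorm W sx).
  by apply: ler_sum_nat => w /andP[_ wW]; rewrite /xt wW.
apply: (@ler_cvg_to _ \oo _ _ (fun W =>
  sqnorm c * (\sum_(0 <= m < L) Hankel N (xt W) m ^+ 2) + conv c x t ^+ 2)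
  (fun W => sqnorm c * sqnorm x)); last 1 first.
- near=> W; have tW : (t < W)%N by near: W; exact: nbhs_infty_gt.
  rewrite -(ct W tW); apply: le_trans (Hankel_contraction_fin sa sc ac (xt0 W) t L N0) _.
  by rewrite ler_wpM2l ?sqnorm_ge0.
- apply: cvgD; last exact: cvg_cst.
  apply: cvgM; first exact: cvg_cst.
  apply: cvg_sum_seq => m _; rewrite expr2; under eq_fun do rewrite expr2.
  exact: cvgM.
- exact: cvg_cst.
Unshelve. all: by end_near. Qed.

Section index.
Variable N : nat.
Hypothesis N0 : (0 < N)%N.

Let psum_Hankel L x : sqsummable x ->
  \sum_(0 <= m < L) Hankel N x m ^+ 2 <= sqnorm x.
Proof.
move=> sx; rewrite -(ler_pM2l (sqnorm_c_gt0 sc ac)).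
apply: le_trans (Hankel_defect_psum 0 L N0 sx).
by rewrite lerDl sqr_ge0.
Qed.

Lemma sqsum_Hankel x : sqsummable x -> sqsummable (Hankel N x).
Proof.
move=> sx; exists (sqnorm x) => L.
by under eq_bigr do rewrite ger0_norm ?sqr_ge0//; exact: psum_Hankel.
Qed.

Lemma sqnorm_Hankel_le x : sqsummable x -> sqnorm (Hankel N x) <= sqnorm x.
Proof.
by move=> sx; apply: tsum_le_bound => [|L]; [exact: sqsum_Hankel|exact: psum_Hankel].
Qed.

Lemma Hankel_defect t x : sqsummable x ->
  conv c x t ^+ 2 <= sqnorm c * (sqnorm x - sqnorm (Hankel N x)).
Proof.
move=> sx; have c0 := sqnorm_c_gt0 sc ac.
rewrite mulrBr lerBrDl -lerBrDr -ler_pdivlMl// mulrC.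
apply: tsum_le_bound => [|L]; first exact: sqsum_Hankel.
by rewrite ler_pdivlMr// mulrC lerBrDr; exact: Hankel_defect_psum.
Qed.

Lemma HankelB x y j : sqsummable x -> sqsummable y ->
  Hankel N (fun n => x n - y n) j = Hankel N x j - Hankel N y j.
Proof.
move=> sx sy; rewrite /Hankel -tsumB; [|exact: asum_Hankel|exact: asum_Hankel].
by apply: eq_tsum => w; rewrite mulrBr.
Qed.

(** Absolute convergence of the double series in x, [beta] and r is not at hand. Symmetry is clear
    for the truncations [z K], and the remainder [y K] is controlled by the contraction property and
    Cauchy-Schwarz. *)
Lemma Hankel_sym x r : sqsummable x -> sqsummable r ->
  tsum (fun u => x u * Hankel N r u) = tsum (fun u => Hankel N x u * r u).
Proof.
move=> sx sr; pose y K n := if (n < K)%N then 0 else x n.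
pose z K n := if (n < K)%N then x n else 0.
have z0 K n : (K <= n)%N -> z K n = 0 by rewrite /z ltnNge => ->.
have sz K : sqsummable (z K) by apply: (@asum_fin _ K) => n /z0 ->; rewrite expr0n.
have sy K : sqsummable (y K).
  by apply: sqsum_le sx => n; rewrite /y; case: ifP => // _; rewrite normr0.
have yE K : y K = (fun n => x n - z K n).
  by apply/funext => n; rewrite /y /z; case: ifP => _; rewrite ?subrr ?subr0.
have sHr := sqsum_Hankel sr.
have zE K : \sum_(0 <= u < K) x u * Hankel N r u = tsum (fun u => Hankel N (z K) u * r u).
  transitivity (\sum_(0 <= u < K) tsum (fun w => x u * (beta (N + u + w) * r w))).
    by apply: eq_bigr => u _; rewrite tsumZ//; exact: asum_Hankel.
  rewrite -tsum_sum => [|u _]; last by apply: asumZ; exact: asum_Hankel.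
  apply: eq_tsum => w; rewrite /Hankel (@tsum_fin _ K) => [|u /z0->]; last by rewrite mulr0.
  rewrite mulr_suml; apply: eq_big_nat => u /andP[_ uK].
  by rewrite /z uK -addnA [(u + w)%N]addnC addnA; ring.
have y_cvg : sqnorm (y K) @[K --> \oo] --> (0 : R).
  have -> : (fun K => sqnorm (y K)) = (fun K => tsum (fun n => x (n + K)%N ^+ 2)).
    apply/funext => K; rewrite /sqnorm (tsum_split K (sy K)).
    rewrite big_nat big1 ?add0r => [|i /andP[_ iK]]; last by rewrite /y iK expr0n.
    by apply: eq_tsum => n; rewrite /y ltnNge leq_addl.
  exact: (@tsum_tail_cvg _ (fun n => x n ^+ 2)).
apply: tsum_eq; apply/cvgrPdist_le => e e0.
have /cvgrPdist_le := y_cvg; move=> /(_ (e ^+ 2 / (sqnorm r + 1)))[|K0 _ HK].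
  by rewrite divr_gt0 ?exprn_gt0// ltr_wpDl ?sqnorm_ge0.
exists K0 => // K /HK/=; rewrite sub0r normrN ler_pdivlMr ?ltr_wpDl ?sqnorm_ge0// => yK.
rewrite /series/= zE -tsumB; [|by apply: asumM => //; exact: sqsum_Hankel..].
under eq_tsum do rewrite -mulrBl -HankelB//.
rewrite -yE -ler_sqr ?nnegrE ?(ltW e0)// real_normK ?num_real//.
apply: le_trans (tsumM_CauchySchwarz (sqsum_Hankel (sy K)) sr) _.
apply: le_trans yK; apply: ler_pM.
- by apply: sqnorm_ge0; exact: sqsum_Hankel.
- exact: sqnorm_ge0.
- by rewrite ger0_norm ?sqnorm_ge0//; exact: sqnorm_Hankel_le.
- by rewrite lerDl.
Qed.

Local Notation d := (fun k => dcoef c a k N).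

Lemma dcoefS k : d k.+1 = Hankel N (d k).
Proof. by []. Qed.

Lemma sqsum_dcoef k : sqsummable (d k).
Proof.
elim: k => [|k ih]; last by rewrite dcoefS; exact: sqsum_Hankel.
by apply: (@asum_fin _ 1) => -[|n]//= _; rewrite expr0n.
Qed.

Let sqnorm_d_decr : nonincreasing_seq (fun k => sqnorm (d k)).
Proof.
apply/nonincreasing_seqP => k; rewrite dcoefS.
by apply: sqnorm_Hankel_le; exact: sqsum_dcoef.
Qed.

Let sqnorm_d_cvg : cvgn (fun k => sqnorm (d k)).
Proof.
apply: nonincreasing_is_cvgn; first exact: sqnorm_d_decr.
by exists 0 => _ [k _ <-]; apply: sqnorm_ge0; exact: sqsum_dcoef.
Qed.

(* [sqnorm (d k)] is nonincreasing, so the defect in [Hankel_defect] vanishes in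
   the limit; no strict contraction is needed. *)
Let conv_c_d_cvg t : conv c (d k) t @[k --> \oo] --> (0 : R).
Proof.
have H : sqnorm c * (sqnorm (d k) - sqnorm (d k.+1)) @[k --> \oo] --> (0 : R).
  rewrite -(mulr0 (sqnorm c)); apply: cvgM; first exact: cvg_cst.
  rewrite -(subrr (limn (fun k => sqnorm (d k)))); apply: cvgB => //.
  have := sqnorm_d_cvg; rewrite -(cvg_shiftn 1).
  by under [X in X @ _ --> _]eq_fun do rewrite addn1.
apply/cvgrPdist_le => e e0; move/cvgrPdist_le: H => /(_ (e ^+ 2)).
rewrite exprn_gt0// => /(_ isT); apply: filterS => k /=.
rewrite !sub0r !normrN => h.
rewrite -ler_sqr ?nnegrE ?(ltW e0)// real_normK ?num_real//.
apply: le_trans (Hankel_defect t (sqsum_dcoef k)) _.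
by apply: le_trans h; exact: ler_norm.
Qed.

Lemma dcoef_cvg0 u : d k u @[k --> \oo] --> (0 : R).
Proof.
have -> : (fun k => d k u) = (fun k => - conv a (conv c (d k)) u).
  by apply/funext => k; rewrite (conv_acK ac) opprK.
rewrite -oppr0; apply: cvgN; rewrite /conv.
rewrite -[X in _ --> X](@big1_eq R 0 +%R nat (index_iota 0 u.+1) xpredT).
apply: (@cvg_sum_seq _ _ _ (fun=> 0)) => s _; rewrite -[X in _ --> X](mulr0 (a s)).
by apply: cvgM; [exact: cvg_cst|exact: conv_c_d_cvg].
Qed.

Lemma dcoef_weak_cvg0 r : sqsummable r ->
  tsum (fun u => d k u * r u) @[k --> \oo] --> (0 : R).
Proof.
apply: (@weak_cvg0 _ _ (sqnorm (d 0%N))).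
- exact: sqsum_dcoef.
- by move=> k; exact: sqnorm_d_decr.
- exact: dcoef_cvg0.
Qed.

End index.

End Hankel_iterates.

(** * The coefficients b_k and the normal equations *)

Section b_coefficients.
Context {R : realType}.
Variables a c : nat -> R.
Hypothesis sa : abs_summable a.
Hypothesis sc : sqsummable c.
Hypothesis ac : forall n, conv a c n = - (n == 0%N)%:R.

Local Notation beta := (beta_coef c a).
Local Notation Hankel := (Hankel a c).

Let sa2 : sqsummable a. Proof. exact: sqsum_asum. Qed.

Section Hankel_factorization.
Variable x : nat -> R.
Hypothesis sx : sqsummable x.

Let dsum_conv M : dsummable (fun k s => x k * (c s * a (s + (M + k))%N)).
Proof.
apply: (@dsummable_intro _ _ (fun k => `|x k| * abs_beta a c (M + k))).
- by move=> k; apply: asumZ; exact: asum_beta.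
- move=> k; under eq_tsum do rewrite normrM.
  by rewrite tsumZ//; apply: asum_norm; exact: asum_beta.
- apply: asumM; first exact: sqsum_norm.
  by under eq_fun do rewrite addnC; exact: (sqsum_shift M (sqsum_abs_beta sa sc)).
Qed.

Let diagE M t :
  \sum_(0 <= s < t.+1) x (t - s)%N * (c s * a (s + (M + (t - s)))%N) =
  a (M + t)%N * conv c x t.
Proof.
rewrite /conv mulr_sumr; apply: eq_big_nat => s /andP[_ st].
have -> : (s + (M + (t - s)) = M + t)%N by lia.
by ring.
Qed.

Lemma asum_a_conv M : abs_summable (fun t => a (M + t)%N * conv c x t).
Proof. by have := asum_diag (dsum_conv M); under eq_fun do rewrite diagE. Qed.

(** Since [beta] is the correlation of [c] with [a], the Hankel operator factors as convolution with
    [c] followed by the Hankel matrix of [a]. *)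
Lemma tsum_a_conv N u :
  tsum (fun t => a (N + u + t)%N * conv c x t) = Hankel N x u.
Proof.
under eq_tsum do rewrite -diagE.
rewrite (tsum_diag (dsum_conv (N + u))); apply: eq_tsum => k.
by rewrite tsumZ 1?mulrC//; exact: asum_beta.
Qed.

End Hankel_factorization.

Section index.
Variable n : nat.

Lemma sqsum_iter_Hankel k x : sqsummable x ->
  sqsummable (iter k (Hankel n.+1) x).
Proof. by move=> sx; elim: k => //= k ih; exact: sqsum_Hankel. Qed.

Lemma iter_Hankel_sym k x r : sqsummable x -> sqsummable r ->
  tsum (fun u => x u * iter k (Hankel n.+1) r u) =
  tsum (fun u => iter k (Hankel n.+1) x u * r u).
Proof.
elim: k x r => // k ih x r sx sr; rewrite iterS Hankel_sym//; last exact: sqsum_iter_Hankel.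
by rewrite ih//; [rewrite -iterSr|exact: sqsum_Hankel].
Qed.

Lemma dcoef_iter k : dcoef c a k n.+1 =
  iter k (Hankel n.+1) (fun u => (u == 0%N)%:R).
Proof. by elim: k => //= k <-. Qed.

Lemma bmcoef1E m j : bmcoef1 c a m j = conv c (fun u => a (j + u)%N) m.
Proof.
by apply: eq_big_nat => k /andP[_ km]; rewrite addnBA.
Qed.

Let sqh j : sqsummable (fun u => a (j + u)%N).
Proof. by under eq_fun do rewrite addnC; exact: sqsum_shift. Qed.

(** A step of the recursion applies the Hankel matrix of [a] and then convolves with [c]. Applied to
    a sequence of the form c * x, the matrix completes a factor [Hankel n.+1] by [tsum_a_conv], and
    the new convolution stays outside. *)
Lemma bmcoefE k m j : bmcoef c a k.+1 m n j =
  conv c (iter k (Hankel n.+1) (fun u => a (j + u)%N)) m.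
Proof.
elim: k m => [|k ih] m; first by rewrite /= bmcoef1E.
set x := iter k (Hankel n.+1) (fun u => a (j + u)%N).
have sx : sqsummable x by exact: sqsum_iter_Hankel.
rewrite [LHS](_ : _ = tsum (fun m1 => bmcoef1 c a m (n + 1 + m1)%N * bmcoef c a k.+1 m1 n j))//.
transitivity (tsum (fun m1 => \sum_(0 <= s < m.+1)
    c s * (a (n.+1 + (m - s) + m1)%N * conv c x m1))).
  apply: eq_tsum => m1; rewrite ih -/x bmcoef1E /conv mulr_suml.
  apply: eq_big_nat => s _; rewrite addn1 -mulrA; congr (_ * (a _ * _)); lia.
rewrite tsum_sum => [|s _]; last by apply: asumZ; exact: asum_a_conv.
apply: eq_bigr => s _; rewrite tsumZ; last exact: asum_a_conv.
by rewrite tsum_a_conv.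
Qed.

Lemma asum_a_dcoef k v :
  abs_summable (fun u => a (v + u)%N * dcoef c a k n.+1 u).
Proof. by apply: asumM; [exact: sqh|exact: sqsum_dcoef]. Qed.

(** At m = 0 the outer convolution keeps only c_0 and the entry 0, that is, the pairing with delta;
    symmetry moves the iterates onto delta, where they produce [dcoef]. *)
Lemma bcoefE k v : bcoef c a k.+1 n v =
  c 0%N * tsum (fun u => a (v + u)%N * dcoef c a k n.+1 u).
Proof.
rewrite /bcoef bmcoefE /conv big_nat1 subnn; congr (_ * _).
set h := fun u => a (v + u)%N.
transitivity (tsum (fun u => (u == 0%N)%:R * iter k (Hankel n.+1) h u)).
  rewrite (@tsum_fin _ 1); first by rewrite big_nat1 eqxx mul1r.
  by case=> // u _; rewrite mul0r.
rewrite iter_Hankel_sym; last exact: sqh.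
  by rewrite -dcoef_iter; apply: eq_tsum => u; rewrite mulrC.
by apply: (@asum_fin _ 1) => u; case: eqP => [->//|_ _]; rewrite expr0n.
Qed.

Lemma bcoef1E v : bcoef c a 1 n v = c 0%N * a v.
Proof. by rewrite /bcoef/= /bmcoef1 big_nat1 subn0 addn0. Qed.

End index.

End b_coefficients.

(** * Residuals of the partial sums in the normal equations *)

Section normal_equations.
Context {R : realType}.
Variables a c : nat -> R.
Hypothesis sa : abs_summable a.
Hypothesis sc : sqsummable c.
Hypothesis ac : forall n, conv a c n = - (n == 0%N)%:R.

Local Notation beta := (beta_coef c a).
Local Notation Hankel := (Hankel a c).
Local Notation g := (gram c).

Definition abs_gram (t : nat) : R := tsum (fun v => `|c (v + t)%N * c v|).

(* What is needed, beyond [a] in l^1 and [c] in l^2, for the errors [r_seq] and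
   [q_seq] below to be square summable. *)
Definition tame := (forall u, abs_summable (fun t => `|a (u + t)%N| * abs_gram t)) /\
  sqsummable (fun u => tsum (fun t => `|a (u + t)%N| * abs_gram t)).

Let asum_cc t : abs_summable (fun v => c (v + t)%N * c v).
Proof. by apply: asumM => //; exact: sqsum_shift. Qed.

Lemma abs_gram_ge0 t : 0 <= abs_gram t.
Proof. by apply: tsum_ge0 => //; exact: asum_norm. Qed.

Lemma ler_norm_gram t : `|g 0 t| <= abs_gram t.
Proof. by rewrite gram0E//; exact: ler_norm_tsum. Qed.

Let gram_le s k : `|g s k| <= sqnorm c.
Proof.
have nsh t : sqnorm (shift_seq c t) = sqnorm c.
  rewrite /sqnorm -(tsum_shift_seq t sc); apply: eq_tsum => j.
  by rewrite /shift_seq; case: ifP => //; rewrite expr0n.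
rewrite -ler_sqr ?nnegrE ?sqnorm_ge0// real_normK ?num_real//.
apply: le_trans (tsumM_CauchySchwarz (sqsum_shift_seq s sc) (sqsum_shift_seq k sc)) _.
by rewrite !nsh expr2.
Qed.

Lemma asum_a_gram m : abs_summable (fun s => a s * g s m).
Proof.
apply: asum_le (asumZ (sqnorm c) (asum_norm sa)) => s.
by rewrite normrM mulrC ler_wpM2r.
Qed.

(** The combination of the shifts of [c] with weights a_s is a * c = - delta, and a shift of [c] by
    m > 0 vanishes at index 0. *)
Lemma tsum_a_gram m : (0 < m)%N -> tsum (fun s => a s * g s m) = 0.
Proof.
move=> m0; pose F s k := a s * (shift_seq c s k * shift_seq c m k).
have rF s : abs_summable (fun k => shift_seq c s k * shift_seq c m k).
  by apply: asumM; exact: sqsum_shift_seq.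
have dF : dsummable F.
  apply: (@dsummable_intro _ _ (fun s => `|a s| * sqnorm c)).
  - by move=> s; exact: asumZ.
  - move=> s; under eq_tsum do rewrite normrM.
    rewrite tsumZ; last exact: asum_norm.
    apply: ler_wpM2l => //; rewrite -ler_sqr ?nnegrE ?sqnorm_ge0//; last first.
      by apply: tsum_ge0 => //; exact: asum_norm.
    have nsh t : sqnorm (shift_seq c t) = sqnorm c.
      rewrite /sqnorm -(tsum_shift_seq t sc); apply: eq_tsum => j.
      by rewrite /shift_seq; case: ifP => //; rewrite expr0n.
    apply: le_trans (tsum_CauchySchwarz (sqsum_shift_seq s sc) (sqsum_shift_seq m sc)) _.
    by rewrite !nsh expr2.
  - by under eq_fun do rewrite mulrC; apply: asumZ; exact: asum_norm.
transitivity (tsum (fun s => tsum (F s))).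
  by apply: eq_tsum => s; rewrite tsumZ.
rewrite tsum_exch//; transitivity (tsum (fun k => conv a c k * shift_seq c m k)).
  apply: eq_tsum => k; rewrite (@tsum_fin _ k.+1); last first.
    by move=> s ks; rewrite /F {1}/shift_seq leqNgt ks mul0r mulr0.
  rewrite conv_shift mulr_suml; apply: eq_bigr => s _.
  by rewrite /F mulrA.
rewrite (@tsum_fin _ 1).
  by rewrite big_nat1 /shift_seq leqNgt m0 mulr0.
by move=> -[|k]// _; rewrite ac/= oppr0 mul0r.
Qed.

Hypothesis ht : tame.

Let rho u := tsum (fun t => `|a (u + t)%N| * abs_gram t).

Let rho_ge0 u : 0 <= rho u.
Proof.
by apply: tsum_ge0 => [t|]; [rewrite mulr_ge0 ?abs_gram_ge0|exact: ht.1].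
Qed.

Let rho_psum u i K :
  \sum_(0 <= s < K) `|a (u + i + s)%N| * abs_gram (s + i) <= rho u.
Proof.
apply: (@le_trans _ _ (\sum_(0 <= t < K + i) `|a (u + t)%N| * abs_gram t)).
  rewrite (big_cat_nat (leq0n i) (leq_addl K i))/= sum_nat_shift.
  rewrite -[leLHS]add0r; apply: lerD.
    by apply: sumr_ge0 => t _; rewrite mulr_ge0 ?abs_gram_ge0.
  by apply: ler_sum => s _; rewrite -addnA [(i + s)%N]addnC.
apply: psum_le_tsum; last exact: ht.1.
by move=> t; rewrite mulr_ge0 ?abs_gram_ge0.
Qed.

Section index.
Variable n : nat.
Local Notation N := n.+1.

(* The identity [sum_s a_s gamma_{s-m} = 0] for [m = u + i], cut at [s = u] and
   [s = u + n]: its middle part involves only the predictor window. *)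
Definition r_seq (i u : nat) : R := \sum_(0 <= s < u.+1) a s * g s (u + i).
Definition q_seq (i u : nat) : R := tsum (fun s => a (N + u + s)%N * g (N + s) i).

Lemma rq_rel i u : (0 < i)%N ->
  r_seq i u + \sum_(1 <= j < N) a (j + u)%N * g j i + q_seq i u = 0.
Proof.
move=> i0; have ui0 : (0 < u + i)%N by rewrite addn_gt0 i0 orbT.
rewrite -[RHS](tsum_a_gram ui0) [RHS](tsum_split (N + u) (asum_a_gram _)).
congr (_ + _); last first.
  apply: eq_tsum => s; congr (a _ * _); first by lia.
  have -> : (s + (N + u) = (N + s) + u)%N by lia.
  by rewrite [(u + i)%N]addnC gram_add.
rewrite [RHS](@big_cat_nat _ _ _ u.+1)//=; last by lia.
congr (_ + _); rewrite -[u.+1]add1n big_addn addnK.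
by apply: eq_bigr => j _; rewrite [(u + i)%N]addnC gram_add.
Qed.

Let gramN i s : (i <= N)%N -> g (N + s) i = g 0 (s + (N - i)).
Proof.
move=> iN; have -> : (N + s = (s + (N - i)) + i)%N by lia.
by have := gram_add (s + (N - i)) 0 i sc; rewrite add0n => ->; rewrite gramC.
Qed.

Lemma sqsum_q i : (0 < i <= n)%N -> sqsummable (q_seq i).
Proof.
move=> /andP[i0 iN]; apply: sqsum_le (sqsum_shift i ht.2) => u.
rewrite -/(rho (u + i)) [leRHS]ger0_norm//.
have H K : \sum_(0 <= s < K) `|a (N + u + s)%N * g (N + s) i| <= rho (u + i).
  apply: le_trans (rho_psum _ (N - i) K); apply: ler_sum => s _.
  rewrite normrM gramN ?leqW//; have -> : (u + i + (N - i) + s = N + u + s)%N by lia.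
  by rewrite ler_wpM2l// ler_norm_gram.
have sq : abs_summable (fun s => a (N + u + s)%N * g (N + s) i) by exists (rho (u + i)).
apply: le_trans (ler_norm_tsum sq) _.
by apply: tsum_le_bound => //; exact: asum_norm.
Qed.

Let sqh j : sqsummable (fun u => a (j + u)%N).
Proof. by under eq_fun do rewrite addnC; apply: sqsum_shift; exact: sqsum_asum. Qed.

(** The number of terms of [r_seq i u] grows with u, so no direct estimate is attempted: [rq_rel]
    expresses it by [q_seq] and finitely many shifts of [a]. *)
Lemma sqsum_r i : (0 < i <= n)%N -> sqsummable (r_seq i).
Proof.
move=> hi; have /andP[i0 iN] := hi.
have -> : r_seq i = (fun u => - (\sum_(1 <= j < N) g j i * a (j + u)%N + q_seq i u)).
  apply/funext => u; apply/eqP; rewrite -addr_eq0 addrA; apply/eqP.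
  rewrite -[RHS](rq_rel u i0).
  by congr (_ + _ + _); apply: eq_bigr => j _; rewrite mulrC.
apply: sqsumN; apply: sqsumD; last exact: sqsum_q.
by apply: sqsum_sum => j _; apply: sqsumZ; exact: sqh.
Qed.

(** Once [abs_beta] is written out, the sum over s is at most rho(v + (m - i)) for each v, and |c_v|
    rho <= c_v^2 + rho^2 gives a bound independent of m and K. *)
Let beta_gram_psum m i K : (i <= m)%N ->
  \sum_(0 <= s < K) abs_beta a c (m + s) * abs_gram (s + i) <= sqnorm c + sqnorm rho.
Proof.
move=> im; have sb := asum_beta sa sc.
rewrite (eq_bigr (fun s => tsum (fun v => abs_gram (s + i) * `|c v * a (v + (m + s))%N|))); last first.
  by move=> s _; rewrite tsumZ 1?mulrC//; exact: asum_norm.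
rewrite -tsum_sum => [|s _]; last by apply: asumZ; exact: asum_norm.
have srho : sqsummable (fun v => rho (v + (m - i))) by apply: sqsum_shift; exact: ht.2.
apply: (@le_trans _ _ (sqnorm c + sqnorm (fun v => rho (v + (m - i))))); last first.
  rewrite lerD2l {2}/sqnorm (@tsum_split _ (m - i) (fun n => rho n ^+ 2)); last exact: ht.2.
  by rewrite lerDr; apply: sumr_ge0 => v _; exact: sqr_ge0.
rewrite /sqnorm -tsumD//; apply: le_tsum => [v||]; last exact: asumD.
  apply: (@le_trans _ _ (`|c v| * rho (v + (m - i)))).
    apply: le_trans (ler_wpM2l (normr_ge0 (c v)) (rho_psum (v + (m - i)) i K)).
    rewrite mulr_sumr; apply: ler_sum => s _; rewrite normrM.
    have -> : (v + (m - i) + i + s = v + (m + s))%N by lia.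
    by rewrite mulrC -mulrA.
  rewrite -[c v ^+ 2]real_normK ?num_real//.
  by have := normr_ge0 (c v); have := rho_ge0 (v + (m - i)); nra.
by apply: asum_sum => s _; apply: asumZ; exact: asum_norm.
Qed.

Let dsum_r i u : (0 < i <= n)%N ->
  dsummable (fun s w => beta (N + u + (s + w)) * (a w * g 0 (s + (N - i)))).
Proof.
move=> /andP[i0 iN].
apply: (@dsumC _ (fun w s => beta (N + u + (s + w)) * (a w * g 0 (s + (N - i))))).
exists (tsum (fun w => `|a w|) * (sqnorm c + sqnorm rho)) => W K.
have C0 : 0 <= sqnorm c + sqnorm rho by rewrite addr_ge0 ?sqnorm_ge0//; exact: ht.2.
apply: (@le_trans _ _ (\sum_(0 <= w < W) `|a w| * (sqnorm c + sqnorm rho))); last first.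
  rewrite -mulr_suml ler_wpM2r//; apply: psum_le_tsum => //; exact: asum_norm.
apply: ler_sum => w _.
have iNuw : (N - i <= N + u + w)%N by lia.
apply: le_trans (ler_wpM2l (normr_ge0 (a w)) (beta_gram_psum K iNuw)).
rewrite mulr_sumr; apply: ler_sum => s _; rewrite !normrM mulrCA ler_wpM2l//.
have -> : (N + u + (s + w) = N + u + w + s)%N by lia.
by apply: ler_pM => //; [exact: ler_norm_beta|exact: ler_norm_gram].
Qed.

(** Summing along diagonals puts gamma(s + N - i) in front of the sum over w of a_w beta_{N+u+s+w},
    which is -a_{N+u+s} by [tsum_a_beta]. The tail error [q_seq i] thus becomes a Hankel image of
    the head error at the reflected index. *)
Lemma Hankel_r i u : (0 < i <= n)%N -> Hankel N (r_seq (N - i)) u = - q_seq i u.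
Proof.
move=> hi; have /andP[i0 iN] := hi.
transitivity (tsum (fun s => tsum (fun w =>
    beta (N + u + (s + w)) * (a w * g 0 (s + (N - i)))))).
  rewrite -(tsum_diag (dsum_r u hi)); apply: eq_tsum => t.
  rewrite /r_seq mulr_sumr; apply: eq_big_nat => w /andP[_ wt].
  rewrite subnK//; congr (_ * (_ * _)).
  have -> : (t + (N - i) = (t - w + (N - i)) + w)%N by lia.
  by have := gram_add 0 (t - w + (N - i)) w sc; rewrite add0n.
rewrite -(mulN1r (q_seq i u)) -tsumZ; last first.
  exists (rho (u + i)) => K; apply: le_trans (rho_psum _ (N - i) K); apply: ler_sum => s _.
  rewrite normrM gramN ?leqW//; have -> : (u + i + (N - i) + s = N + u + s)%N by lia.
  by rewrite ler_wpM2l// ler_norm_gram.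
apply: eq_tsum => s; rewrite gramN ?leqW//.
transitivity (tsum (fun w => g 0 (s + (N - i)) * (a w * beta (N + u + s + w)))).
  by apply: eq_tsum => w; rewrite addnA; ring.
rewrite tsumZ; last exact: asum_a_beta.
by rewrite tsum_a_beta//; ring.
Qed.

Local Notation d := (fun k => dcoef c a k N).

(* The error terms of consecutive [k] telescope, since the index [j] is reflected
   at even [k], which exchanges [i] and [N - i]. *)
Lemma gram_bcoef k i : (0 < i <= n)%N ->
  \sum_(1 <= j < N) g j i * bcoef c a k.+1 n j =
  c 0%N * (tsum (fun u => d k.+1 u * r_seq (N - i) u) - tsum (fun u => d k u * r_seq i u)).
Proof.
move=> hi; have /andP[i0 iN] := hi.
have hi' : (0 < N - i <= n)%N by lia.
have sd := sqsum_dcoef sa sc ac (ltn0Sn n).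
have dS : d k.+1 = Hankel N (d k) by [].
rewrite dS -Hankel_sym//; last exact: sqsum_r.
rewrite -tsumB; [|by apply: asumM => //; apply: sqsum_Hankel => //; exact: sqsum_r
                 |by apply: asumM => //; exact: sqsum_r].
under eq_bigr do rewrite bcoefE// mulrCA.
rewrite -mulr_sumr; congr (_ * _).
transitivity (\sum_(1 <= j < N) tsum (fun u => g j i * (a (j + u)%N * d k u))).
  by apply: eq_bigr => j _; rewrite tsumZ//; exact: asum_a_dcoef.
rewrite -tsum_sum => [|j _]; last by apply: asumZ; exact: asum_a_dcoef.
apply: eq_tsum => u; rewrite Hankel_r// -mulrBr mulrC.
have := rq_rel u i0 => /eqP; rewrite addrAC addr_eq0 => /eqP h.
rewrite -[- q_seq i u - r_seq i u]opprD [q_seq i u + _]addrC h opprK mulr_suml.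
by apply: eq_bigr => j _; ring.
Qed.

Definition predictor_sum (M j : nat) : R := \sum_(1 <= k < M.+1) gcoef c a k n j.

Let ref (M i : nat) := if odd M then (N - i)%N else i.

Lemma gram_predictor_sum M i : (0 < i <= n)%N ->
  \sum_(1 <= j < N) g j i * predictor_sum M j =
  g 0 i + c 0%N * tsum (fun u => d M u * r_seq (ref M i) u).
Proof.
move=> hi; have /andP[i0 iN] := hi; have hi' : (0 < N - i <= n)%N by lia.
elim: M => [|M ih].
  (* For M = 0, [dcoef] selects r_seq i 0 = a_0 g 0 i, and a_0 c_0 = -1 makes it cancel g 0 i. *)
  rewrite big1 => [|j _]; last by rewrite /predictor_sum big_geq// mulr0.
  rewrite (@tsum_fin _ 1); last by case=> // u _; rewrite /= mul0r.
  rewrite big_nat1/= mul1r /ref/= /r_seq big_nat1 mulrA [c 0%N * _]mulrC.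
  by rewrite (a0c0 ac) mulN1r add0n subrr.
transitivity (\sum_(1 <= j < N) g j i * predictor_sum M j +
    \sum_(1 <= j < N) g j i * gcoef c a M.+1 n j).
  rewrite -big_split/=; apply: eq_bigr => j _.
  by rewrite /predictor_sum (@big_nat_recr _ _ _ M.+1)//= mulrDr.
rewrite ih -addrA; congr (_ + _).
suff -> : \sum_(1 <= j < N) g j i * gcoef c a M.+1 n j =
    c 0%N * (tsum (fun u => d M.+1 u * r_seq (ref M.+1 i) u) -
             tsum (fun u => d M u * r_seq (ref M i) u)).
  by rewrite mulrBr addrC subrK.
rewrite /gcoef /ref/=; case: (odd M) => /=; last exact: gram_bcoef.
(* For odd M the new term has even k and is evaluated at N - j; by [gram_rev], reflecting j amounts
   to using the equation with N - i in place of i. *)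
have := gram_bcoef M hi'; have -> : (N - (N - i) = i)%N by lia.
move=> <-; rewrite big_nat_rev/=; apply: eq_big_nat => j /andP[j1 jN].
have -> : (1 + N - j.+1 = N - j)%N by lia.
have -> : (n + 1 - (N - j) = j)%N by lia.
by congr (_ * _); rewrite -(@gram_rev _ _ N)//; [congr gram; lia|lia|lia].
Qed.

Lemma gram_predictor_sum_cvg i : (0 < i <= n)%N ->
  \sum_(1 <= j < N) g j i * predictor_sum M j @[M --> \oo] --> g 0 i.
Proof.
move=> hi; have /andP[i0 iN] := hi; have hi' : (0 < N - i <= n)%N by lia.
have -> : (fun M => \sum_(1 <= j < N) g j i * predictor_sum M j) =
    (fun M => g 0 i + c 0%N * tsum (fun u => d M u * r_seq (ref M i) u)).
  by apply/funext => M; exact: gram_predictor_sum.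
rewrite -[X in _ --> X]addr0; apply: cvgD; first exact: cvg_cst.
rewrite -(mulr0 (c 0%N)); apply: cvgM; first exact: cvg_cst.
have w1 := dcoef_weak_cvg0 sa sc ac (ltn0Sn n) (sqsum_r hi).
have w2 := dcoef_weak_cvg0 sa sc ac (ltn0Sn n) (sqsum_r hi').
apply/cvgrPdist_le => e e0.
move/cvgrPdist_le: w1 => /(_ e e0) w1; move/cvgrPdist_le: w2 => /(_ e e0) w2.
apply: filterS2 w1 w2 => M h1 h2.
by rewrite /ref; case: (odd M).
Qed.

Let Gmx := \matrix_(i < n, j < n) g i.+1 j.+1.

(** A vector w in the kernel makes the norm of c * w vanish, and convolution with [a] then recovers
    w = 0. *)
Let Gmx_unit : Gmx \in unitmx.
Proof.
rewrite -row_free_unit; apply: inj_row_free => v vG.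
pose w (s : nat) : R := if insub s is Some i then v 0 i else 0.
have wE (i : 'I_n) : w i = v 0 i by rewrite /w valK.
have lc0 : sqnorm (lincomb c n w) = 0.
  rewrite sqnorm_lincomb// big_mkord exchange_big/= big_mkord big1// => t _.
  have := congr1 (fun m : 'rV_n => m 0 t) vG; rewrite !mxE => h.
  transitivity (w t * \sum_j v 0 j * Gmx j t); last by rewrite h mulr0.
  rewrite mulr_sumr; apply: eq_bigr => s _.
  rewrite mxE; have := gram_add s t 1 sc; rewrite !addn1 => ->.
  by rewrite !wE; ring.
have cw0 k : conv c w k = 0.
  rewrite (@conv_shift_fin _ _ _ n) => [|s ns]; last by rewrite /w insubF// ltnNge ns.
  apply/eqP; rewrite -sqrf_eq0; apply/eqP.
  apply: (@tsum_eq0 _ (fun k => lincomb c n w k ^+ 2)) => //.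
    by move=> j; exact: sqr_ge0.
  exact: sqsum_lincomb.
apply/rowP => i; rewrite mxE -wE -[w i]opprK -(conv_acK ac).
by rewrite /conv big1 ?oppr0// => s _; rewrite -/(conv c w _) cw0 mulr0.
Qed.

(** The residuals of the partial sums tend to 0, and the inverse of the Gram matrix, which does not
    depend on M, carries this over to the differences from [phi]. *)
Lemma predictor_sum_cvg (phi : nat -> R) :
  (forall i, (0 < i <= n)%N -> \sum_(1 <= j < N) g j i * phi j = g 0 i) ->
  forall j, (0 < j <= n)%N -> predictor_sum M j @[M --> \oo] --> phi j.
Proof.
move=> hphi j /andP[j0 jn].
pose e M (i : 'I_n) := predictor_sum M i.+1 - phi i.+1.
have resid_cvg (i : 'I_n) : \sum_k e M k * Gmx k i @[M --> \oo] --> (0 : R).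
  have hi : (0 < i.+1 <= n)%N by rewrite /= ltn_ord.
  have -> : (fun M => \sum_k e M k * Gmx k i) =
      (fun M => \sum_(1 <= j < N) g j i.+1 * predictor_sum M j - g 0 i.+1).
    apply/funext => M; rewrite -(hphi _ hi) -sumrB big_add1 big_mkord.
    by apply: eq_bigr => k _; rewrite mxE /e; ring.
  rewrite -[X in _ --> X](subrr (g 0 i.+1)); apply: cvgB; last exact: cvg_cst.
  exact: gram_predictor_sum_cvg.
have eE M (k : 'I_n) : e M k = \sum_i (\sum_l e M l * Gmx l i) * invmx Gmx i k.
  have := congr1 (fun m : 'rV_n => m 0 k) (mulmxK Gmx_unit (\row_l e M l)).
  rewrite !mxE => <-; apply: eq_bigr => i _; rewrite mxE; congr (_ * _).
  by apply: eq_bigr => l _; rewrite mxE.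
have jn' : (j.-1 < n)%N by lia.
have jE : j = (Ordinal jn').+1 by rewrite /= prednK.
suff : e M (Ordinal jn') @[M --> \oo] --> (0 : R).
  rewrite /e -jE => h.
  have -> : predictor_sum ^~ j = (fun M => predictor_sum M j - phi j + phi j).
    by apply/funext => M; rewrite subrK.
  by rewrite -[X in _ --> X]add0r; apply: cvgD; [exact: h|exact: cvg_cst].
have -> : (fun M => e M (Ordinal jn')) = (fun M =>
    \sum_i (\sum_l e M l * Gmx l i) * invmx Gmx i (Ordinal jn')).
  by apply/funext => M; exact: eE.
rewrite -[X in _ --> X](@big1_eq R 0 +%R _ (index_enum 'I_n) xpredT).
apply: cvg_big => [|i _]; first exact: add_continuous.
by rewrite -[X in _ --> X](mul0r (invmx Gmx i (Ordinal jn'))); apply: cvgM; [exact: resid_cvg|exact: cvg_cst].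
Qed.

End index.

End normal_equations.

(** * Coefficients of regular variation *)

Section tame_sequences.
Context {R : realType}.
Implicit Types a c : nat -> R.

(** Here [abs_gram c] is itself in l^1, and summing |a_{u+t}| over u costs at most the l^1 norm of
    [a]; the sequence in u is thus in l^1, hence in l^2. *)
Lemma tame_summable a c : abs_summable a -> abs_summable c -> tame a c.
Proof.
move=> sa sc; have [A aA] := sa.
have aleA n : `|a n| <= A.
  by apply: le_trans (aA n.+1); rewrite big_nat_recr//= lerDr sumr_ge0.
have dc : dsummable (fun v t => c (v + t)%N * c v).
  apply: (@dsummable_intro _ _ (fun v => tsum (fun n => `|c n|) * `|c v|)).
  - move=> v; under eq_fun do rewrite mulrC addnC.
    by apply: asumZ; exact: (asum_shift v sc).
  - move=> v; under eq_tsum do rewrite normrM mulrC addnC.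
    rewrite tsumZ; last exact: (asum_shift v (asum_norm sc)).
    rewrite mulrC ler_wpM2r// [leRHS](tsum_split v (asum_norm sc)) lerDr.
    exact: sumr_ge0.
  - by apply: asumZ; exact: asum_norm.
have sG : abs_summable (abs_gram c) := dsum_rownorms (dsumC dc).
have G0 t : 0 <= abs_gram c t by apply: abs_gram_ge0; exact: sqsum_asum.
split.
  move=> u; apply: asum_le (asumZ A sG) => t.
  by rewrite normrM normr_id (ger0_norm (G0 t)) ler_wpM2r.
apply: sqsum_asum.
have dG : dsummable (fun t u => `|a (u + t)%N| * abs_gram c t).
  apply: (@dsummable_intro _ _ (fun t => tsum (fun n => `|a n|) * abs_gram c t)).
  - move=> t; under eq_fun do rewrite mulrC.
    by apply: asumZ; exact: (asum_shift t (asum_norm sa)).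
  - move=> t; under eq_tsum do rewrite normrM normr_id (ger0_norm (G0 t)) mulrC.
    rewrite tsumZ; last exact: (asum_shift t (asum_norm sa)).
    rewrite mulrC ler_wpM2r// [leRHS](tsum_split t (asum_norm sa)) lerDr.
    exact: sumr_ge0.
  - exact: asumZ.
exact: (dsum_rows (dsumC dG)).
Qed.

(** This is (n + 1)^(-s), shifted by one so as to make sense at n = 0. *)
Definition pw (s : R) (n : nat) : R := expR (- s * ln n.+1%:R).

Lemma pw_gt0 s n : 0 < pw s n. Proof. exact: expR_gt0. Qed.

Lemma pw_ge0 s n : 0 <= pw s n. Proof. exact: ltW (pw_gt0 _ _). Qed.

Lemma pwD s t n : pw (s + t) n = pw s n * pw t n.
Proof. by rewrite /pw -expRD; congr expR; ring. Qed.

(** Both x + 1 and y + 1 are at most x + y + 1, so decay in x + y can be shared out between x and y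
    in any proportion. *)
Lemma pw_split (p q : R) x y : 0 <= p -> 0 <= q ->
  pw (p + q) (x + y) <= pw p x * pw q y.
Proof.
move=> p0 q0; rewrite pwD; have lnle (m k : nat) : ln m.+1%:R <= ln (m + k).+1%:R :> R.
  by rewrite ler_ln ?posrE// ler_nat ltnS leq_addr.
apply: ler_pM; rewrite ?pw_ge0// ler_expR !mulNr lerN2 ler_wpM2l//.
by rewrite addnC.
Qed.

Lemma asum_pw (e : R) : 0 < e -> abs_summable (pw (1 + e)).
Proof.
move=> e0; exists (1 + e^-1) => n.
under eq_bigr do rewrite gtr0_norm ?pw_gt0//.
(* A telescoping majorant in place of the integral test. It follows from 1 / (k + 2) <= ln (k + 2) -
   ln (k + 1) and 1 + x <= exp x. *)
have step k : pw (1 + e) k.+1 <= e^-1 * (pw e k - pw e k.+1).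
  rewrite ler_pdivlMl// pwD.
  have k2 : 0 < k.+2%:R :> R by [].
  have -> : pw 1 k.+1 = k.+2%:R^-1.
    by rewrite /pw mulN1r expRN lnK ?posrE.
  set t := ln k.+2%:R - ln k.+1%:R :> R.
  have tge : k.+2%:R^-1 <= t.
    have -> : t = - ln (k.+1%:R / k.+2%:R).
      by rewrite lnM ?posrE ?invr_gt0// lnV ?posrE// opprD opprK addrC.
    rewrite lerNr; have -> : k.+1%:R / k.+2%:R = 1 + (- k.+2%:R^-1) :> R.
      have -> : k.+1%:R = k.+2%:R - 1 :> R by rewrite -(natr1 k.+1) addrK.
      by rewrite mulrBl divff ?mul1r// gt_eqF.
    by apply: le_ln1Dx; rewrite ltrNl opprK invf_lt1// ltr1n.
  have -> : pw e k = pw e k.+1 * expR (e * t).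
    by rewrite /pw -expRD; congr expR; rewrite /t; ring.
  have := expR_ge1Dx (e * t); have := pw_gt0 e k.+1.
  move: (pw e k.+1) (expR (e * t)) => E1 E2 E10 h.
  apply: (@le_trans _ _ (E1 * (e * t))); last by nra.
  by rewrite mulrCA [leLHS]mulrC [e * E1]mulrC -mulrA !ler_pM2l.
case: n => [|n]; first by rewrite big_geq// addr_ge0// invr_ge0 ltW.
rewrite big_nat_recl//; apply: lerD.
  by rewrite /pw ln1 mulr0 expR0.
apply: le_trans (ler_sum _ (fun k _ => step k)) _.
rewrite -mulr_sumr ler_piMr ?invr_ge0 ?ltW// big_mkord.
rewrite -(big_mkord xpredT (fun i => pw e i - pw e i.+1)).
under eq_bigr do rewrite -opprB.
rewrite sumrN telescope_sumr// opprB /pw ln1 mulr0 expR0.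
by rewrite ltrBlDr ltrDl expR_gt0.
Qed.

Section power_bounds.
Variables (a c : nat -> R) (d e K : R).
Hypotheses (e0 : 0 < e) (ed : e < d) (d_e : 12 * e <= 1 - 2 * d).
Hypothesis cK : forall n, `|c n| <= K * pw (1 - d - e) n.
Hypothesis aK : forall n, `|a n| <= K * pw (1 + d - e) n.

Let de : [/\ 0 < e, e < d & 12 * e <= 1 - 2 * d]. Proof. by []. Qed.

Let K0 : 0 <= K.
Proof. by have := le_trans (normr_ge0 _) (cK 0); rewrite pmulr_lge0// pw_gt0. Qed.

Lemma power_asum : abs_summable a.
Proof.
apply: asum_le (asumZ K (@asum_pw (d - e) _)) => [n|]; last by rewrite subr_gt0.
by rewrite addrA.
Qed.

Lemma sqsum_pw (p : R) : 1 < 2 * p -> sqsummable (pw p).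
Proof.
move=> p1; have := @asum_pw (2 * p - 1); rewrite subr_gt0 => /(_ p1).
congr abs_summable; apply/funext => n.
rewrite expr2 -pwD; have -> : 1 + (2 * p - 1) = p + p by ring.
by [].
Qed.

Lemma power_sqsum : sqsummable c.
Proof.
apply: (@sqsum_le _ (fun n => K * pw (1 - d - e) n)).
  by move=> n; apply: le_trans (cK n) _; exact: ler_norm.
by apply: sqsumZ; apply: sqsum_pw; have [? ? ?] := de; lra.
Qed.

Let C1 := tsum (pw (1 + e)).

(** Of the decay 1 - d - e of c_{v+t}, the share d + 2e goes to v, where together with the 1 - d - e
    of c_v it makes the summable exponent 1 + e; the rest goes to t. *)
Let gram_pw t : abs_gram c t <= K ^+ 2 * C1 * pw (1 - 2 * d - 3 * e) t.
Proof.
have s1 : abs_summable (pw (1 + e)) by exact: asum_pw.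
have sc := power_sqsum.
rewrite -mulrA [C1 * _]mulrC mulrA -tsumZ//.
apply: le_tsum => [v||]; last exact: asumZ.
  have h : pw (1 - d - e) (v + t) <= pw (d + 2 * e) v * pw (1 - 2 * d - 3 * e) t.
    rewrite (_ : 1 - d - e = (d + 2 * e) + (1 - 2 * d - 3 * e)); last by ring.
    by apply: pw_split; have [? ? ?] := de; lra.
  rewrite normrM; apply: le_trans (ler_pM _ _ (cK _) (cK _)) _ => //.
  rewrite [in leRHS](_ : 1 + e = (d + 2 * e) + (1 - d - e)); last by ring.
  rewrite [in leRHS]pwD; apply: le_trans (ler_wpM2r _ (ler_wpM2l K0 h)) _.
    by rewrite mulr_ge0 ?pw_ge0.
  by rewrite le_eqVlt; apply/orP; left; apply/eqP; ring.
by apply: asum_norm; apply: asumM => //; exact: sqsum_shift.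
Qed.

(** Of the decay 1 + d - e of a_{u+t}, the share 2d + 4e goes to t and completes the exponent of
    [gram_pw] to 1 + e. What is left for u is 1 - d - 5e, which is square summable if 10 e < 1 - 2d;
    hence the assumption with 12 e. *)
Lemma tame_power : tame a c.
Proof.
have s1 : abs_summable (pw (1 + e)) by exact: asum_pw.
have sc := power_sqsum.
have bnd u t : `|a (u + t)%N| * abs_gram c t <=
    K ^+ 3 * C1 * pw (1 - d - 5 * e) u * pw (1 + e) t.
  have h : pw (1 + d - e) (u + t) <= pw (1 - d - 5 * e) u * pw (2 * d + 4 * e) t.
    rewrite (_ : 1 + d - e = (1 - d - 5 * e) + (2 * d + 4 * e)); last by ring.
    by apply: pw_split; have [? ? ?] := de; lra.
  apply: le_trans (ler_pM _ _ (aK _) (gram_pw _)) _ => //; first exact: abs_gram_ge0.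
  rewrite [in leRHS](_ : 1 + e = (2 * d + 4 * e) + (1 - 2 * d - 3 * e)); last by ring.
  rewrite [pw (2 * d + _ + _) t]pwD; apply: le_trans (ler_wpM2r _ (ler_wpM2l K0 h)) _.
    by rewrite !mulr_ge0 ?pw_ge0 ?exprn_ge0// tsum_ge0// => n; exact: pw_ge0.
  by rewrite le_eqVlt; apply/orP; left; apply/eqP; ring.
have row u : abs_summable (fun t => `|a (u + t)%N| * abs_gram c t).
  apply: asum_le (asumZ (K ^+ 3 * C1 * pw (1 - d - 5 * e) u) s1) => t.
  by rewrite ger0_norm// mulr_ge0// abs_gram_ge0.
split=> //; apply: (@sqsum_le _ (fun u => K ^+ 3 * C1 ^+ 2 * pw (1 - d - 5 * e) u)).
  move=> u; rewrite ger0_norm; last first.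
    by apply: tsum_ge0 => // t; rewrite mulr_ge0// abs_gram_ge0.
  apply: le_trans (le_tsum (bnd u) (row u) (asumZ _ s1)) _.
  rewrite tsumZ//; apply: le_trans (ler_norm _); rewrite -/C1.
  by rewrite le_eqVlt; apply/orP; left; apply/eqP; ring.
by apply: sqsumZ; apply: sqsum_pw; have [? ? ?] := de; lra.
Qed.

End power_bounds.

End tame_sequences.

(** * Uniform convergence for slowly varying functions in additive form *)

Section slow_variation.
Context {R : realType}.
Local Notation mu := (@lebesgue_measure R).

Lemma lebesgue_measure_shift (u : R) (A : set R) : measurable A ->
  pushforward mu ((fun x => x + u) : measurableTypeR R -> measurableTypeR R) A = mu A.
Proof.
have mu_shift : measurable_fun setT ((fun x => x + u) : measurableTypeR R -> measurableTypeR R).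
  exact: measurable_funD.
move=> mA; apply/esym; pose h := isMeasurableFun.Build _ _ _ _ _ mu_shift.
pose hp : {mfun _ >-> _} := HB.pack (fun x : measurableTypeR R => x + u : measurableTypeR R) h.
apply: (@lebesgue_measure_unique _ (pushforward mu hp)) => // _ [[p q]] _ <-.
rewrite /pushforward/=.
rewrite [X in _ = lebesgue_measure X](_ : _ = `](p - u), (q - u)]%classic); last first.
  by apply/seteqP; split => x /=; rewrite !in_itv/= ltrBlDr lerBrDr.
rewrite !lebesgue_measure_itv/= !lte_fin ltrD2r; case: ifP => // _.
by rewrite !EFinN -!EFinD; congr EFin; ring.
Qed.

Lemma ge0_integral_shift (f : R -> \bar R) (D : set R) (u : R) :
  measurable D -> measurable_fun setT f -> (forall x, 0 <= f x)%E ->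
  (\int[mu]_(x in D) f x = \int[mu]_(x in (fun x => x + u)%R @^-1` D) f (x + u)%R)%E.
Proof.
move=> mD mf f0.
have mu_shift : measurable_fun setT ((fun x => x + u) : measurableTypeR R -> measurableTypeR R).
  exact: measurable_funD.
rewrite -(@ge0_integral_pushforward _ _ _ _ _ _ mu_shift mu D f)//=; last exact: measurable_funS mf.
by apply: eq_measure_integral => A mA _; exact/esym/lebesgue_measure_shift.
Qed.

Lemma integrable_itv_cst (p q r : R) : mu.-integrable `[p, q] (fun=> r%:E).
Proof.
apply: measurable_bounded_integrable => //.
- by rewrite /= lebesgue_measure_itv/=; case: ifP => _; rewrite ?ltry// -EFinB ltry.
- by exists `|r|; split; [exact: num_real|move=> x rx t _; exact: ltW].
Qed.

(** Truncation at 1 provides the dominating function and keeps the triangle inequality. *)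
Let tnorm (t : R) : R := Num.min 1 `|t|.

Let tnorm_ge0 t : 0 <= tnorm t. Proof. by rewrite le_min ler01 normr_ge0. Qed.

Let tnorm_le1 t : tnorm t <= 1. Proof. by rewrite ge_min lexx. Qed.

Let tnormN t : tnorm (- t) = tnorm t. Proof. by rewrite /tnorm normrN. Qed.

Let tnorm_tri (s t : R) : tnorm s <= tnorm (s - t) + tnorm t.
Proof.
have [h1|/ltW h1] := leP 1 `|s - t|.
  by rewrite {2}/tnorm (min_idPl h1) (le_trans (tnorm_le1 s))// lerDl.
have [h2|/ltW h2] := leP 1 `|t|.
  by rewrite {3}/tnorm (min_idPl h2) (le_trans (tnorm_le1 s))// lerDr.
rewrite {2 3}/tnorm (min_idPr h1) (min_idPr h2).
apply: (@le_trans _ _ `|s|); first by rewrite ge_min lexx orbT.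
by rewrite -{1}[s](subrK t) ler_normD.
Qed.


Section uniform_convergence.
Variable F : R -> R.
Hypothesis mF : measurable_fun setT F.
Hypothesis sF : forall u, F (x + u) - F x @[x --> +oo] --> (0 : R).

Let mtnorm (z v : R) : measurable_fun setT (fun t => (tnorm (F (z + t) - v))%:E).
Proof.
apply/measurable_EFinP; apply: measurable_minr; first exact: measurable_cst.
apply: measurableT_comp => //; apply: measurable_funB; last exact: measurable_cst.
by apply: measurableT_comp => //; exact: measurable_funD.
Qed.

Let I (z : R) : \bar R := (\int[mu]_(t in `[0%R, 2%R]) (tnorm (F (z + t) - F z))%:E)%E.

Let I_cvg (z : nat -> R) : (forall m, m%:R <= z m) -> I (z m) @[m --> \oo] --> 0%E.
Proof.
move=> zm; have zy : z @ \oo --> +oo.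
  apply: (@ger_cvgy _ _ _ _ (fun m => m%:R)); first exact: nearW.
  exact: cvgr_idn.
have := @dominated_cvg _ _ _ mu `[0%R, 2%R]%classic _
  (fun m t => (tnorm (F (z m + t) - F (z m)))%:E) (cst 0%E) (cst 1%E).
rewrite integral_cst//= mul0e; apply => //.
- by move=> m; exact: measurable_funS (mtnorm _ _).
- move=> t _; apply: cvg_EFin; first exact: nearW.
  have h : (fun m => F (z m + t) - F (z m)) @ \oo --> (0 : R).
    exact: (cvg_comp _ _ zy (sF t)).
  apply/cvgrPdist_le => e e0; move/cvgrPdist_le: h => /(_ e e0).
  apply: filterS => m /=; rewrite !sub0r !normrN => h.
  by rewrite (ger0_norm (tnorm_ge0 _)) (le_trans _ h)// ge_min lexx orbT.
- exact: integrable_itv_cst.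
- by move=> m t _ /=; rewrite lee_fin (ger0_norm (tnorm_ge0 _)).
Qed.

(* If the variation at [x + u] is large, then for every [t] it is large either
   from [x] to [x + t] or from [x + u] to [x + t]; the integrals over [t] of both
   truncated variations tend to 0 by dominated convergence. *)
Lemma slow_uniform (e : R) : 0 < e ->
  exists X, forall x u, X <= x -> 0 <= u <= 1 -> `|F (x + u) - F x| <= e.
Proof.
move=> e0; apply: contrapT => /forallNP H.
have {}H m : exists p : R * R, [/\ m%:R <= p.1, 0 <= p.2 <= 1 & e < `|F (p.1 + p.2) - F p.1|].
  have /existsNP[x /existsNP[u /not_implyP[xm /not_implyP[u01 /negP]]]] := H m%:R.
  by rewrite -ltNge => h; exists (x, u).
have {H}[p Hp] := choice H.
pose x m := (p m).1; pose u m := (p m).2.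
have xm m : m%:R <= x m by have [] := Hp m.
have u01 m : 0 <= u m <= 1 by have [] := Hp m.
have exu m : e < `|F (x m + u m) - F (x m)| by have [] := Hp m.
have xum m : m%:R <= x m + u m by rewrite (le_trans (xm m))// lerDl; case/andP: (u01 m).
pose e1 := Num.min 1 e; have e10 : 0 < e1 by rewrite lt_min ltr01.
(* For t in [1, 2] both t and t - u lie in [0, 2], so each of the two integrals contains a copy of
   [1, 2], an interval of length 1. *)
have key m : (e1%:E <= I (x m) + I (x m + u m)%R)%E.
  have shiftI : (\int[mu]_(t in `[1%R, 2%R]) (tnorm (F (x m + t) - F (x m + u m)))%:E <= I (x m + u m)%R)%E.
    rewrite (@ge0_integral_shift _ _ (u m))//; last by move=> t; rewrite lee_fin.
    under eq_integral => t _ do rewrite [(t + u m)%R]addrC addrA.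
    apply: ge0_subset_integral => //.
    - rewrite -[X in measurable X]setTI.
      by have /= := @measurable_funD _ _ _ setT id (cst (u m)) (@measurable_id _ _ _) (@measurable_cst _ _ _ _ _ _); apply.
    - exact: measurable_funS (mtnorm _ _).
    - by move=> t _; rewrite lee_fin.
    - move=> t /=; rewrite !in_itv/=; have /andP[] := u01 m; lra.
  have subI : (\int[mu]_(t in `[1%R, 2%R]) (tnorm (F (x m + t) - F (x m)))%:E <= I (x m))%E.
    apply: ge0_subset_integral => //.
    - exact: measurable_funS (mtnorm _ _).
    - by move=> t _; rewrite lee_fin.
    - by move=> t /=; rewrite !in_itv/=; lra.
  apply: le_trans (leeD subI shiftI); rewrite -ge0_integralD//; first last.
  - exact: measurable_funS (mtnorm _ _).
  - by move=> t _; rewrite lee_fin.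
  - exact: measurable_funS (mtnorm _ _).
  - by move=> t _; rewrite lee_fin.
  apply: (@le_trans _ _ (\int[mu]_(t in `[1%R, 2%R]) (cst e1%:E t))%E).
    by rewrite integral_cst//= lebesgue_measure_itv/= lte_fin ltr1n -EFinB -EFinM
      (_ : 2 - 1 = 1 :> R) ?mulr1//; ring.
  apply: ge0_le_integral => //.
  - by move=> t _; rewrite lee_fin ltW.
  - by apply: emeasurable_funD; exact: measurable_funS (mtnorm _ _).
  - move=> t _ /=; rewrite -EFinD lee_fin.
    have h : tnorm (F (x m + u m) - F (x m)) <=
        tnorm (F (x m + t) - F (x m)) + tnorm (F (x m + t) - F (x m + u m)).
      have := tnorm_tri (F (x m + u m) - F (x m)) (F (x m + t) - F (x m)).
      have -> : F (x m + u m) - F (x m) - (F (x m + t) - F (x m)) =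
          - (F (x m + t) - F (x m + u m)) by ring.
      by rewrite tnormN [in leRHS]addrC; apply: le_trans; rewrite addrC.
    by apply: le_trans h; rewrite le_min !ge_min lexx/= (ltW (exu m)) orbT.
have hI : (I (x m) + I (x m + u m)%R)%E @[m --> \oo] --> 0%E.
  rewrite -[X in _ --> X](adde0 0%E); apply: cvgeD => //; exact: I_cvg.
have : (e1%:E <= 0)%E.
  by apply: (lee_cvg_to (cvg_cst _) hI); exact: nearW.
by rewrite lee_fin leNgt e10.
Qed.

End uniform_convergence.

End slow_variation.

(** * Potter bounds and the coefficients under (A2) *)

Section Potter.
Context {R : realType}.

(** The way from X to x is covered by at most x - X + 1 steps of length at most 1, each costing at
    most e. *)
Lemma slow_growth (F : R -> R) (X e : R) : 0 <= e ->
  (forall x u, X <= x -> 0 <= u <= 1 -> `|F (x + u) - F x| <= e) ->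
  forall x, X <= x -> `|F x - F X| <= e * (x - X + 1).
Proof.
move=> e0 Fe x Xx.
have step n y : X <= y <= X + n%:R -> `|F y - F X| <= e * n%:R.
  elim: n y => [|n ih] y; first by rewrite addr0 => /andP[h1 h2];
    rewrite (_ : y = X) ?subrr ?normr0 ?mulr0//; apply/eqP; rewrite eq_le h1 h2.
  move=> /andP[Xy yn]; have [yX|Xy1] := leP y (X + 1).
    have := Fe X (y - X) (lexx _); rewrite [X + _]addrC subrK => h.
    apply: le_trans (h _) _; last by rewrite ler_peMr// ler1n.
    by rewrite subr_ge0 Xy/= lerBlDl.
  have h1 : `|F (y - 1) - F X| <= e * n%:R.
    apply: ih; rewrite lerBrDr (ltW Xy1)/= lerBlDr.
    by move: yn; rewrite -natr1 addrA.
  have Xy' : X <= y - 1 by rewrite lerBrDr ltW.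
  have := Fe (y - 1) 1 Xy'; rewrite subrK ler01 lexx => /(_ isT) h2.
  rewrite -natr1 mulrDr mulr1; apply: le_trans (lerD h1 h2).
  have -> : F y - F X = (F (y - 1) - F X) + (F y - F (y - 1)) by ring.
  exact: ler_normD.
have xX0 : 0 <= x - X by rewrite subr_ge0.
have h : X <= x <= X + (Num.truncn (x - X)).+1%:R.
  by rewrite Xx/= -lerBlDl ltW// truncnS_gt.
apply: le_trans (step _ _ h) _; apply: ler_wpM2l => //.
by rewrite -natr1 lerD2r truncn_le.
Qed.

Lemma slowly_varying_bounds (l : R -> R) (e : R) : slowly_varying l -> 0 < e ->
  exists (C : R) (n0 : nat), 0 < C /\ forall n : nat, (n0 <= n)%N ->
  [/\ 0 < l n%:R, l n%:R <= C * expR (e * ln n%:R) &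
      (l n%:R)^-1 <= C * expR (e * ln n%:R)].
Proof.
move=> [[A [ml lpos]] lim_l] e0.
(* [l] is known to be measurable and positive only from A on, while [slow_uniform] asks for
   measurability on the whole line. *)
pose lt y := if A <= y then l y else 1.
have mlt : measurable_fun setT lt.
  apply: measurable_fun_if => //.
  - by apply: measurable_fun_ler => //; exact: measurable_cst.
  - apply: measurable_funS ml => //.
    by move=> y /= [_]; rewrite in_itv/= andbT.
pose F x := ln (lt (expR x)).
have mF : measurable_fun setT F.
  apply: measurableT_comp; first exact: measurable_ln.
  by apply: measurableT_comp => //; exact: measurable_expR.
have expR_cvgy : expR x @[x --> +oo] --> (+oo : set_system R).
  apply: (@ger_cvgy _ _ _ _ id); last exact: cvg_id.
  by apply: nearW => x; apply: le_trans (expR_ge1Dx x); rewrite lerDr.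
have expR_ge (B : R) : \forall x \near +oo, B <= expR x by move/cvgryPge: expR_cvgy => /(_ B).
have sF u : F (x + u) - F x @[x --> +oo] --> (0 : R).
  have h : ln (l (expR u * expR x) / l (expR x)) @[x --> +oo] --> (0 : R).
    have h1 : (fun x => l (expR u * expR x) / l (expR x)) @ +oo --> (1 : R).
      exact: (cvg_comp _ _ expR_cvgy (lim_l (expR u) (expR_gt0 _))).
    have := @continuous_cvg _ _ _ _ _ _ (@ln R) _ (@continuous_ln R 1 ltr01) h1.
    by rewrite ln1; apply.
  apply: cvg_trans h; apply: near_eq_cvg; near=> x.
  have Ax : A <= expR x.
    by near: x; exact: expR_ge.
  have Axu : A <= expR u * expR x.
    rewrite -ler_pdivrMl ?expR_gt0//.
    by near: x; exact: expR_ge.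
  by rewrite /F /lt expRD [expR x * _]mulrC Ax Axu ln_div// posrE lpos.
have [X HX] := slow_uniform mF sF e0.
have HX1 := slow_growth (ltW e0) HX.
(* The constant part of the bound |F X| + e (x - X + 1) given by [slow_growth], so that |F x| <= D +
   e x. *)
pose D := `|F X| + e * (1 - X).
have nat_ge (r : R) : exists t : nat, r <= t%:R.
  exists (Num.truncn `|r|).+1; apply: le_trans (ler_norm _) _.
  exact: ltW (truncnS_gt _).
have [tA htA] := nat_ge A; have [tX htX] := nat_ge (expR X).
exists (expR D), (tA + tX).+1.
split; first exact: expR_gt0.
move=> n hn; have n0 : 0 < n%:R :> R by rewrite ltr0n; lia.
have hnA : A <= n%:R.
  by apply: le_trans htA _; rewrite ler_nat; lia.
have hnX : X <= ln n%:R.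
  by rewrite -ler_expR lnK ?posrE//; apply: le_trans htX _; rewrite ler_nat; lia.
have := HX1 _ hnX; rewrite {1}/F lnK ?posrE// /lt hnA => h.
have ln0 := lpos _ hnA.
have key : `|ln (l n%:R)| <= D + e * ln n%:R.
  rewrite -[ln (l _)](subrK (F X)); apply: le_trans (ler_normD _ _) _.
  apply: le_trans (lerD h (lexx _)) _.
  by rewrite le_eqVlt; apply/orP; left; apply/eqP; rewrite /D; ring.
split=> //; rewrite -expRD.
  by rewrite -{1}[l _]lnK ?posrE// ler_expR; apply: le_trans (ler_norm _) key.
rewrite -{1}[l _]lnK ?posrE// -expRN ler_expR; apply: le_trans key.
by rewrite -normrN ler_norm.
Unshelve. all: by end_near. Qed.

Lemma eventually_pw (u : nat -> R) (s B : R) (n0 : nat) : 0 <= s ->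
  (forall n, (n0 <= n)%N -> `|u n| <= B * expR (- s * ln n%:R)) ->
  exists K, forall n, `|u n| <= K * pw s n.
Proof.
move=> s0 uB.
(* [K2] takes care of the indices up to n0; beyond n0, passing from n to n + 1 <= 2 n costs the
   factor 2^s. *)
pose K2 := \sum_(0 <= k < n0.+1) `|u k| / pw s k.
exists (`|B| * expR (s * ln 2) + K2) => n; rewrite mulrDl.
have K20 : 0 <= K2 by apply: sumr_ge0 => k _; rewrite divr_ge0 ?pw_ge0.
have [nn0|n0n] := leqP n n0.
  apply: (@le_trans _ _ (K2 * pw s n)); last first.
    by rewrite lerDr !mulr_ge0 ?expR_ge0 ?pw_ge0.
  rewrite -ler_pdivrMr ?pw_gt0// /K2.
  rewrite big_mkord (bigD1 (Ordinal (_ : (n < n0.+1)%N)))//= lerDl.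
  by apply: sumr_ge0 => k _; rewrite divr_ge0 ?pw_ge0.
apply: (@le_trans _ _ (`|B| * expR (s * ln 2) * pw s n)); last first.
  by rewrite lerDl mulr_ge0 ?pw_ge0.
have n_gt0 : 0 < n%:R :> R by rewrite ltr0n; exact: leq_trans n0n.
apply: le_trans (uB n (ltnW n0n)) _; rewrite -mulrA.
apply: le_trans (ler_wpM2r (expR_ge0 _) (ler_norm B)) _.
rewrite ler_wpM2l// /pw -expRD ler_expR.
have h : ln n.+1%:R <= ln 2 + ln n%:R :> R.
  rewrite -lnM ?posrE// ler_ln ?posrE ?mulr_gt0// -natrM ler_nat; lia.
by have := ler_wpM2l s0 h; rewrite mulrDr; lra.
Qed.

Lemma equiv_le (u f : nat -> R) : u ~_\oo f ->
  \forall n \near \oo, `|u n| <= 2 * `|f n|.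
Proof.
move=> /eqaddoP/(_ 1 ltr01); apply: filterS => n /=; rewrite mul1r => h.
have -> : u n = (u n - f n) + f n by rewrite subrK.
by apply: le_trans (ler_normD _ _) _; rewrite mulr2n mulrDl mul1r lerD2r.
Qed.

Lemma condA2_power (c a : nat -> R) : condA2 c a -> exists d e K : R,
  [/\ 0 < e, e < d, 12 * e <= 1 - 2 * d,
    forall n, `|c n| <= K * pw (1 - d - e) n &
    forall n, `|a n| <= K * pw (1 + d - e) n].
Proof.
move=> [d [l [/andP[d0 d2] sl ec ea]]].
have d21 : 2 * d < 1 by have := d2; lra.
(* The first bound gives e < d, needed for [a] to be summable; the second is the margin required by
   [tame_power]. *)
pose e := Num.min (d / 2) ((1 - 2 * d) / 12).
have e0 : 0 < e by rewrite lt_min !divr_gt0// subr_gt0.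
have ed : e < d by apply: (@le_lt_trans _ _ (d / 2)); [rewrite ge_min lexx|lra].
have e12 : 12 * e <= 1 - 2 * d.
  have : e <= (1 - 2 * d) / 12 by rewrite ge_min lexx orbT.
  by lra.
have [C [n0 [C0 Hl]]] := slowly_varying_bounds sl e0.
have powE n s : (0 < n)%N -> n%:R `^ s = expR (s * ln n%:R) :> R.
  by move=> n_gt0; rewrite /powR pnatr_eq0 gtn_eqF.
have [n1 _ Hc] := equiv_le ec; have [n2 _ Ha] := equiv_le ea.
have [K1 HK1] : exists K, forall n, `|c n| <= K * pw (1 - d - e) n.
  apply: (@eventually_pw _ _ (2 * C) (maxn 1 (maxn n0 n1))); first by lra.
  move=> n; rewrite !geq_max => /and3P[n_gt0 n0n n1n].
  have /= hc := Hc n n1n; apply: (le_trans hc); rewrite powE// -mulrA ler_pM2l//.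
  have [lp lC _] := Hl n n0n.
  rewrite ger0_norm ?mulr_ge0 ?expR_ge0 ?(ltW lp)//.
  apply: (le_trans (ler_wpM2l (expR_ge0 _) lC)).
  by rewrite mulrCA -expRD le_eqVlt; apply/orP; left; apply/eqP; congr (_ * expR _); ring.
have [K2 HK2] : exists K, forall n, `|a n| <= K * pw (1 + d - e) n.
  pose B := `|d * sin (pi * d) / pi|.
  apply: (@eventually_pw _ _ (2 * (C * B)) (maxn 1 (maxn n0 n2))); first by lra.
  move=> n; rewrite !geq_max => /and3P[n_gt0 n0n n2n].
  have /= hn := Ha n n2n; apply: (le_trans hn); rewrite powE// -[leRHS]mulrA ler_pM2l//.
  have [lp _ lC] := Hl n n0n.
  rewrite !normrM [`|expR _|]ger0_norm ?expR_ge0// -2!normrM -/B -mulrA.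
  rewrite [`|_^-1|]ger0_norm ?invr_ge0 ?(ltW lp)//.
  apply: (@le_trans _ _ (expR (- (1 + d) * ln n%:R) * (C * expR (e * ln n%:R) * B))).
    by rewrite ler_wpM2l ?expR_ge0// ler_wpM2r ?normr_ge0.
  rewrite [leLHS](_ : _ = C * (B * (expR (- (1 + d) * ln n%:R) * expR (e * ln n%:R)))); last by ring.
  by rewrite -expRD mulrA le_eqVlt; apply/orP; left; apply/eqP; congr (_ * expR _); ring.
exists d, e, (Num.max K1 K2); split=> // n.
  by apply: le_trans (HK1 n) _; rewrite ler_wpM2r ?pw_ge0// le_max lexx.
by apply: le_trans (HK2 n) _; rewrite ler_wpM2r ?pw_ge0// le_max lexx orbT.
Qed.

Lemma condA_tame (c a : nat -> R) : condA1 c a \/ condA2 c a ->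
  [/\ abs_summable a, sqsummable c & tame a c].
Proof.
case=> [[/abs_summableP sa /abs_summableP sc]|/condA2_power].
  by split=> //; [exact: sqsum_asum|exact: tame_summable].
move=> [d [e [K [e0 ed de hc ha]]]]; split.
- exact: power_asum ed ha.
- exact: power_sqsum e0 ed de hc.
- exact: tame_power e0 ed de hc ha.
Qed.

End Potter.

(** * The Szego function in polar coordinates *)

Section complex_power_series.
Context {R : realType}.
Local Open Scope complex_scope.

Definition polar (r t : R) : R[i] := (r * cos t) +i* (r * sin t).

Lemma polarX r t n :
  polar r t ^+ n = (r ^+ n * cos (n%:R * t)) +i* (r ^+ n * sin (n%:R * t)).
Proof.
elim: n => [|n ih]; first by rewrite !expr0 mul0r cos0 sin0 mulr0 mulr1.
rewrite exprS ih -natr1 mulrDl mul1r cosD sinD /polar.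
by apply/eqP; rewrite eq_complex/=; apply/andP; split; apply/eqP; rewrite exprS; ring.
Qed.

Lemma polar_norm_lt1 (r t : R) : 0 <= r < 1 -> (`|polar r t| : R[i]) < 1.
Proof.
move=> /andP[r0 r1]; rewrite normc_def/= !exprMn -mulrDr cos2Dsin2 mulr1.
by rewrite sqrtr_sqr ger0_norm// (ltcR r 1).
Qed.

(** The squared modulus as a real number; the norm on [R[i]] takes its values in [R[i]]. *)
Definition nsq (z : R[i]) : R := complex.Re z ^+ 2 + complex.Im z ^+ 2.

Lemma nsqM z w : nsq (z * w) = nsq z * nsq w.
Proof. by case: z w => [x y] [u v]; rewrite /nsq/=; ring. Qed.

Lemma nsq_real (x : R) : nsq x%:C = x ^+ 2.
Proof. by rewrite /nsq/= expr0n addr0. Qed.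

Lemma ReN (z : R[i]) : complex.Re (- z) = - complex.Re z. Proof. by case: z. Qed.

Lemma ImN (z : R[i]) : complex.Im (- z) = - complex.Im z. Proof. by case: z. Qed.

Lemma ReV (z : R[i]) : complex.Re z^-1 = complex.Re z / nsq z.
Proof. by case: z. Qed.

Lemma ImV (z : R[i]) : complex.Im z^-1 = - (complex.Im z / nsq z).
Proof. by case: z. Qed.

Lemma nsq_eq0 z : (nsq z == 0) = (z == 0).
Proof.
by case: z => x y; rewrite /nsq/= paddr_eq0 ?sqr_ge0// !sqrf_eq0 eq_complex.
Qed.

Lemma nsq_expC z : nsq (expC z) = expR (2 * complex.Re z).
Proof.
rewrite /expC nsqM nsq_real /nsq/= cos2Dsin2 mulr1 expr2 -expRD.
by congr expR; ring.
Qed.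

Lemma ReIm_series (u : nat -> R) r t n :
  series (fun n => (u n)%:C * polar r t ^+ n) n =
  series (fun n => u n * (r ^+ n * cos (n%:R * t))) n +i*
  series (fun n => u n * (r ^+ n * sin (n%:R * t))) n.
Proof.
rewrite /series/=; elim: n => [|n ih]; first by rewrite !big_geq.
rewrite !big_nat_recr//= ih polarX.
by apply/eqP; rewrite eq_complex/=; apply/andP; split; apply/eqP; ring.
Qed.

Lemma power_series_polar f u r t : power_series_of f u -> 0 <= r < 1 ->
  series (fun n => u n * (r ^+ n * cos (n%:R * t))) @ \oo --> complex.Re (f (polar r t)) /\
  series (fun n => u n * (r ^+ n * sin (n%:R * t))) @ \oo --> complex.Im (f (polar r t)).
Proof.
move=> fu r01; have := fu _ (polar_norm_lt1 t r01); move: (f _) => w.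
move=> /cvgrPdist_lt h.
have {}h (e : R) : 0 < e -> \forall n \near \oo,
    `|w - series (fun n => (u n)%:C * polar r t ^+ n) n| < e%:C.
  by move=> e0; apply: h; rewrite (ltcR 0 e).
have bnd (z : R[i]) (e : R) : `|z| < e%:C -> `|complex.Re z| <= e /\ `|complex.Im z| <= e.
  rewrite normc_def (ltcR _ e) => ze.
  have e0 : 0 <= e by apply: le_trans (ltW ze); exact: sqrtr_ge0.
  split; apply: le_trans (ltW ze); rewrite -sqrtr_sqr ler_wsqrtr//.
    by rewrite lerDl sqr_ge0.
  by rewrite lerDr sqr_ge0.
split; apply/cvgrPdist_le => e e0; apply: filterS (h e e0) => n /bnd[];
  by rewrite ReIm_series; case: (w).
Qed.

End complex_power_series.

Section Szego.
Context {R : realType}.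
Local Open Scope complex_scope.
Local Notation mu := (@lebesgue_measure R).

Definition poisson (r x : R) : R := (1 - r ^+ 2) / (1 - 2 * r * cos x + r ^+ 2).

Lemma expiE (t : R) : expi t = polar 1 t.
Proof.
by rewrite /expi /expC/= expR0 /polar; apply/eqP; rewrite eq_complex/= !mul1r !mul0r subr0 addr0 !eqxx.
Qed.

Lemma poisson_den_gt0 (r x : R) : 0 <= r < 1 -> 0 < 1 - 2 * r * cos x + r ^+ 2.
Proof.
move=> /andP[r0 r1]; have := cos_le1 x => c1.
have : 0 < (1 - r) ^+ 2 by rewrite exprn_gt0// subr_gt0.
by nra.
Qed.

Lemma Re_poisson (r t s : R) (v : R) : 0 <= r < 1 ->
  complex.Re ((expi s + polar r t) / (expi s - polar r t) * v%:C) =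
  poisson r (s - t) * v.
Proof.
move=> r01; rewrite expiE /polar /poisson cosB.
have := poisson_den_gt0 (s - t) r01; rewrite cosB => den.
have e1 : (1 * cos s - r * cos t) ^+ 2 + (1 * sin s - r * sin t) ^+ 2 =
    1 - 2 * r * (cos s * cos t + sin s * sin t) + r ^+ 2.
  have := cos2Dsin2 s; have := cos2Dsin2 t.
  move: (cos s) (sin s) (cos t) (sin t) => a b c d h1 h2.
  transitivity ((a ^+ 2 + b ^+ 2) - 2 * r * (a * c + b * d) + r ^+ 2 * (c ^+ 2 + d ^+ 2)).
    by ring.
  by rewrite h1 h2; ring.
have e2 : (1 * cos s + r * cos t) * (1 * cos s - r * cos t) +
    (1 * sin s + r * sin t) * (1 * sin s - r * sin t) = 1 - r ^+ 2.
  have := cos2Dsin2 s; have := cos2Dsin2 t.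
  move: (cos s) (sin s) (cos t) (sin t) => a b c d h1 h2.
  transitivity ((a ^+ 2 + b ^+ 2) - r ^+ 2 * (c ^+ 2 + d ^+ 2)); first by ring.
  by rewrite h1 h2; ring.
rewrite /= e1 mulr0 subr0 -e2; congr (_ * _).
move: (_ + _ ^+ 2) den => D D0; field; exact: lt0r_neq0.
Qed.

Variable Delta : R -> R.

Definition log_poisson (r t : R) : R :=
  \int[mu]_(s in `[- pi, pi]) (poisson r (s - t) * ln (Delta s)).

(** As |exp w|^2 = exp (2 Re w), the factor 1 / (4 pi) becomes the normalization 1 / (2 pi) of the
    Poisson integral. *)
Lemma nsq_szego (r t : R) : 0 <= r < 1 ->
  nsq (szego_function Delta (polar r t)) =
  2 * pi * expR ((2 * pi)^-1 * log_poisson r t).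
Proof.
move=> r01; rewrite /szego_function nsqM nsq_real nsq_expC sqr_sqrtr ?mulr_ge0 ?pi_ge0//.
congr (_ * expR _).
have -> : complex.Re (((4 * pi)^-1)%:C * Cintegral (fun s =>
     (expi s + polar r t) / (expi s - polar r t) * (ln (Delta s))%:C)) =
    (4 * pi)^-1 * log_poisson r t.
  rewrite /Cintegral/= mul0r subr0; congr (_ * _); apply: eq_Rintegral => s _.
  exact: Re_poisson.
have p0 : pi != 0 :> R := lt0r_neq0 (pi_gt0 R).
by move: (log_poisson r t) (pi : R) p0 => L p p0; field.
Qed.

Variables c a : nat -> R.
Hypothesis hc : MA_coefficients Delta c.
Hypothesis ha : AR_coefficients Delta a.

Definition cos_sum (u : nat -> R) (r t : R) := tsum (fun n => u n * (r ^+ n * cos (n%:R * t))).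
Definition sin_sum (u : nat -> R) (r t : R) := tsum (fun n => u n * (r ^+ n * sin (n%:R * t))).

Lemma AR_nsq (r t : R) : 0 <= r < 1 ->
  2 * pi * (cos_sum a r t ^+ 2 + sin_sum a r t ^+ 2) *
    expR ((2 * pi)^-1 * log_poisson r t) = 1.
Proof.
move=> r01; have [h1 h2] := power_series_polar t ha r01.
have h := nsq_szego t r01; have hz : nsq (szego_function Delta (polar r t)) != 0.
  by rewrite h !mulf_neq0 ?gt_eqF ?pi_gt0 ?expR_gt0.
rewrite /cos_sum /sin_sum (tsum_eq h1) (tsum_eq h2) -/(nsq _).
rewrite mulrAC -h mulrC -nsqM mulNr mulVf; last by rewrite -nsq_eq0.
by rewrite /nsq/= oppr0 expr0n addr0 sqrrN expr1n.
Qed.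

Lemma MA_AR_polar (r t : R) (A2 := cos_sum a r t ^+ 2 + sin_sum a r t ^+ 2) : 0 <= r < 1 ->
  cos_sum c r t = - (cos_sum a r t / A2) /\ sin_sum c r t = sin_sum a r t / A2.
Proof.
move=> r01; have [h1 h2] := power_series_polar t ha r01.
have [h3 h4] := power_series_polar t hc r01.
have A2E : A2 = nsq (- (szego_function Delta (polar r t))^-1).
  by rewrite /A2 /cos_sum /sin_sum (tsum_eq h1) (tsum_eq h2).
rewrite A2E /cos_sum /sin_sum (tsum_eq h1) (tsum_eq h2) (tsum_eq h3) (tsum_eq h4).
have h := nsq_szego t r01; have hz : nsq (szego_function Delta (polar r t)) != 0.
  by rewrite h !mulf_neq0 ?gt_eqF ?pi_gt0 ?expR_gt0.
move: (szego_function _ _) hz => z hz.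
rewrite ReN ImN ReV ImV opprK.
have -> : nsq (- z^-1) = (nsq z)^-1.
  rewrite /nsq ReN ImN ReV ImV opprK sqrrN.
  move: hz; rewrite /nsq; move: (complex.Re z) (complex.Im z) => x y hz.
  by field.
by move: (nsq z) hz => D D0; split; field.
Qed.

End Szego.

(** * Uniqueness of power series coefficients and a * c = - delta *)

Section power_series_coefficients.
Context {R : realType}.

Lemma asum_geometric_bounded (b : nat -> R) (M r : R) : 0 <= r < 1 ->
  (forall n, `|b n| <= M) -> abs_summable (fun n => b n * r ^+ n).
Proof.
move=> /andP[r0 r1] bM; have sr : abs_summable (fun n => r ^+ n).
  apply/abs_summableP; rewrite (_ : [normed series _] = series (geometric 1 r)).
    by apply: is_cvg_geometric_series; rewrite ger0_norm.
  apply/funext => n; apply: eq_bigr => i _.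
  by rewrite /geometric/= mul1r ger0_norm// exprn_ge0.
apply: asum_le (asumZ M sr) => n.
by rewrite normrM [`|r ^+ n|]ger0_norm ?exprn_ge0// ler_wpM2r ?exprn_ge0.
Qed.

Lemma power_series_eq0 (b : nat -> R) (M : R) : (forall n, `|b n| <= M) ->
  (forall r, 0 < r < 1 -> tsum (fun n => b n * r ^+ n) = 0) -> forall n, b n = 0.
Proof.
move=> bM b0 n; have M0 : 0 <= M := le_trans (normr_ge0 _) (bM 0).
elim/ltn_ind: n => n ih.
(* With the earlier coefficients 0, division by r^n gives b_n = - r sum_i b_{i+n+1} r^i, which is at
   most M r / (1 - r) <= 2 M r in modulus. *)
have key (r : R) : 0 < r <= 2^-1 -> `|b n| <= 2 * M * r.
  move=> /andP[r0 r2]; have r01 : 0 < r < 1 by rewrite r0; lra.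
  have r01' : 0 <= r < 1 by have := r01; lra.
  have sb (b' : nat -> R) : (forall n, `|b' n| <= M) -> abs_summable (fun n => b' n * r ^+ n).
    exact: asum_geometric_bounded.
  have := b0 r r01; rewrite (tsum_split n (sb _ bM)) big_nat big1 => [|i /andP[_ /ih->]]; last first.
    by rewrite mul0r.
  have -> : tsum (fun i => b (i + n)%N * r ^+ (i + n)) =
      r ^+ n * (b n + r * tsum (fun i => b (i + n).+1 * r ^+ i)).
    have s1 : abs_summable (fun i => b (i + n)%N * r ^+ i) by exact: sb.
    have s2 : abs_summable (fun i => b (i + n).+1 * r ^+ i) by exact: (sb (fun i => b (i + n).+1)).
    transitivity (tsum (fun i => r ^+ n * (b (i + n)%N * r ^+ i))).
      by apply: eq_tsum => i; rewrite exprD; ring.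
    rewrite tsumZ//; congr (_ * _); rewrite (tsum_recl s1) add0n expr0 mulr1.
    congr (_ + _); rewrite -tsumZ//; apply: eq_tsum => i.
    by rewrite addSn exprS; ring.
  rewrite add0r => /eqP; rewrite mulf_eq0 expf_eq0 (gt_eqF r0) andbF/= addr_eq0 => /eqP ->.
  have s2 : abs_summable (fun i => b (i + n).+1 * r ^+ i) by exact: (sb (fun i => b (i + n).+1)).
  rewrite normrN normrM gtr0_norm// mulrC ler_wpM2r ?(ltW r0)//.
  apply: le_trans (ler_norm_tsum s2) _.
  apply: tsum_le_bound => [|k]; first exact: asum_norm.
  apply: (@le_trans _ _ (\sum_(0 <= i < k) M * r ^+ i)).
    apply: ler_sum => i _; rewrite normrM [`|r ^+ i|]ger0_norm ?exprn_ge0 ?(ltW r0)//.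
    by rewrite ler_wpM2r ?exprn_ge0 ?(ltW r0).
  rewrite -mulr_sumr mulrC ler_wpM2r//.
  have geo : (1 - r) * (\sum_(0 <= i < k) r ^+ i) = 1 - r ^+ k.
    elim: k => [|k ihk]; first by rewrite big_geq// mulr0 expr0 subrr.
    by rewrite big_nat_recr//= mulrDr ihk exprS; ring.
  have rk0 : 0 <= r ^+ k by rewrite exprn_ge0// ltW.
  have s0 : 0 <= \sum_(0 <= i < k) r ^+ i by apply: sumr_ge0 => i _; rewrite exprn_ge0// ltW.
  by move: geo rk0 s0; move: (\sum_(_ <= _ < _) _) (r ^+ k) => s q; nra.
apply/eqP; rewrite -normr_le0; apply/ler_addgt0Pr => e e0; rewrite add0r.
pose r := Num.min 2^-1 (e / (2 * M + 1)).
have d0 : 0 < 2 * M + 1 by rewrite ltr_wpDl// mulr_ge0.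
have r0 : 0 < r by rewrite lt_min invr_gt0 ltr0n/= divr_gt0.
apply: (le_trans (key r _)); first by rewrite r0 ge_min lexx.
have : r <= e / (2 * M + 1) by rewrite ge_min lexx orbT.
rewrite ler_pdivlMr// mulrC; apply: le_trans.
by rewrite ler_wpM2r ?(ltW r0)// lerDl.
Qed.

Section MA_AR.
Variables (Delta : R -> R) (c a : nat -> R).
Hypothesis hc : MA_coefficients Delta c.
Hypothesis ha : AR_coefficients Delta a.
Hypothesis sa : abs_summable a.
Hypothesis sc : sqsummable c.

(** On the real axis the two power series have product -1, so a * c + delta has bounded coefficients
    and a power series that vanishes on (0, 1). *)
Lemma conv_MA_AR n : conv a c n = - (n == 0%N)%:R.
Proof.
have sc0 := sqnorm_ge0 sc.
have c_le := sqsum_bounded sc.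
have a_le k : `|a k| <= tsum (fun n => `|a n|).
  by apply: (@term_le_tsum _ (fun n => `|a n|)) => //; exact: asum_norm.
pose b k := conv a c k + (k == 0%N)%:R.
suff : forall k, b k = 0 by move=> /(_ n)/eqP; rewrite addr_eq0 => /eqP.
apply: (@power_series_eq0 _ (tsum (fun n => `|a n|) * (1 + sqnorm c) + 1)).
  move=> k; apply: le_trans (ler_normD _ _) _; apply: lerD; last first.
    by case: (k == 0%N); rewrite ?normr1 ?normr0.
  apply: le_trans (ler_norm_sum _ _ _) _.
  apply: (@le_trans _ _ (\sum_(0 <= s < k.+1) `|a s| * (1 + sqnorm c))).
    by apply: ler_sum => s _; rewrite normrM ler_wpM2l.
  rewrite -mulr_suml ler_wpM2r// ?addr_ge0//.
  by apply: psum_le_tsum => //; exact: asum_norm.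
move=> r /andP[r0 r1]; have r01 : 0 <= r < 1 by rewrite ltW.
have ca : tsum (fun n => c n * r ^+ n) * tsum (fun n => a n * r ^+ n) = -1.
  have [] := MA_AR_polar hc ha 0 r01.
  have := AR_nsq ha 0 r01.
  have cosE (u : nat -> R) : cos_sum u r 0 = tsum (fun n => u n * r ^+ n).
    by apply: eq_tsum => k; rewrite mulr0 cos0 mulr1.
  have sinE (u : nat -> R) : sin_sum u r 0 = 0.
    rewrite /sin_sum (@tsum_fin _ 0) ?big_geq// => k _.
    by rewrite mulr0 sin0 !mulr0.
  rewrite !cosE !sinE expr0n addr0 => /eqP h -> _.
  have A0 : tsum (fun n => a n * r ^+ n) != 0.
    by apply/eqP => A0; move: h; rewrite A0 expr0n mulr0 mul0r eq_sym oner_eq0.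
  by field.
have sca : abs_summable (fun n => c n * r ^+ n) := asum_geometric_bounded r01 c_le.
have saa : abs_summable (fun n => a n * r ^+ n) := asum_geometric_bounded r01 a_le.
have dca : dsummable (fun k s => (c k * r ^+ k) * (a s * r ^+ s)).
  apply: (@dsummable_intro _ _ (fun k => `|c k * r ^+ k| * tsum (fun s => `|a s * r ^+ s|))).
  - by move=> k; exact: asumZ.
  - by move=> k; under eq_tsum do rewrite normrM; rewrite tsumZ//; exact: asum_norm.
  - by under eq_fun do rewrite mulrC; apply: asumZ; exact: asum_norm.
have tE t : \sum_(0 <= s < t.+1) (c (t - s)%N * r ^+ (t - s)) * (a s * r ^+ s) =
    conv a c t * r ^+ t.
  rewrite /conv mulr_suml; apply: eq_big_nat => s /andP[_ st].
  have -> : r ^+ t = r ^+ (t - s) * r ^+ s by rewrite -exprD subnK.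
  by ring.
have sconv : abs_summable (fun t => conv a c t * r ^+ t).
  by have := asum_diag dca; under eq_fun do rewrite tE.
have sdelta : abs_summable (fun t => (t == 0%N)%:R * r ^+ t).
  by apply: (@asum_fin _ 1) => -[|k]// _; rewrite mul0r.
under eq_tsum do rewrite mulrDl.
rewrite tsumD// (@tsum_fin _ 1 (fun t => _%:R * _)); last by case=> // k _; rewrite mul0r.
rewrite big_nat1 eqxx mul1r expr0.
under eq_tsum do rewrite -tE.
rewrite (tsum_diag dca).
under eq_tsum => k do rewrite tsumZ// mulrC.
by rewrite tsumZ// mulrC ca addNr.
Qed.

End MA_AR.

End power_series_coefficients.

(** * Poisson integrals *)

Section trigonometric_integrals.
Context {R : realType}.
Local Notation mu := (@lebesgue_measure R).
Local Notation D := (`[- pi, pi]%classic : set R).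

Lemma continuous_integrable_pi (f : R -> R) : continuous f ->
  mu.-integrable D (EFin \o f).
Proof.
move=> cf; apply: continuous_compact_integrable; first exact: segment_compact.
exact: continuous_subspaceT.
Qed.

Lemma continuous_cos_affine (k b : R) : continuous (fun s => cos (k * s + b)).
Proof.
move=> x; apply: continuous_comp; last exact: continuous_cos.
by apply: cvgD; [apply: cvgM; [exact: cvg_cst|exact: cvg_id]|exact: cvg_cst].
Qed.

Lemma integral_cos (j : nat) (b : R) :
  \int[mu]_(s in D) cos (j%:R * s + b) = if j == 0%N then 2 * pi * cos b else 0.
Proof.
case: ifPn => [/eqP->|j0].
  under eq_Rintegral do rewrite mul0r add0r.
  rewrite Rintegral_cst//= lebesgue_measure_itv/= lte_fin.
  rewrite ifT; last by rewrite gtrN// pi_gt0.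
  by rewrite -EFinB/= opprK; ring.
have j0' : j%:R != 0 :> R by rewrite pnatr_eq0.
pose F (s : R) := j%:R^-1 * sin (j%:R * s + b).
have dF (s : R) : is_derive s 1 F (cos (j%:R * s + b)).
  have d1 : is_derive s 1 (fun s => j%:R * s + b) (j%:R : R).
    have := is_deriveD (is_deriveZ j%:R (is_derive_id s (1 : R))) (is_derive_cst b s (1 : R)).
    by rewrite /GRing.scale/= mulr1 addr0.
  have := is_deriveZ j%:R^-1 (@is_derive1_comp _ _ _ _ _ _ (is_derive_sin _) d1).
  by rewrite /GRing.scale/= mulrCA mulVf// mulr1.
have cF : continuous F.
  by move=> s; apply: differentiable_continuous; apply/derivable1_diffP.
rewrite /Rintegral (@continuous_FTC2 _ _ F); first last.
- by move=> s _; rewrite derive1E (@derive_val _ _ _ _ _ _ _ (dF s)).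
- split; [by move=> s _|exact/cvg_at_right_filter/cF|exact/cvg_at_left_filter/cF].
- by apply: continuous_subspaceT; exact: continuous_cos_affine.
- by rewrite gtrN// pi_gt0.
have /= := @periodicn _ _ (@sin R) _ (@sinD2pi R) j (j%:R * - pi + b).
rewrite /= /F; set u := (X in sin X = _ -> _); have -> : u = j%:R * pi + b.
  by rewrite /u -mulr_natr mulr2n; ring.
by move=> ->; rewrite subrr.
Qed.

Lemma Rintegral_pi_cst (k : R) : \int[mu]_(s in D) k = k * (2 * pi).
Proof.
have /= := integral_cos 0 0; under eq_Rintegral do rewrite mul0r add0r cos0.
rewrite cos0 mulr1 => <-; rewrite -RintegralZl//; last first.
  by apply: continuous_integrable_pi => x; exact: cvg_cst.
by apply: eq_Rintegral => s _; rewrite mulr1.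
Qed.

(** A partial sum of the Fourier series of the Poisson kernel; r = 1 would give the Dirichlet
    kernel. *)
Definition dirichlet (r x : R) (n : nat) : R :=
  1 + \sum_(0 <= k < n) 2 * r ^+ k.+1 * cos (k.+1%:R * x).

(** Multiplication by the denominator telescopes, because 2 cos x cos (k x) = cos ((k + 1) x) + cos
    ((k - 1) x). *)
Lemma dirichlet_poisson (r x : R) n :
  (1 - 2 * r * cos x + r ^+ 2) * dirichlet r x n =
  1 - r ^+ 2 - 2 * r ^+ n.+1 * cos (n.+1%:R * x) + 2 * r ^+ n.+2 * cos (n%:R * x).
Proof.
elim: n => [|n ih].
  by rewrite /dirichlet big_geq// !mul1r mul0r cos0; ring.
have -> : dirichlet r x n.+1 = dirichlet r x n + 2 * r ^+ n.+1 * cos (n.+1%:R * x).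
  by rewrite /dirichlet big_nat_recr//= addrA.
rewrite mulrDr ih.
have -> : n.+2%:R * x = n.+1%:R * x + x by rewrite -[in LHS]natr1; ring.
have -> : n%:R * x = n.+1%:R * x - x by rewrite -natr1; ring.
by rewrite !cosD cosN sinN !exprS; ring.
Qed.

Lemma poisson_dirichlet_le (r x : R) n : 0 <= r < 1 ->
  `|poisson r x - dirichlet r x n| <= 4 / (1 - r) ^+ 2 * r ^+ n.+1.
Proof.
move=> r01; have den := poisson_den_gt0 x r01; have /andP[r0 r1] := r01.
have d1 : 0 < (1 - r) ^+ 2 by rewrite exprn_gt0// subr_gt0.
have den_ge : (1 - r) ^+ 2 <= 1 - 2 * r * cos x + r ^+ 2.
  by have := cos_le1 x; nra.
have -> : poisson r x - dirichlet r x n =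
    (2 * r ^+ n.+1 * cos (n.+1%:R * x) - 2 * r ^+ n.+2 * cos (n%:R * x)) /
    (1 - 2 * r * cos x + r ^+ 2).
  have h := dirichlet_poisson r x n; rewrite /poisson.
  apply: (mulIf (lt0r_neq0 den)); rewrite mulrBl divfK ?lt0r_neq0// divfK ?lt0r_neq0//.
  by rewrite [dirichlet _ _ _ * _]mulrC h; ring.
rewrite normrM normfV (gtr0_norm den) [leRHS]mulrAC ler_pM ?invr_ge0 ?(ltW den)//.
  have rn0 : 0 <= r ^+ n.+1 by rewrite exprn_ge0.
  rewrite (exprS r n.+1); move: (r ^+ n.+1) rn0 => q q0.
  have := cos_max (n.+1%:R * x); have := cos_max (n%:R * x).
  move: (cos (n.+1%:R * x)) (cos (n%:R * x)) => u v /ler_normlP[v1 v2] /ler_normlP[u1 u2].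
  have h1 : - q <= q * u <= q by nra.
  have h2 : - q <= r * q * v <= q by have : 0 <= r * q <= q; nra.
  by apply/ler_normlP; split; lra.
by rewrite lef_pV2 ?posrE.
Qed.

Lemma poisson_ge0 (r x : R) : 0 <= r < 1 -> 0 <= poisson r x.
Proof.
move=> r01; apply: divr_ge0; last exact: ltW (poisson_den_gt0 _ r01).
rewrite subr_ge0; by case/andP: r01 => r0 r1; rewrite expr_le1// ltW.
Qed.

Lemma continuous_poisson (r : R) : 0 <= r < 1 -> continuous (poisson r).
Proof.
move=> r01 x; rewrite /poisson; apply: cvgM; first exact: cvg_cst.
apply: cvgV; first by rewrite lt0r_neq0// poisson_den_gt0.
apply: cvgD; last exact: cvg_cst.
apply: cvgB; first exact: cvg_cst.
by apply: cvgM; [exact: cvg_cst|exact: continuous_cos].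
Qed.

Lemma continuous_shift_fun (f : R -> R) (t : R) : continuous f ->
  continuous (fun s => f (s - t)).
Proof.
move=> cf x; apply: continuous_comp; last exact: cf.
by apply: cvgB; [exact: cvg_id|exact: cvg_cst].
Qed.

Lemma continuous_dirichlet (r : R) n : continuous (fun x => dirichlet r x n).
Proof.
move=> x; rewrite /dirichlet; elim: n => [|n ih].
  by under eq_fun do rewrite big_geq//; exact: cvg_cst.
under eq_fun do rewrite big_nat_recr//= addrA.
apply: cvgD; first exact: ih.
apply: cvgM; first exact: cvg_cst.
by have := @continuous_cos_affine n.+1%:R 0 x; under eq_fun do rewrite addr0.
Qed.

Lemma integral_dirichlet (r t : R) n :
  \int[mu]_(s in D) dirichlet r (s - t) n = 2 * pi.
Proof.
elim: n => [|n ih].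
  under eq_Rintegral do rewrite /dirichlet big_geq// addr0.
  have := integral_cos 0 0; under eq_Rintegral do rewrite mul0r add0r cos0.
  by rewrite cos0 mulr1.
have dE s : dirichlet r (s - t) n.+1 = dirichlet r (s - t) n +
    2 * r ^+ n.+1 * cos (n.+1%:R * s + (n.+1%:R * - t)).
  by rewrite /dirichlet big_nat_recr//= addrA mulrDr.
under eq_Rintegral do rewrite dE.
have c1 : continuous (fun s : R => dirichlet r (s - t) n).
  exact: (continuous_shift_fun (@continuous_dirichlet r n)).
have c2 : continuous (fun s : R => 2 * r ^+ n.+1 * cos (n.+1%:R * s + (n.+1%:R * - t))).
  by move=> x; apply: cvgM; [exact: cvg_cst|exact: continuous_cos_affine].
rewrite RintegralD//; [|exact: continuous_integrable_pi..].
rewrite ih RintegralZl//; last by apply: continuous_integrable_pi; exact: continuous_cos_affine.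
by rewrite integral_cos/= mulr0 addr0.
Qed.

Lemma integral_poisson (r t : R) : 0 <= r < 1 ->
  \int[mu]_(s in D) poisson r (s - t) = 2 * pi.
Proof.
move=> r01; have /andP[r0 r1] := r01.
have ip : mu.-integrable D (EFin \o (fun s => poisson r (s - t))).
  by apply: continuous_integrable_pi; exact: (continuous_shift_fun (continuous_poisson r01)).
have id n : mu.-integrable D (EFin \o (fun s => dirichlet r (s - t) n)).
  by apply: continuous_integrable_pi; exact: (continuous_shift_fun (@continuous_dirichlet r n)).
apply/eqP; rewrite -subr_eq0 -normr_le0.
pose B := 4 / (1 - r) ^+ 2 * (2 * pi).
have cpd n : continuous (fun s : R => poisson r (s - t) - dirichlet r (s - t) n).
  move=> x; apply: cvgB; first exact: (continuous_shift_fun (continuous_poisson r01)).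
  exact: (continuous_shift_fun (@continuous_dirichlet r n)).
have bnd n : `|\int[mu]_(s in D) poisson r (s - t) - 2 * pi| <= B * r ^+ n.+1.
  rewrite -(integral_dirichlet r t n) -RintegralB//.
  apply: le_trans (le_normr_Rintegral _ _) _ => //; first exact: continuous_integrable_pi.
  apply: (@le_trans _ _ (\int[mu]_(s in D) (4 / (1 - r) ^+ 2 * r ^+ n.+1))).
    apply: le_Rintegral => //.
    - by apply: continuous_integrable_pi => x; apply: cvg_norm; exact: cpd.
    - by apply: continuous_integrable_pi => x; exact: cvg_cst.
    - by move=> s _; exact: poisson_dirichlet_le.
  by rewrite Rintegral_pi_cst /B le_eqVlt; apply/orP; left; apply/eqP; ring.
have cv : (fun n => B * r ^+ n.+1) @ \oo --> (0 : R).
  rewrite -(mulr0 B); apply: cvgM; first exact: cvg_cst.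
  have : (fun n => r ^+ n) @ \oo --> (0 : R) by apply: cvg_expr; rewrite ger0_norm.
  by rewrite -(cvg_shiftn 1); under eq_fun do rewrite addn1.
by apply: (ler_cvg_to (cvg_cst _) cv); exact: nearW.
Qed.

End trigonometric_integrals.

Lemma ereal_cvg0 {R : realType} (u : nat -> \bar R) : (forall m, 0 <= u m)%E ->
  (forall e : R, 0 < e -> \forall m \near \oo, (u m <= e%:E)%E) ->
  u @ \oo --> 0%E.
Proof.
move=> u0 ue; apply/fine_cvgP; split.
  by apply: filterS (ue 1 ltr01) => m um; rewrite ge0_fin_numE// (le_lt_trans um)// ltry.
apply/cvgrPdist_le => e e0; apply: filterS (ue e e0) => m um.
rewrite sub0r normrN ger0_norm ?fine_ge0//= -lee_fin fineK//.
by rewrite ge0_fin_numE// (le_lt_trans um)// ltry.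
Qed.

(** * The Poisson kernel as an approximate identity *)

Section Poisson_kernel.
Context {R : realType}.
Local Notation mu := (@lebesgue_measure R).
Local Notation D := (`[- pi, pi]%classic : set R).

Definition pkernel (r t s : R) : R := (2 * pi)^-1 * poisson r (s - t).

Let pi2_gt0 : 0 < 2 * pi :> R. Proof. by rewrite mulr_gt0// pi_gt0. Qed.

Lemma pkernel_ge0 r t s : 0 <= r < 1 -> 0 <= pkernel r t s.
Proof. by move=> r01; rewrite mulr_ge0 ?invr_ge0 ?(ltW pi2_gt0)// poisson_ge0. Qed.

Lemma pkernelC r t s : pkernel r t s = pkernel r s t.
Proof. by rewrite /pkernel /poisson -[s - t]opprB cosN. Qed.

Lemma continuous_pkernel r t : 0 <= r < 1 -> continuous (pkernel r t).
Proof.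
move=> r01 s; apply: cvgM; first exact: cvg_cst.
exact: (continuous_shift_fun (continuous_poisson r01)).
Qed.

(** The denominator is (1 - r)^2 + 2 r (1 - cos x). Away from x = 0 the kernel therefore vanishes
    uniformly as r tends to 1. *)
Lemma poisson_le r (x k : R) : 0 < r < 1 -> cos x <= k -> k < 1 ->
  poisson r x <= (1 - r ^+ 2) / (2 * r * (1 - k)).
Proof.
move=> /andP[r0 r1] xk k1; rewrite /poisson ler_wpM2l//.
  by rewrite subr_ge0 expr_le1// ltW.
have d0 : 0 < 2 * r * (1 - k) by rewrite !mulr_gt0// subr_gt0.
have le : 2 * r * (1 - k) <= 1 - 2 * r * cos x + r ^+ 2.
  by have := sqr_ge0 (1 - r); nra.
by rewrite lef_pV2// posrE//; exact: lt_le_trans le.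
Qed.

Lemma poisson_le_max r (x : R) : 0 <= r < 1 -> poisson r x <= (1 - r ^+ 2) / (1 - r) ^+ 2.
Proof.
move=> r01; have /andP[r0 r1] := r01.
rewrite /poisson ler_wpM2l//; first by rewrite subr_ge0 expr_le1// ltW.
have d0 : 0 < (1 - r) ^+ 2 by rewrite exprn_gt0// subr_gt0.
rewrite lef_pV2// ?posrE//; last exact: poisson_den_gt0.
by have := cos_le1 x; nra.
Qed.

Lemma pkernel_mass r t : 0 <= r < 1 -> (\int[mu]_(s in D) (pkernel r t s)%:E = 1)%E.
Proof.
move=> r01.
have ik : mu.-integrable D (EFin \o pkernel r t).
  by apply: continuous_integrable_pi; exact: continuous_pkernel.
rewrite -[LHS]fineK; last exact: (integrable_fin_num _ ik).
rewrite -[fine _]/(\int[mu]_(s in D) pkernel r t s) RintegralZl//; last first.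
  by apply: continuous_integrable_pi; exact: (continuous_shift_fun (continuous_poisson r01)).
by rewrite integral_poisson// mulVf// gt_eqF.
Qed.

Lemma measurable_pkernel2 r : 0 <= r < 1 ->
  measurable_fun setT (fun z : R * R => pkernel r z.1 z.2).
Proof.
move=> r01; apply: measurable_funM; first exact: measurable_cst.
have mp : measurable_fun setT (poisson r).
  by apply: continuous_measurable_fun; exact: (continuous_poisson r01).
apply: (measurableT_comp mp).
by apply: measurable_funB; [exact: measurable_snd|exact: measurable_fst].
Qed.

Section Tonelli.
Variable h : R * R -> R.
Hypothesis mh : measurable_fun setT h.
Hypothesis h0 : forall z, 0 <= h z.

Let mD : measurable D. Proof. by []. Qed.

(** Extension by 0 outside the square, to apply Tonelli's theorem on the whole product space. *)
Let hD : R * R -> \bar R := (EFin \o h) \_ (D `*` D).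

Let mhD : measurable_fun setT hD.
Proof.
apply/(measurable_restrictT _ (measurableX mD mD)).
by apply/measurable_EFinP; exact: measurable_funTS.
Qed.

Let hD0 z : (0 <= hD z)%E.
Proof. by rewrite /hD /patch; case: ifP => //= _; rewrite lee_fin. Qed.

Let FE : (fun t => \int[mu]_s hD (t, s))%E =
  (fun t => \int[mu]_(s in D) (h (t, s))%:E)%E \_ D.
Proof.
apply/funext => t; rewrite /patch; case: ifPn => tD.
  rewrite [RHS]integral_mkcond; apply: eq_integral => s _.
  by rewrite /hD /patch in_setX tD.
rewrite integral0_eq// => s _.
by rewrite /hD /patch in_setX (negbTE tD).
Qed.

Let GE : (fun s => \int[mu]_t hD (t, s))%E =
  (fun s => \int[mu]_(t in D) (h (t, s))%:E)%E \_ D.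
Proof.
apply/funext => s; rewrite /patch; case: ifPn => sD.
  rewrite [RHS]integral_mkcond; apply: eq_integral => t _.
  by rewrite /hD /patch in_setX sD andbT.
rewrite integral0_eq// => t _.
by rewrite /hD /patch in_setX (negbTE sD) andbF.
Qed.

Lemma measurable_section_integral :
  measurable_fun D (fun t => \int[mu]_(s in D) (h (t, s))%:E)%E.
Proof.
apply/measurable_restrictT => //; rewrite -FE.
exact: (@measurable_fun_fubini_tonelli_F _ _ _ _ _ mu hD mhD hD0).
Qed.

Lemma Tonelli : (\int[mu]_(t in D) \int[mu]_(s in D) (h (t, s))%:E =
  \int[mu]_(s in D) \int[mu]_(t in D) (h (t, s))%:E)%E.
Proof.
rewrite [LHS]integral_mkcond [RHS]integral_mkcond -FE -GE.
exact: (@fubini_tonelli _ _ _ _ _ mu mu hD mhD hD0).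
Qed.

End Tonelli.

(** By Tonelli and the symmetry of the kernel, integrating over t first meets its total mass 1. *)
Lemma integral_pkernel_conv r (w : R -> R) : 0 <= r < 1 ->
  measurable_fun setT w -> (forall s, 0 <= w s) ->
  (\int[mu]_(t in D) \int[mu]_(s in D) (pkernel r t s * w s)%:E =
   \int[mu]_(s in D) (w s)%:E)%E.
Proof.
move=> r01 mw w0; rewrite (@Tonelli (fun z => pkernel r z.1 z.2 * w z.2))/=; first last.
- by move=> z; rewrite mulr_ge0// pkernel_ge0.
- by apply: measurable_funM; [exact: measurable_pkernel2|exact: measurableT_comp].
apply: eq_integral => s _.
under eq_integral => t _ do rewrite mulrC EFinM pkernelC.
rewrite ge0_integralZl//.
- by rewrite pkernel_mass// mule1.
- apply: measurable_funTS; apply/measurable_EFinP.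
  by apply: continuous_measurable_fun; exact: continuous_pkernel.
- by move=> t _; rewrite lee_fin pkernel_ge0.
- by rewrite lee_fin.
Qed.

Section approximate_identity.
Variable r : nat -> R.
Hypothesis r01 : forall m, 0 < r m < 1.
Hypothesis r1 : r m @[m --> \oo] --> (1 : R).

Let r01' m : 0 <= r m < 1. Proof. by have /andP[/ltW-> ->] := r01 m. Qed.

Section continuous_function.
Variables (g : R -> R).
Hypothesis cg : continuous g.

Let osc (m : nat) (t : R) : \bar R :=
  (\int[mu]_(s in D) (pkernel (r m) t s * `|g s - g t|)%:E)%E.

Let measurable_osc_integrand m :
  measurable_fun setT (fun z : R * R => pkernel (r m) z.1 z.2 * `|g z.2 - g z.1|).
Proof.
have mg := continuous_measurable_fun cg.
apply: measurable_funM; first exact: measurable_pkernel2.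
apply: measurableT_comp => //; apply: measurable_funB.
  exact: (measurableT_comp mg measurable_snd).
exact: (measurableT_comp mg measurable_fst).
Qed.

Let osc_ge0 m z : 0 <= pkernel (r m) z.1 z.2 * `|g z.2 - g z.1|.
Proof. by rewrite mulr_ge0// pkernel_ge0. Qed.

Lemma measurable_osc m : measurable_fun D (osc m).
Proof. exact: (measurable_section_integral (measurable_osc_integrand m) (osc_ge0 m)). Qed.

Let g_bounded : exists2 M : R, 0 <= M & forall s, D s -> `|g s| <= M.
Proof.
have cD : compact D by exact: segment_compact.
have /compact_bounded[M [_ mrt]] := continuous_compact (continuous_subspaceT cg) cD.
exists (`|M| + 1); first by rewrite addr_ge0.
move=> s Ds; apply: (mrt (`|M| + 1)); first by rewrite (le_lt_trans (ler_norm _))// ltrDl.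
by exists s.
Qed.

Let osc_le (m : nat) (t e B : R) : 0 <= e ->
  (forall s, D s -> pkernel (r m) t s * `|g s - g t| <= e * pkernel (r m) t s + B) -> 0 <= B ->
  (osc m t <= (e + B * (2 * pi))%:E)%E.
Proof.
move=> e0 H B0.
have mk : measurable_fun D (EFin \o pkernel (r m) t).
  apply: measurable_funTS; apply/measurable_EFinP.
  by apply: continuous_measurable_fun; exact: continuous_pkernel.
apply: (@le_trans _ _ (\int[mu]_(s in D) (e%:E * (pkernel (r m) t s)%:E + B%:E))%E).
  apply: ge0_le_integral => //.
  - by move=> s _; rewrite lee_fin; exact: (osc_ge0 m (t, s)).
  - apply: measurable_funTS; apply/measurable_EFinP; apply: measurable_funM.
      by apply: continuous_measurable_fun; exact: continuous_pkernel.
    apply: measurableT_comp => //; apply: measurable_funB; last exact: measurable_cst.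
    exact: continuous_measurable_fun.
  - exact: (emeasurable_funD (measurable_funeM e%:E mk) (measurable_cst B%:E)).
rewrite ge0_integralD//.
- rewrite ge0_integralZl//; last by move=> s _; rewrite lee_fin pkernel_ge0.
  rewrite pkernel_mass// mule1 integral_cst//= lebesgue_measure_itv/= lte_fin.
  rewrite ifT; last by rewrite gtrN// pi_gt0.
  rewrite -EFinB -EFinM -EFinD lee_fin opprK le_eqVlt; apply/orP; left; apply/eqP.
  by ring.
- by move=> s _; rewrite mule_ge0// lee_fin// pkernel_ge0.
- exact: measurable_funeM.
Qed.

(** Interior points only: [g] is not assumed periodic, and at an endpoint the kernel also charges
    the opposite end of the interval. *)
Let osc_cvg (t : R) : (- pi < t < pi) -> osc m t @[m --> \oo] --> 0%E.
Proof.
move=> /andP[tl tr].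
have [M M0 gM] := g_bounded.
apply: ereal_cvg0 => [m|e e0].
  by apply: integral_ge0 => s _; rewrite lee_fin; exact: (osc_ge0 m (t, s)).
have cgt : g @ t --> g t by exact: cg.
have /cvgrPdist_le/(_ (e / 2)) := cgt; rewrite divr_gt0// => /(_ isT)[d0 /= d00 Hd].
pose d := Num.min d0 pi; have dpi : 0 < d <= pi by rewrite lt_min d00 pi_gt0 ge_min lexx orbT.
have nt : `|t| < pi by rewrite ltr_norml tl tr.
(* If d <= |s - t| <= pi then cos (s - t) <= cos d. If |s - t| > pi, the distance on the circle is 2
   pi - |s - t| >= pi - |t|, whence the second term. *)
pose k := Num.max (cos d) (cos (pi - `|t|)).
have cos_lt1 (x : R) : 0 < x <= pi -> cos x < 1.
  move=> /andP[x0 xpi]; rewrite -(@cos0 R) ltr_cos ?in_itv/= ?lexx ?pi_ge0 ?(ltW x0)//.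
have k1 : k < 1.
  by rewrite gt_max !cos_lt1//= subr_gt0 nt/= lerBlDr lerDl.
have cos_le (x y : R) : 0 <= x -> x <= y -> y <= pi -> cos y <= cos x.
  move=> x0 xy ypi; rewrite leNgt ltr_cos ?in_itv/= ?x0 ?ypi ?(le_trans x0 xy) ?(le_trans xy ypi)//.
  by rewrite -leNgt.
have cosk s : D s -> d <= `|s - t| -> cos (s - t) <= k.
  move=> /=; rewrite in_itv/= => /andP[s1 s2] ds; have /andP[d_gt0 d_le] := dpi.
  have -> : cos (s - t) = cos `|s - t|.
    by case: (ltrP 0 (s - t)) => h; [rewrite gtr0_norm|rewrite ler0_norm// cosN].
  have [y1|y1] := leP `|s - t| pi; first by rewrite le_max cos_le// ltW.
  rewrite le_max; apply/orP; right.
  have -> : cos `|s - t| = cos (pi *+ 2 - `|s - t|).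
    by rewrite -cosN -[in LHS](@cosD2pi R) addrC.
  have yt : `|s - t| <= pi + `|t|.
    by rewrite (le_trans (ler_normB _ _))// lerD2r ler_norml s1 s2.
  by apply: cos_le; rewrite ?subr_ge0 ?(ltW nt)// mulr2n; move: y1 yt; lra.
pose B m := (2 * pi)^-1 * ((1 - r m ^+ 2) / (2 * r m * (1 - k))) * (2 * M).
have B_cvg : B m * (2 * pi) @[m --> \oo] --> (0 : R).
  have -> : 0 = (2 * pi)^-1 * ((1 - 1 ^+ 2) / (2 * 1 * (1 - k))) * (2 * M) * (2 * pi).
    by rewrite expr1n subrr !(mul0r, mulr0).
  apply: cvgM; last exact: cvg_cst.
  apply: cvgM; last exact: cvg_cst.
  apply: cvgM; first exact: cvg_cst.
  apply: cvgM.
    apply: cvgB; first exact: cvg_cst.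
    by rewrite expr2; under eq_fun do rewrite expr2; exact: cvgM.
  apply: cvgV; first by rewrite mulr1 mulf_neq0// subr_eq0 gt_eqF.
  apply: cvgM; last exact: cvg_cst.
  by apply: cvgM => //; exact: cvg_cst.
have B0 m : 0 <= B m.
  have /andP[h1 h2] := r01 m.
  rewrite /B !mulr_ge0 ?invr_ge0 ?(ltW pi2_gt0) ?divr_ge0 ?mulr_ge0 ?subr_ge0 ?(ltW k1) ?(ltW h1)//.
  by rewrite expr_le1// ltW.
have key m : (osc m t <= (e / 2 + B m * (2 * pi))%:E)%E.
  apply: osc_le => //; first by rewrite divr_ge0// ltW.
  move=> s Ds; have [sd|sd] := ltP `|s - t| d.
    have h : `|g s - g t| <= e / 2.
      by rewrite distrC; apply: Hd => /=; rewrite distrC (lt_le_trans sd)// ge_min lexx.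
    apply: le_trans (ler_wpM2l (pkernel_ge0 _ _ (r01' m)) h) _.
    by rewrite mulrC lerDl.
  apply: (@le_trans _ _ (B m)); last first.
    by rewrite lerDr mulr_ge0 ?divr_ge0 ?pkernel_ge0// ltW.
  apply: ler_pM => //; first exact: pkernel_ge0.
    rewrite ler_wpM2l ?invr_ge0 ?(ltW pi2_gt0)//.
    by apply: poisson_le => //; exact: cosk.
  rewrite (le_trans (ler_normB _ _))// mulr2n mulrDl mul1r lerD ?gM//=.
  by rewrite in_itv/= !ltW.
move/cvgrPdist_le: B_cvg => /(_ (e / 2)); rewrite divr_gt0// => /(_ isT).
apply: filterS => m; rewrite sub0r normrN => h; apply: le_trans (key m) _.
rewrite lee_fin [leRHS]splitr lerD2l; apply: le_trans h; exact: ler_norm.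
Qed.

Let integral_osc_cvg : (\int[mu]_(t in D) osc m t)%E @[m --> \oo] --> 0%E.
Proof.
have [M M0 gM] := g_bounded.
have [] := @dominated_convergence _ _ _ mu D _ osc (cst 0%E) (cst (2 * M)%:E) _ _ _ _ _ => //.
- exact: measurable_osc.
- exists [set - pi; pi]; split => //.
  + by apply: measurableU; exact: measurable_set1.
  + by rewrite measureU0//=; exact: lebesgue_measure_set1.
  + move=> t /= /not_implyP[]; rewrite in_itv/= => /andP[t1 t2] nt.
    apply: contrapT => /not_orP[tn1 tn2]; apply: nt; apply: osc_cvg.
    by rewrite !lt_neqAle t1 t2 !andbT; apply/andP; split; apply/eqP => // /esym.
- exact: integrable_itv_cst.
- apply: aeW => t m Dt; rewrite gee0_abs; last first.
    by apply: integral_ge0 => s _; rewrite lee_fin; exact: (osc_ge0 m (t, s)).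
  apply: le_trans (@osc_le m t (2 * M) 0 _ _ _) _ => //; rewrite ?mulr_ge0//.
    move=> s Ds; rewrite addr0 mulrC ler_wpM2r ?pkernel_ge0//.
    by rewrite (le_trans (ler_normB _ _))// mulr2n mulrDl mul1r lerD ?gM.
  by rewrite mul0r addr0.
by move=> _ _; rewrite integral_cst// mul0e.
Qed.

Variable f : R -> R.
Hypothesis intf : mu.-integrable D (EFin \o f).

Let mf : measurable_fun D f.
Proof. by case/integrableP : intf => /measurable_EFinP. Qed.

Let w : R -> R := (fun s => `|f s - g s|) \_ D.

Let mw : measurable_fun setT w.
Proof.
have mn : measurable_fun D (fun s => `|f s - g s|).
  apply: measurableT_comp => //; apply: measurable_funB => //; apply: measurable_funTS.
  exact: continuous_measurable_fun.
exact/(measurable_restrictT _ _).1.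
Qed.

Let w_ge0 s : 0 <= w s. Proof. by rewrite /w /patch; case: ifP. Qed.

Let wE s : D s -> w s = `|f s - g s|.
Proof. by move=> Ds; rewrite /w patchT// inE. Qed.

Let pk_cst m t v : mu.-integrable D (EFin \o (fun s => pkernel (r m) t s * v)).
Proof.
apply: continuous_integrable_pi => s.
by apply: cvgM; [exact: continuous_pkernel|exact: cvg_cst].
Qed.

Let pk_f m t : mu.-integrable D (EFin \o (fun s => pkernel (r m) t s * f s)).
Proof.
pose B := (2 * pi)^-1 * ((1 - r m ^+ 2) / (1 - r m) ^+ 2).
have mk : measurable_fun D (pkernel (r m) t).
  by apply: measurable_funTS; apply: continuous_measurable_fun; exact: continuous_pkernel.
apply: (@le_integrable _ _ _ mu D _ _ (fun s => B%:E * (f s)%:E)%E) => //.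
- by apply/measurable_EFinP; exact: measurable_funM.
- move=> s _ /=; rewrite lee_fin normrM [leRHS]normrM ler_wpM2r//.
  rewrite ger0_norm ?pkernel_ge0//; apply: (@le_trans _ _ B); last exact: ler_norm.
  by rewrite ler_wpM2l ?invr_ge0 ?(ltW pi2_gt0)// poisson_le_max.
- exact: integrableZl.
Qed.

Let conv_dist_le m t : D t ->
  ((`|\int[mu]_(s in D) (pkernel (r m) t s * f s) - f t|)%:E <=
   \int[mu]_(s in D) (pkernel (r m) t s * w s)%:E + osc m t + (w t)%:E)%E.
Proof.
move=> Dt.
have mk : measurable_fun D (pkernel (r m) t).
  by apply: measurable_funTS; apply: continuous_measurable_fun; exact: continuous_pkernel.
have mg : measurable_fun D g by apply: measurable_funTS; exact: continuous_measurable_fun.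
have -> : f t = \int[mu]_(s in D) (pkernel (r m) t s * f t).
  rewrite RintegralZr//; last by apply: continuous_integrable_pi; exact: continuous_pkernel.
  by rewrite /Rintegral pkernel_mass// mul1r.
have iB : mu.-integrable D (EFin \o (fun s => pkernel (r m) t s * f s - pkernel (r m) t s * f t)).
  exact: (integrableB _ (pk_f m t) (pk_cst m t (f t))).
rewrite -RintegralB ?EFin_normr_Rintegral//.
apply: le_trans (le_abse_integral _ _ _) _ => //.
  by apply/measurable_EFinP; apply: measurable_funB; apply: measurable_funM => //; exact: measurable_cst.
have -> : (w t)%:E = (\int[mu]_(s in D) (pkernel (r m) t s * w t)%:E)%E.
  under eq_integral do rewrite EFinM muleC.
  rewrite ge0_integralZl ?lee_fin//; first by rewrite pkernel_mass// mule1.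
  - exact/measurable_EFinP.
  - by move=> s _; rewrite lee_fin pkernel_ge0.
have m1 : measurable_fun D (fun s => (pkernel (r m) t s * w s)%:E).
  by apply/measurable_EFinP; apply: measurable_funM => //; exact: measurable_funTS.
have m2 : measurable_fun D (fun s => (pkernel (r m) t s * `|g s - g t|)%:E).
  apply/measurable_EFinP; apply: measurable_funM => //.
  by apply: measurableT_comp => //; apply: measurable_funB => //; exact: measurable_cst.
have m3 : measurable_fun D (fun s => (pkernel (r m) t s * w t)%:E).
  by apply/measurable_EFinP; apply: measurable_funM => //; exact: measurable_cst.
have p0 s v : (0 <= v) -> (0%E <= (pkernel (r m) t s * v)%:E)%E.
  by move=> v0; rewrite lee_fin mulr_ge0// pkernel_ge0.
rewrite -ge0_integralD//; [|by move=> s _; exact: p0..].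
rewrite -ge0_integralD//; first last.
- by move=> s _; exact: p0.
- exact: emeasurable_funD.
- by move=> s _; apply: adde_ge0; exact: p0.
apply: ge0_le_integral => //.
- by apply: measurableT_comp => //; apply/measurable_EFinP; apply: measurable_funB; apply: measurable_funM => //; exact: measurable_cst.
- by apply: emeasurable_funD => //; exact: emeasurable_funD.
move=> s Ds /=; rewrite lee_fin -mulrBr normrM (ger0_norm (pkernel_ge0 _ _ (r01' m))) -!mulrDr.
rewrite ler_wpM2l ?pkernel_ge0// !wE//.
have -> : f s - f t = (f s - g s) + (g s - g t) - (f t - g t) by ring.
by apply: le_trans (ler_normB _ _) _; rewrite lerD2r ler_normD.
Qed.

Variables (sigma : R -> R) (S : nat -> R -> R) (S1 : R -> R).
Hypothesis sigma_lip : forall x y, `|sigma x - sigma y| <= `|x - y|.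
Hypothesis sigma_le1 : forall x, `|sigma x| <= 1.
Hypothesis mS : forall m, measurable_fun D (S m).
Hypothesis SE : forall m t, D t ->
  S m t = sigma (\int[mu]_(s in D) (pkernel (r m) t s * f s)).
Hypothesis S_cvg : forall t, D t -> S m t @[m --> \oo] --> S1 t.

Let mS1 : measurable_fun D S1.
Proof. exact: (measurable_fun_cvg mS). Qed.

Let dist_S_cvg : (\int[mu]_(t in D) (`|S1 t - S m t|)%:E)%E @[m --> \oo] --> 0%E.
Proof.
have S1_le1 t : D t -> `|S1 t| <= 1.
  move=> Dt; have h : `|S m t| @[m --> \oo] --> `|S1 t| by apply: cvg_norm; exact: S_cvg.
  rewrite -(cvg_lim _ h)//; apply: limr_le; first by apply/cvg_ex; exists `|S1 t|.
  by apply: nearW => m; rewrite SE.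
have [] := @dominated_convergence _ _ _ mu D _ (fun m t => (`|S1 t - S m t|)%:E) (cst 0%E)
    (cst 2%:E) _ _ _ _ _ => //.
- move=> m; apply/measurable_EFinP; apply: measurableT_comp => //.
  exact: (measurable_funB mS1 (mS m)).
- apply: aeW => t Dt; apply: cvg_EFin; first exact: nearW.
  have -> : fine \o (fun m => (`|S1 t - S m t|)%:E) = (fun m => `|S1 t - S m t|) by [].
  rewrite -(normr0 R) -(subrr (S1 t)); apply: cvg_norm.
  by apply: cvgB; [exact: cvg_cst|exact: S_cvg].
- exact: integrable_itv_cst.
- apply: aeW => t m Dt; rewrite gee0_abs ?lee_fin//.
  by rewrite (le_trans (ler_normB _ _))// -[leRHS]/(1 + 1) lerD ?S1_le1// SE.
by move=> _ _; rewrite integral_cst// mul0e.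
Qed.

(** Of the two copies of the L^1 distance between [f] and [g], one comes from the Poisson integral
    of |f - g|, which has the same mass, and one from returning from [g] to [f]. The oscillation of
    [g] and the distance from [S m] to [S1] vanish in the limit, the latter because [sigma] is
    bounded. *)
Lemma poisson_limit_dist (msigma : measurable_fun D (sigma \o f)) :
  (\int[mu]_(t in D) (`|S1 t - sigma (f t)|)%:E <=
   \int[mu]_(s in D) `|(f s - g s)%:E| + \int[mu]_(s in D) `|(f s - g s)%:E|)%E.
Proof.
have wE' : (\int[mu]_(s in D) `|(f s - g s)%:E| = \int[mu]_(s in D) (w s)%:E)%E.
  by apply: eq_integral => s; rewrite inE => Ds; rewrite wE.
rewrite !wE'; set W := (X in (_ <= X + X)%E).
have W0 : (0 <= W)%E by apply: integral_ge0 => s _; rewrite lee_fin.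
have [->|Wfin] := eqVneq W +oo%E; first by rewrite addye// ?leey// -ltNye (lt_le_trans _ W0).
pose u m := (\int[mu]_(t in D) (`|S1 t - S m t|)%:E + (W + \int[mu]_(t in D) osc m t + W))%E.
have Wf : W \is a fin_num by rewrite ge0_fin_numE// ltey.
have u_cvg : u @ \oo --> (W + W)%E.
  rewrite -[X in _ --> X]add0e; apply: cvgeD; [by []|exact: dist_S_cvg|].
  apply: cvgeD; first by rewrite fin_num_adde_defl.
    rewrite -[X in _ --> X]adde0.
    by apply: cvgeD; [rewrite fin_num_adde_defl|exact: cvg_cst|exact: integral_osc_cvg].
  exact: cvg_cst.
apply: (cvge_ge _ u_cvg); apply: nearW => m; rewrite /u /W.
have mk2 : measurable_fun setT (fun z : R * R => pkernel (r m) z.1 z.2 * w z.2).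
  by apply: measurable_funM; [exact: measurable_pkernel2|exact: measurableT_comp].
have k0 z : 0 <= pkernel (r m) z.1 z.2 * w z.2 by rewrite mulr_ge0// pkernel_ge0.
have mPhi := measurable_section_integral mk2 k0.
have Phi0 t : (0 <= \int[mu]_(s in D) (pkernel (r m) t s * w s)%:E)%E.
  by apply: integral_ge0 => s _; rewrite lee_fin; exact: (k0 (t, s)).
have mosc := measurable_osc m.
have osc0 t : (0 <= osc m t)%E.
  by apply: integral_ge0 => s _; rewrite lee_fin; exact: (osc_ge0 m (t, s)).
have mwD : measurable_fun D (fun s => (w s)%:E) by apply/measurable_EFinP; exact: measurable_funTS.
have mA : measurable_fun D (fun t => (`|S1 t - S m t|)%:E).
  by apply/measurable_EFinP; apply: measurableT_comp => //; exact: measurable_funB.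
rewrite -{1}(integral_pkernel_conv (r01' m) mw w_ge0) -ge0_integralD//=.
rewrite -ge0_integralD//=; first last.
- by move=> t _; rewrite lee_fin.
- exact: emeasurable_funD.
- by move=> t _; exact: adde_ge0.
rewrite -ge0_integralD//=; first last.
- by apply: emeasurable_funD; first exact: emeasurable_funD.
- by move=> t _; apply: adde_ge0; [exact: adde_ge0|rewrite lee_fin].
apply: ge0_le_integral => //.
- by apply/measurable_EFinP; apply: measurableT_comp => //; exact: measurable_funB.
- by apply: emeasurable_funD => //; apply: emeasurable_funD => //; exact: emeasurable_funD.
move=> t Dt /=; apply: (@le_trans _ _ ((`|S1 t - S m t|)%:E + (`|S m t - sigma (f t)|)%:E)%E).
  by rewrite -EFinD lee_fin -[S1 t - _](subrKA (S m t)) ler_normD.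
apply: leeD => //; apply: le_trans (conv_dist_le m Dt).
by rewrite lee_fin SE.
Qed.

End continuous_function.

(** The pointwise limit [S1] is given and has only to be identified, so L^1 estimates suffice and no
    maximal function is involved: take [g] continuous and close to [f] in L^1. *)
Lemma poisson_limit_ae (f sigma : R -> R) (S : nat -> R -> R) (S1 : R -> R) :
  mu.-integrable D (EFin \o f) -> measurable_fun D (sigma \o f) ->
  (forall x y, `|sigma x - sigma y| <= `|x - y|) -> (forall x, `|sigma x| <= 1) ->
  (forall m, measurable_fun D (S m)) ->
  (forall m t, D t -> S m t = sigma (\int[mu]_(s in D) (pkernel (r m) t s * f s))) ->
  (forall t, D t -> S m t @[m --> \oo] --> S1 t) ->
  {ae mu, forall t, D t -> S1 t = sigma (f t)}.
Proof.
move=> intf msf lip le1 mS SE S_cvg.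
have mS1 : measurable_fun D S1 by exact: (measurable_fun_cvg mS).
have mD : measurable D by [].
have Dfin : (mu D < +oo)%E by rewrite /= lebesgue_measure_itv/=; case: ifP => // _; rewrite ltry.
have [g_ [cg_ _ g_cvg]] := approximation_continuous_integrable mD Dfin intf.
have I0 : (\int[mu]_(t in D) (`|S1 t - sigma (f t)|)%:E <= 0)%E.
  have h : (\int[mu]_(s in D) `|(f s - g_ n s)%:E| + \int[mu]_(s in D) `|(f s - g_ n s)%:E|)%E
      @[n --> \oo] --> 0%E.
    by rewrite -[X in _ --> X]add0e; apply: cvgeD.
  apply: (cvge_ge _ h); apply: nearW => n.
  exact: (poisson_limit_dist (cg_ n) intf lip le1 mS SE S_cvg).
have mdiff : measurable_fun D (EFin \o (S1 \- (sigma \o f))).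
  by apply/measurable_EFinP; exact: measurable_funB.
have := (ae_eq_integral_abs mu mD mdiff).1; case.
  apply/eqP; rewrite eq_le; apply/andP; split; first exact: I0.
  by apply: integral_ge0.
move=> N [mN N0 NS]; exists N; split => //; apply: subset_trans NS => t /= nt h.
apply: nt => Dt; apply/eqP; rewrite -subr_eq0; apply/eqP.
by have /= [] := h Dt.
Qed.

End approximate_identity.

End Poisson_kernel.

(** * Boundary values and the spectral density *)

Section trigonometric_polynomials.
Context {R : realType}.
Local Notation mu := (@lebesgue_measure R).
Local Notation D := (`[- pi, pi]%classic : set R).
Implicit Types u v : nat -> R.

Definition tcos u (K : nat) (t : R) : R := \sum_(0 <= n < K) u n * cos (n%:R * t).
Definition tsin u (K : nat) (t : R) : R := \sum_(0 <= n < K) u n * sin (n%:R * t).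

Lemma continuous_sum_nat (F : nat -> R -> R) K :
  (forall n, continuous (F n)) -> continuous (fun t => \sum_(0 <= n < K) F n t).
Proof.
move=> cF t; elim: K => [|K ih].
  by under eq_fun do rewrite big_geq//; exact: cvg_cst.
have -> : (fun t => \sum_(0 <= n < K.+1) F n t) = (fun t => \sum_(0 <= n < K) F n t + F K t).
  by apply/funext => s; rewrite big_nat_recr.
by apply: cvgD => //; exact: cF.
Qed.

Lemma continuous_sin_linear (k : R) : continuous (fun s => sin (k * s)).
Proof.
move=> x; apply: continuous_comp; last exact: continuous_sin.
by apply: cvgM; [exact: cvg_cst|exact: cvg_id].
Qed.

Lemma continuous_cos_linear (k : R) : continuous (fun s => cos (k * s)).
Proof.
move=> x; apply: continuous_comp; last exact: continuous_cos.
by apply: cvgM; [exact: cvg_cst|exact: cvg_id].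
Qed.

Lemma continuous_tcos u K : continuous (tcos u K).
Proof.
apply: continuous_sum_nat => n t; apply: cvgM; first exact: cvg_cst.
exact: continuous_cos_linear.
Qed.

Lemma continuous_tsin u K : continuous (tsin u K).
Proof.
apply: continuous_sum_nat => n t; apply: cvgM; first exact: cvg_cst.
exact: continuous_sin_linear.
Qed.

Lemma Rintegral_sum_nat (F : nat -> R -> R) K : (forall n, continuous (F n)) ->
  \int[mu]_(t in D) (\sum_(0 <= n < K) F n t) = \sum_(0 <= n < K) \int[mu]_(t in D) F n t.
Proof.
move=> cF; elim: K => [|K ih].
  by under eq_Rintegral do rewrite big_geq//; rewrite Rintegral_pi_cst mul0r big_geq.
under eq_Rintegral do rewrite big_nat_recr//=.
rewrite RintegralD//; first by rewrite ih big_nat_recr.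
  by apply: continuous_integrable_pi; exact: continuous_sum_nat.
exact: continuous_integrable_pi.
Qed.

Lemma integral_cosB (n m : nat) :
  \int[mu]_(t in D) cos (n%:R * t - m%:R * t) = (n == m)%:R * (2 * pi).
Proof.
wlog mn : n m / (m <= n)%N => [H|].
  have [/H//|/ltnW nm] := leqP m n.
  under eq_Rintegral => t _ do rewrite -cosN opprB.
  by rewrite H// eq_sym.
have := integral_cos (n - m) (0 : R); rewrite cos0 mulr1.
under eq_Rintegral => t _ do rewrite addr0 natrB// mulrBl.
by move=> ->; rewrite subn_eq0 eqn_leq mn andbT; case: leqP; rewrite ?mul1r ?mul0r.
Qed.

(** The integrand is the real part of one analytic polynomial times the conjugate of the other, so
    only the functions cos ((n - m) t) occur. *)
Lemma trig_orthogonality u v K K' : (K <= K')%N ->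
  \int[mu]_(t in D) (tcos u K t * tcos v K' t + tsin u K t * tsin v K' t) =
  2 * pi * \sum_(0 <= n < K) u n * v n.
Proof.
move=> KK'.
have cosB_cont n m : continuous (fun t : R => cos (n%:R * t - m%:R * t)).
  move=> t; apply: continuous_comp; last exact: continuous_cos.
  by apply: cvgB; apply: cvgM; solve [exact: cvg_cst|exact: cvg_id].
have cc (x : R) n m : continuous (fun t : R => x * cos (n%:R * t - m%:R * t)).
  by move=> t; apply: cvgM; [exact: cvg_cst|exact: cosB_cont].
transitivity (\int[mu]_(t in D) \sum_(0 <= n < K) \sum_(0 <= m < K')
    u n * v m * cos (n%:R * t - m%:R * t)).
  apply: eq_Rintegral => t _; rewrite /tcos /tsin !mulr_suml -big_split/=.
  apply: eq_bigr => n _; rewrite !mulr_sumr -big_split/=.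
  by apply: eq_bigr => m _; rewrite cosB; ring.
rewrite Rintegral_sum_nat; last by move=> n; apply: continuous_sum_nat => m; exact: cc.
rewrite mulr_sumr; apply: eq_big_nat => n /andP[_ nK].
rewrite Rintegral_sum_nat; last by move=> m; exact: cc.
rewrite (big_cat_nat (leq0n n) (leq_trans (ltnW nK) KK'))/= big_nat big1 ?add0r.
  rewrite (big_ltn (leq_trans nK KK')) big_nat big1 ?addr0.
    rewrite RintegralZl//; last first.
      exact: continuous_integrable_pi.
    by rewrite integral_cosB eqxx mul1r mulrC.
  move=> m /andP[nm _]; rewrite RintegralZl//; last first.
    exact: continuous_integrable_pi.
  by rewrite integral_cosB (ltn_eqF nm) mul0r mulr0.
move=> m /andP[_ mn]; rewrite RintegralZl//; last first.
  exact: continuous_integrable_pi.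
by rewrite integral_cosB (gtn_eqF mn) mul0r mulr0.
Qed.

Lemma tcos_shift u K k t : tcos (shift_seq u k) (K + k) t =
  cos (k%:R * t) * tcos u K t - sin (k%:R * t) * tsin u K t.
Proof.
rewrite /tcos (big_cat_nat (leq0n k) (leq_addl K k))/= big_nat big1 ?add0r; last first.
  by move=> i /andP[_ ik]; rewrite /shift_seq leqNgt ik mul0r.
rewrite sum_nat_shift /tsin !mulr_sumr -sumrB; apply: eq_bigr => n _.
by rewrite shift_seq_addn natrD mulrDl cosD; ring.
Qed.

Lemma tsin_shift u K k t : tsin (shift_seq u k) (K + k) t =
  sin (k%:R * t) * tcos u K t + cos (k%:R * t) * tsin u K t.
Proof.
rewrite /tsin (big_cat_nat (leq0n k) (leq_addl K k))/= big_nat big1 ?add0r; last first.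
  by move=> i /andP[_ ik]; rewrite /shift_seq leqNgt ik mul0r.
rewrite sum_nat_shift /tcos !mulr_sumr -big_split/=; apply: eq_bigr => n _.
by rewrite shift_seq_addn natrD mulrDl sinD; ring.
Qed.

(* [cos (k t) |H|^2] is the real part of [H] times the conjugate of [e^{ikt} H]. *)
Lemma integral_cos_nsq u K k :
  \int[mu]_(t in D) (cos (k%:R * t) * (tcos u K t ^+ 2 + tsin u K t ^+ 2)) =
  2 * pi * \sum_(0 <= n < K) u n * shift_seq u k n.
Proof.
rewrite -(@trig_orthogonality u _ K (K + k)) ?leq_addr//.
apply: eq_Rintegral => t _; rewrite tcos_shift tsin_shift.
by ring.
Qed.

Lemma integral_nsq u K :
  \int[mu]_(t in D) (tcos u K t ^+ 2 + tsin u K t ^+ 2) =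
  2 * pi * \sum_(0 <= n < K) u n ^+ 2.
Proof. exact: (@trig_orthogonality u u K K). Qed.

End trigonometric_polynomials.

(** * Dominated convergence for series and Fatou's lemma *)

Section dominated_series.
Context {R : realType}.

Lemma tsum_dominated (F : nat -> nat -> R) (f g : nat -> R) :
  abs_summable g -> (forall m n, `|F m n| <= g n) ->
  (forall n, F m n @[m --> \oo] --> f n) ->
  tsum (F m) @[m --> \oo] --> tsum f.
Proof.
move=> sg Fg Ff.
have fg n : `|f n| <= g n.
  have h : `|F m n| @[m --> \oo] --> `|f n| by apply: cvg_norm; exact: Ff.
  rewrite -(cvg_lim _ h)//; apply: limr_le; first by apply/cvg_ex; exists `|f n|.
  by apply: nearW.
have sF m : abs_summable (F m) by exact: asum_le (Fg m) sg.
have sf : abs_summable f by exact: asum_le fg sg.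
have tail (h : nat -> R) N : (forall n, `|h n| <= g n) -> abs_summable h ->
    `|tsum (fun n => h (n + N)%N)| <= tsum (fun n => g (n + N)%N).
  move=> hg sh; apply: le_trans (ler_norm_tsum (asum_shift N sh)) _.
  apply: le_tsum => [n| |]; [exact: hg|exact/asum_norm/asum_shift|exact: asum_shift].
apply/cvgrPdist_le => e e0.
have /cvgrPdist_le/(_ (e / 3)) := tsum_tail_cvg sg; rewrite divr_gt0// => /(_ isT)[N _ HN].
have /= {}HN := HN N (leqnn N).
have {}HN : tsum (fun n => g (n + N)%N) <= e / 3.
  by apply: le_trans HN; rewrite sub0r normrN ler_norm.
have : \sum_(0 <= i < N) F m i @[m --> \oo] --> \sum_(0 <= i < N) f i.
  by apply: (@cvg_sum_seq _ _ (fun i m => F m i)) => i _; exact: Ff.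
move=> /cvgrPdist_le/(_ (e / 3)); rewrite divr_gt0// => /(_ isT); apply: filterS => m hm.
rewrite (tsum_split N sf) (tsum_split N (sF m)).
have h1 := tail _ N fg sf; have h2 := tail _ N (Fg m) (sF m).
move: h1 h2 hm HN; move: (tsum (fun n => f (n + N)%N)) (tsum (fun n => F m (n + N)%N)) => x y.
move: (\sum_(_ <= _ < _) _) (\sum_(_ <= _ < _) _) => u v.
rewrite !ler_norml; move: (tsum _) => G.
by move=> /andP[? ?] /andP[? ?] /andP[? ?] ?; apply/andP; split; lra.
Qed.

End dominated_series.

Section Fatou.
Context {R : realType} d (T : measurableType d) (mu : {measure set T -> \bar R}).

Lemma Fatou_ae (D : set T) (h : nat -> T -> R) (g : T -> R) (B : nat -> R) (l : R) :
  measurable D -> (forall m, measurable_fun D (h m)) -> measurable_fun D g ->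
  (forall m t, 0 <= h m t) -> (forall t, 0 <= g t) ->
  {ae mu, forall t, D t -> h m t @[m --> \oo] --> g t} ->
  (forall m, (\int[mu]_(t in D) (h m t)%:E <= (B m)%:E)%E) ->
  B @ \oo --> l ->
  (\int[mu]_(t in D) (g t)%:E <= l%:E)%E.
Proof.
move=> mD mh mg h0 g0 hg hB Bl.
have mhE m : measurable_fun D (fun t => (h m t)%:E) by exact/measurable_EFinP.
(* The lower limit exists at every point and agrees with [g] wherever [h] converges, that is, almost
   everywhere. *)
pose G t : \bar R := limn_einf (fun m => (h m t)%:E).
have mG : measurable_fun D G.
  have mN : measurable_fun D (fun t => limn_esup (fun m => (- (h m t)%:E)%E)).
    by apply: measurable_fun_limn_esup => m; exact: measurableT_comp.
  exact: measurableT_comp mN.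
have hgE t : h m t @[m --> \oo] --> g t -> G t = (g t)%:E.
  move=> c; have cE : (h m t)%:E @[m --> \oo] --> (g t)%:E by apply: cvg_EFin => //; exact: nearW.
  by rewrite /G (cvg_limn_einf_sup cE).1.
have G0 t : (0 <= G t)%E.
  rewrite /G limn_einf_lim; apply: lime_ge; first exact: is_cvg_einfs.
  by apply: nearW => m; apply: le_ereal_inf_tmp => _ [p /= _ <-]; rewrite lee_fin.
rewrite (@ge0_ae_eq_integral _ _ _ mu D (fun t => (g t)%:E) G) //; first last.
- by apply: filterS hg => t ht Dt; rewrite hgE//; exact: ht.
- by move=> t _; rewrite lee_fin.
- exact/measurable_EFinP.
have mE m : measurable_fun D (EFin \o h m) by exact: mhE.
apply: (le_trans (fatou mu mD mE _)); first by move=> m t _; rewrite lee_fin.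
have BlE : (B m)%:E @[m --> \oo] --> l%:E by apply: cvg_EFin => //; exact: nearW.
rewrite limn_einf_lim -(cvg_lim _ BlE)//; apply: lee_lim.
- exact: is_cvg_einfs.
- by apply/cvg_ex; exists l%:E.
- apply: nearW => m; apply: le_trans (hB m).
  by apply: ereal_inf_lbound; exists m => /=.
Qed.

End Fatou.

(** * The spectral density as the squared modulus of the MA series *)

Section Szego_density.
Context {R : realType}.
Local Notation mu := (@lebesgue_measure R).
Local Notation D := (`[- pi, pi]%classic : set R).

Let pi2_gt0 : 0 < 2 * pi :> R. Proof. by rewrite mulr_gt0// pi_gt0. Qed.

Lemma tcos_cvg (u : nat -> R) (r t : R) : abs_summable (fun n => u n * r ^+ n) ->
  tcos (fun n => u n * r ^+ n) K t @[K --> \oo] --> cos_sum u r t.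
Proof.
move=> su; have sf : abs_summable (fun n => u n * (r ^+ n * cos (n%:R * t))).
  apply: asum_le (asum_norm su) => n; rewrite mulrA normrM ler_piMr//.
  exact: cos_max.
apply: cvg_trans (tsum_cvg sf); apply: near_eq_cvg; apply: nearW => K.
by rewrite /series/= /tcos; apply: eq_bigr => n _; rewrite mulrA.
Qed.

Lemma tsin_cvg (u : nat -> R) (r t : R) : abs_summable (fun n => u n * r ^+ n) ->
  tsin (fun n => u n * r ^+ n) K t @[K --> \oo] --> sin_sum u r t.
Proof.
move=> su; have sf : abs_summable (fun n => u n * (r ^+ n * sin (n%:R * t))).
  apply: asum_le (asum_norm su) => n; rewrite mulrA normrM ler_piMr//.
  exact: sin_max.
apply: cvg_trans (tsum_cvg sf); apply: near_eq_cvg; apply: nearW => K.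
by rewrite /series/= /tsin; apply: eq_bigr => n _; rewrite mulrA.
Qed.

Lemma measurable_cos_sum (u : nat -> R) (r : R) : abs_summable (fun n => u n * r ^+ n) ->
  measurable_fun D (cos_sum u r).
Proof.
move=> su; apply: (@measurable_fun_cvg _ _ _ D (tcos (fun n => u n * r ^+ n))).
  by move=> K; apply: measurable_funTS; apply: continuous_measurable_fun; exact: continuous_tcos.
by move=> t _; exact: tcos_cvg.
Qed.

Lemma measurable_sin_sum (u : nat -> R) (r : R) : abs_summable (fun n => u n * r ^+ n) ->
  measurable_fun D (sin_sum u r).
Proof.
move=> su; apply: (@measurable_fun_cvg _ _ _ D (tsin (fun n => u n * r ^+ n))).
  by move=> K; apply: measurable_funTS; apply: continuous_measurable_fun; exact: continuous_tsin.
by move=> t _; exact: tsin_cvg.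
Qed.

(* Unlike [expR], it is bounded and Lipschitz, so it preserves the L^1 convergence
   of the Poisson integrals of [ln Delta]; its values on them follow from [AR_nsq]. *)
Definition logistic (x : R) : R := (1 + expR x)^-1.

Lemma logistic_le1 x : `|logistic x| <= 1.
Proof.
have e0 := expR_gt0 x; rewrite /logistic ger0_norm ?invr_ge0 ?addr_ge0 ?(ltW e0)//.
by rewrite invf_le1 ?lerDl ?(ltW e0)// addr_gt0.
Qed.

Lemma logistic_Lipschitz x y : `|logistic x - logistic y| <= `|x - y|.
Proof.
wlog xy : x y / x <= y => [H|].
  have [/H//|/ltW/H] := leP x y.
  by rewrite distrC => h; rewrite distrC in h; rewrite distrC [leRHS]distrC.
rewrite [leRHS]distrC [leRHS]ger0_norm ?subr_ge0//.
have x0 := expR_gt0 x; have y0 := expR_gt0 y.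
have exy : expR x <= expR y by rewrite ler_expR.
have h : expR y - expR x <= (y - x) * expR y.
  have -> : expR x = expR (x - y) * expR y by rewrite -expRD subrK.
  rewrite -{1}[expR y]mul1r -mulrBl ler_wpM2r ?(ltW y0)//.
  by have := expR_ge1Dx (x - y); lra.
rewrite /logistic; have -> : (1 + expR x)^-1 - (1 + expR y)^-1 =
    (expR y - expR x) / ((1 + expR x) * (1 + expR y)).
  by field; rewrite !gt_eqF// addr_gt0.
rewrite ger0_norm; last by rewrite divr_ge0 ?subr_ge0// mulr_ge0 ?addr_ge0 ?(ltW x0) ?(ltW y0).
rewrite ler_pdivrMr ?mulr_gt0 ?addr_gt0//; apply: (le_trans h).
rewrite ler_wpM2l ?subr_ge0//.
rewrite mulrDl mul1r mulrDr mulr1 -addrA addrCA lerDl.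
by rewrite !addr_ge0 ?mulr_ge0 ?(ltW x0) ?(ltW y0).
Qed.

Lemma continuous_logistic : continuous logistic.
Proof.
move=> x; apply: cvgV; first by rewrite gt_eqF// addr_gt0// expR_gt0.
by apply: cvgD; [exact: cvg_cst|exact: continuous_expR].
Qed.

(** The factor 1 / 2 keeps the first radius positive, as the bound of [poisson_le] requires. *)
Definition abel_radius (m : nat) : R := 1 - harmonic m / 2.

Lemma abel_radius01 m : 0 < abel_radius m < 1.
Proof.
have h0 : 0 < m.+1%:R^-1 :> R by rewrite invr_gt0 ltr0n.
have h1 : m.+1%:R^-1 <= 1 :> R by rewrite invf_le1 ?ltr0n// ler1n.
rewrite /abel_radius /harmonic/=; move: h0 h1; move: (m.+1%:R^-1) => h h0 h1.
by apply/andP; split; lra.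
Qed.

Lemma abel_radius_cvg : abel_radius @ \oo --> (1 : R).
Proof.
rewrite -[X in _ --> X](subr0 1); apply: cvgB; first exact: cvg_cst.
by rewrite -[X in _ --> X](mul0r (2^-1 : R)); apply: cvgM; [exact: cvg_harmonic|exact: cvg_cst].
Qed.

Let r := abel_radius.

Let r01 m : 0 <= r m < 1.
Proof. by have /andP[/ltW-> ->] := abel_radius01 m. Qed.

Lemma abel_cos_sum (u : nat -> R) t : abs_summable u ->
  cos_sum u (r m) t @[m --> \oo] --> cos_sum u 1 t.
Proof.
move=> su; apply: (tsum_dominated (asum_norm su)) => [m n|n].
  have /andP[r0 r1] := r01 m.
  rewrite normrM ler_piMr// normrM mulr_ile1 ?cos_max//.
  by rewrite ger0_norm ?exprn_ge0// exprn_ile1// ltW.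
apply: cvgM; first exact: cvg_cst.
apply: cvgM; last exact: cvg_cst.
exact: (cvg_comp _ _ abel_radius_cvg (@exprn_continuous R n 1)).
Qed.

Lemma abel_sin_sum (u : nat -> R) t : abs_summable u ->
  sin_sum u (r m) t @[m --> \oo] --> sin_sum u 1 t.
Proof.
move=> su; apply: (tsum_dominated (asum_norm su)) => [m n|n].
  have /andP[r0 r1] := r01 m.
  rewrite normrM ler_piMr// normrM mulr_ile1 ?sin_max//.
  by rewrite ger0_norm ?exprn_ge0// exprn_ile1// ltW.
apply: cvgM; first exact: cvg_cst.
apply: cvgM; last exact: cvg_cst.
exact: (cvg_comp _ _ abel_radius_cvg (@exprn_continuous R n 1)).
Qed.

Variables (Delta : R -> R) (c a : nat -> R).
Hypothesis hc : MA_coefficients Delta c.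
Hypothesis ha : AR_coefficients Delta a.
Hypothesis sa : abs_summable a.
Hypothesis sc : sqsummable c.
Hypothesis Delta_int : mu.-integrable D (EFin \o Delta).
Hypothesis hlog : positive_log_integrable Delta.

Let N2 (r t : R) : R := cos_sum a r t ^+ 2 + sin_sum a r t ^+ 2.

Let N2_ge0 x t : 0 <= N2 x t. Proof. by rewrite addr_ge0// sqr_ge0. Qed.

Let N2_cvg t : N2 (r m) t @[m --> \oo] --> N2 1 t.
Proof.
have hC := @abel_cos_sum a t sa; have hS := @abel_sin_sum a t sa.
exact: (cvgD (cvgM hC hC) (cvgM hS hS)).
Qed.

Let sar m : abs_summable (fun n => a n * r m ^+ n).
Proof.
apply: asum_le (asum_norm sa) => n; have /andP[r0 r1] := r01 m.
rewrite normrM ler_piMr//.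
by rewrite ger0_norm ?exprn_ge0// exprn_ile1// ltW.
Qed.

Let mlnD : measurable_fun D (fun t => ln (Delta t)).
Proof. by case/integrableP : hlog.2 => /measurable_EFinP. Qed.

(** By [AR_nsq], 2 pi N2 is the reciprocal of the exponential of the Poisson integral, so this is
    [logistic] at that integral. In this form the limit r -> 1 exists at every point, even where N2
    vanishes. *)
Let S (m : nat) t := 1 - (1 + 2 * pi * N2 (r m) t)^-1.

Let den_gt0 x t : 0 < 1 + 2 * pi * N2 x t.
Proof. by rewrite ltr_wpDr// mulr_ge0// ltW. Qed.

Let inv_cvg (u : nat -> R) (l : R) : 0 <= l -> u @ \oo --> l ->
  (1 - (1 + 2 * pi * u m)^-1) @[m --> \oo] --> 1 - (1 + 2 * pi * l)^-1.
Proof.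
move=> l0 ul; apply: cvgB; first exact: cvg_cst.
apply: cvgV; first by rewrite gt_eqF// ltr_wpDr// mulr_ge0// ltW.
by apply: cvgD; [exact: cvg_cst|apply: cvgM => //; exact: cvg_cst].
Qed.

Let mS m : measurable_fun D (S m).
Proof.
pose u K t := tcos (fun n => a n * r m ^+ n) K t ^+ 2 + tsin (fun n => a n * r m ^+ n) K t ^+ 2.
have u0 K t : 0 <= u K t by rewrite addr_ge0 ?sqr_ge0.
apply: (@measurable_fun_cvg _ _ _ D (fun K t => 1 - (1 + 2 * pi * u K t)^-1)).
  move=> K; apply: measurable_funTS; apply: continuous_measurable_fun => t.
  apply: cvgB; first exact: cvg_cst.
  apply: cvgV; first by rewrite gt_eqF// ltr_wpDr// mulr_ge0// ltW.
  apply: cvgD; first exact: cvg_cst.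
  apply: cvgM; first exact: cvg_cst.
  have hC := @continuous_tcos R (fun n => a n * r m ^+ n) K t.
  have hS := @continuous_tsin R (fun n => a n * r m ^+ n) K t.
  exact: (cvgD (cvgM hC hC) (cvgM hS hS)).
move=> t _; apply: inv_cvg => //.
have hC := @tcos_cvg a (r m) t (sar m); have hS := @tsin_cvg a (r m) t (sar m).
exact: (cvgD (cvgM hC hC) (cvgM hS hS)).
Qed.

Let pk_log (m : nat) t : \int[mu]_(s in D) (pkernel (r m) t s * ln (Delta s)) =
  (2 * pi)^-1 * log_poisson Delta (r m) t.
Proof.
rewrite /log_poisson -RintegralZl//.
  by apply: eq_Rintegral => s _; rewrite /pkernel mulrA.
pose B := ((1 - r m ^+ 2) / (1 - r m) ^+ 2).
have mk : measurable_fun D (fun s => poisson (r m) (s - t)).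
  apply: measurable_funTS; apply: continuous_measurable_fun.
  exact: (continuous_shift_fun (continuous_poisson (r01 m))).
apply: (@le_integrable _ _ _ mu D _ _ (fun s => B%:E * (ln (Delta s))%:E)%E) => //.
- by apply/measurable_EFinP; exact: measurable_funM.
- move=> s _ /=; rewrite lee_fin normrM [leRHS]normrM ler_wpM2r//.
  rewrite ger0_norm ?poisson_ge0//; apply: (@le_trans _ _ B); last exact: ler_norm.
  exact: poisson_le_max.
- exact: (integrableZl _ _ hlog.2).
Qed.

Lemma AR_nsq_density : {ae mu, forall t, D t ->
  2 * pi * (cos_sum a 1 t ^+ 2 + sin_sum a 1 t ^+ 2) * Delta t = 1}.
Proof.
have mlog : measurable_fun D (logistic \o (fun t => ln (Delta t))).
  apply: measurableT_comp => //; apply: continuous_measurable_fun.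
  exact: continuous_logistic.
have SE m t : D t -> S m t = logistic (\int[mu]_(s in D) (pkernel (r m) t s * ln (Delta s))).
  move=> _; rewrite pk_log /S /logistic.
  have := AR_nsq ha t (r01 m); rewrite -/(N2 (r m) t).
  have := expR_gt0 ((2 * pi)^-1 * log_poisson Delta (r m) t).
  have := den_gt0 (r m) t; move: (N2 (r m) t) (expR _) => N e N0 e0 Ne.
  have e1 : 1 + e != 0 by rewrite gt_eqF// addr_gt0.
  have N1 : 1 + 2 * pi * N != 0 by rewrite gt_eqF.
  move: Ne N1; move: (2 * pi * N) => y ye y1.
  apply: (mulIf y1); rewrite mulrBl mulVf// mul1r.
  apply: (mulIf e1); rewrite mulrAC mulVf// mul1r.
  have -> : (1 + y - 1) * (1 + e) = y + y * e by ring.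
  by rewrite ye addrC.
have S_cvg t : D t -> S m t @[m --> \oo] --> 1 - (1 + 2 * pi * N2 1 t)^-1.
  by move=> _; apply: inv_cvg => //; exact: N2_cvg.
have := @poisson_limit_ae R r abel_radius01 abel_radius_cvg (fun t => ln (Delta t)) logistic S
  _ hlog.2 mlog logistic_Lipschitz logistic_le1 mS SE S_cvg.
move: hlog.1; apply: (@filterS2 _ _ (ae_filter_ringOfSetsType _)) => t Dpos h Dt.
have {}Dpos : 0 < Delta t by exact: Dpos.
have := h Dt; rewrite /logistic lnK ?posrE// -/(N2 1 t).
have := den_gt0 1 t; move: (N2 1 t) (Delta t) Dpos => N d d0 N0.
have e1 : 1 + d != 0 by rewrite gt_eqF// addr_gt0.
have N1 : 1 + 2 * pi * N != 0 by rewrite gt_eqF.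
move: N1; move: (2 * pi * N) => y y1 e.
have : (1 - (1 + y)^-1) * ((1 + y) * (1 + d)) = (1 + d)^-1 * ((1 + y) * (1 + d)) by rewrite e.
rewrite mulrBl mul1r mulrA mulVf// mul1r [in RHS]mulrC -mulrA divff// mulr1.
lra.
Qed.

(* [GR + i GI] is the boundary value of [h]: it is minus the inverse of the
   boundary value of the AR series, whose squared modulus is [(2 pi Delta)^-1]. *)
Let GR t : R := - cos_sum a 1 t * (2 * pi * Delta t).
Let GI t : R := sin_sum a 1 t * (2 * pi * Delta t).

Let mDelta : measurable_fun D Delta.
Proof. by case/integrableP : Delta_int => /measurable_EFinP. Qed.

Let sa1 : abs_summable (fun n => a n * 1 ^+ n).
Proof. by under eq_fun do rewrite expr1n mulr1. Qed.

Let mGR : measurable_fun D GR.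
Proof.
apply: measurable_funM; last exact: measurable_funM.
by apply: measurableT_comp => //; exact: measurable_cos_sum.
Qed.

Let mGI : measurable_fun D GI.
Proof.
apply: measurable_funM; last exact: measurable_funM.
exact: measurable_sin_sum.
Qed.

Let scr m : abs_summable (fun n => c n * r m ^+ n).
Proof. exact: asum_geometric_bounded (r01 m) (sqsum_bounded sc). Qed.

Let N2_neq0 t : 2 * pi * N2 1 t * Delta t = 1 -> N2 1 t != 0.
Proof. by apply: contra_eq_neq => ->; rewrite mulr0 mul0r eq_sym oner_eq0. Qed.

Let invN2 t : 2 * pi * N2 1 t * Delta t = 1 -> (N2 1 t)^-1 = 2 * pi * Delta t.
Proof.
move=> h; have n0 := N2_neq0 h.
by apply: (mulfI n0); rewrite mulfV// -[LHS]h; ring.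
Qed.

Let MA_boundary t : 2 * pi * N2 1 t * Delta t = 1 ->
  cos_sum c (r m) t @[m --> \oo] --> GR t /\ sin_sum c (r m) t @[m --> \oo] --> GI t.
Proof.
move=> h; have n0 := N2_neq0 h.
have hV : (N2 (r m) t)^-1 @[m --> \oo] --> 2 * pi * Delta t.
  by rewrite -(invN2 h); apply: cvgV => //; exact: N2_cvg.
have hC := @abel_cos_sum a t sa; have hS := @abel_sin_sum a t sa.
have e1 : (fun m => cos_sum c (r m) t) = (fun m => - cos_sum a (r m) t * (N2 (r m) t)^-1).
  by apply/funext => m; rewrite (MA_AR_polar hc ha t (r01 m)).1 mulNr.
have e2 : (fun m => sin_sum c (r m) t) = (fun m => sin_sum a (r m) t * (N2 (r m) t)^-1).
  by apply/funext => m; rewrite (MA_AR_polar hc ha t (r01 m)).2.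
rewrite e1 e2; split; last exact: (cvgM hS hV).
exact: (cvgM (cvgN hC) hV).
Qed.

Let nsq_G t : 2 * pi * N2 1 t * Delta t = 1 -> GR t ^+ 2 + GI t ^+ 2 = 2 * pi * Delta t.
Proof.
move=> h; rewrite /GR /GI.
have -> : (- cos_sum a 1 t * (2 * pi * Delta t)) ^+ 2 + (sin_sum a 1 t * (2 * pi * Delta t)) ^+ 2
  = (2 * pi * N2 1 t * Delta t) * (2 * pi * Delta t) by rewrite /N2; ring.
by rewrite h mul1r.
Qed.

Let mtcos u K : measurable_fun D (@tcos R u K).
Proof. by apply: measurable_funTS; apply: continuous_measurable_fun; exact: continuous_tcos. Qed.

Let mtsin u K : measurable_fun D (@tsin R u K).
Proof. by apply: measurable_funTS; apply: continuous_measurable_fun; exact: continuous_tsin. Qed.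

(** The squared distance of f + i g from the partial sum of c_n e^{int} over n < K. *)
Let dist2 (f g : R -> R) K t := (f t - tcos c K t) ^+ 2 + (g t - tsin c K t) ^+ 2.

Let mdist2 f g K : measurable_fun D f -> measurable_fun D g -> measurable_fun D (dist2 f g K).
Proof.
move=> mf mg; apply: measurable_funD; apply: measurable_funX; apply: measurable_funB => //.
Qed.

Let dist2_ge0 f g K t : 0 <= dist2 f g K t.
Proof. by rewrite addr_ge0 ?sqr_ge0. Qed.

Let dist2_cvg (f g : nat -> R -> R) (F G : R -> R) K t :
  f m t @[m --> \oo] --> F t -> g m t @[m --> \oo] --> G t ->
  dist2 (f m) (g m) K t @[m --> \oo] --> dist2 F G K t.
Proof.
move=> fF gG.
have hf : f m t - tcos c K t @[m --> \oo] --> F t - tcos c K t.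
  by apply: cvgB => //; exact: cvg_cst.
have hg : g m t - tsin c K t @[m --> \oo] --> G t - tsin c K t.
  by apply: cvgB => //; exact: cvg_cst.
exact: (cvgD (cvgM hf hf) (cvgM hg hg)).
Qed.

Let tail K := tsum (fun n => c (n + K)%N ^+ 2).

Let sc2 K : abs_summable (fun n => c (n + K)%N ^+ 2).
Proof. exact: sqsum_shift. Qed.

Let err K m := 2 * pi * (\sum_(0 <= n < K) (c n * r m ^+ n - c n) ^+ 2 + tail K).

Let Eintegral_nsq u K : (\int[mu]_(t in D) (tcos u K t ^+ 2 + tsin u K t ^+ 2)%:E =
  (2 * pi * \sum_(0 <= n < K) u n ^+ 2)%:E)%E.
Proof.
rewrite -integral_nsq /Rintegral fineK//; apply: integrable_fin_num => //.
apply: continuous_integrable_pi => t.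
have hC := @continuous_tcos R u K t; have hS := @continuous_tsin R u K t.
exact: (cvgD (cvgM hC hC) (cvgM hS hS)).
Qed.

(** For partial sums of length L + K this is Parseval's identity, the coefficients from K on being
    at most those of [c] since r <= 1. Fatou's lemma in L passes to the full series. *)
Let interior_dist K m :
  (\int[mu]_(t in D) (dist2 (cos_sum c (r m)) (sin_sum c (r m)) K t)%:E <= (err K m)%:E)%E.
Proof.
pose cr n := c n * r m ^+ n.
pose v n := cr n - (if (n < K)%N then c n else 0).
have hv (trig : R -> R) L t : \sum_(0 <= n < L + K) v n * trig (n%:R * t) =
    \sum_(0 <= n < L + K) cr n * trig (n%:R * t) - \sum_(0 <= n < K) c n * trig (n%:R * t).
  under eq_bigr do rewrite mulrBl.
  rewrite big_split/= sumrN; congr (_ - _).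
  rewrite (big_cat_nat (leq0n K) (leq_addl L K))/= [X in _ + X]big_nat [X in _ + X]big1 ?addr0.
    by apply: eq_big_nat => n /andP[_ ->].
  by move=> n /andP[Kn _]; rewrite ltnNge Kn mul0r.
apply: (@Fatou_ae _ _ _ mu D (fun L t => dist2 (tcos cr (L + K)) (tsin cr (L + K)) K t) _
  (fun=> err K m)) => //.
- by move=> L; exact: mdist2.
- by apply: mdist2; [exact: measurable_cos_sum|exact: measurable_sin_sum].
- apply: aeW => t _.
  apply: (@dist2_cvg (fun L => tcos cr (L + K)) (fun L => tsin cr (L + K))).
    by have := @tcos_cvg c (r m) t (scr m); rewrite -(cvg_shiftn K).
  by have := @tsin_cvg c (r m) t (scr m); rewrite -(cvg_shiftn K).
- move=> L; have -> : dist2 (tcos cr (L + K)) (tsin cr (L + K)) K =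
      (fun t => tcos v (L + K) t ^+ 2 + tsin v (L + K) t ^+ 2).
    by apply/funext => t; rewrite /tcos /tsin !hv.
  rewrite Eintegral_nsq lee_fin ler_wpM2l ?(ltW pi2_gt0)//.
  rewrite (big_cat_nat (leq0n K) (leq_addl L K))/=; apply: lerD.
    by rewrite le_eqVlt; apply/orP; left; apply/eqP; apply: eq_big_nat => n /andP[_ nK]; rewrite /v nK.
  rewrite sum_nat_shift; apply: (@le_trans _ _ (\sum_(0 <= i < L) c (i + K)%N ^+ 2)).
    apply: ler_sum => i _; rewrite /v ltnNge leq_addl subr0 /cr exprMn.
    have /andP[r0 r1] := r01 m.
    by rewrite ler_piMr ?sqr_ge0// -exprM exprn_ile1// ltW.
  by apply: psum_le_tsum => // n; exact: sqr_ge0.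
- exact: cvg_cst.
Qed.

(** Fatou's lemma again, now along the radii: the finite sum in [err K m] vanishes as r tends to 1,
    and the tail remains. *)
Let boundary_dist K : (\int[mu]_(t in D) (dist2 GR GI K t)%:E <= (2 * pi * tail K)%:E)%E.
Proof.
apply: (@Fatou_ae _ _ _ mu D (fun m t => dist2 (cos_sum c (r m)) (sin_sum c (r m)) K t) _ (err K))
  => //.
- by move=> m; apply: mdist2; [exact: measurable_cos_sum|exact: measurable_sin_sum].
- exact: mdist2.
- apply: (@filterS _ _ (ae_filter_ringOfSetsType _)) AR_nsq_density => t h Dt.
  have [hC hS] := MA_boundary (h Dt).
  exact: (@dist2_cvg (fun m => cos_sum c (r m)) (fun m => sin_sum c (r m))).
have -> : 2 * pi * tail K = 2 * pi * (\sum_(0 <= n < K) (0 : R) + tail K) by rewrite big1 ?add0r.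
apply: cvgM; first exact: cvg_cst.
apply: cvgD; last exact: cvg_cst.
apply: (@cvg_sum_seq _ _ (fun n m => (c n * r m ^+ n - c n) ^+ 2) (fun=> 0)) => n _.
have h : c n * r m ^+ n - c n @[m --> \oo] --> (0 : R).
  have -> : 0 = c n * 1 ^+ n - c n by rewrite expr1n mulr1 subrr.
  apply: cvgB; last exact: cvg_cst.
  apply: cvgM; first exact: cvg_cst.
  exact: (cvg_comp _ _ abel_radius_cvg (@exprn_continuous R n 1)).
by have h2 := cvgM h h; rewrite mulr0 in h2; exact: h2.
Qed.

(** With G the boundary value and C_K the partial sum, the difference of |G|^2 and |C_K|^2 is at
    most (1 + 1/e) |G - C_K|^2 + e |C_K|^2, by the weighted inequality 2 p q <= q^2 / e + e p^2. The
    free weight e allows K to tend to infinity first and e to 0 afterwards. *)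
Let cos_density_dist K k e : 0 < e ->
  `|2 * pi * \int[mu]_(t in D) (cos (k%:R * t) * Delta t) -
    2 * pi * \sum_(0 <= n < K) c n * shift_seq c k n| <=
  (1 + e^-1) * (2 * pi * tail K) + e * (2 * pi * sqnorm c).
Proof.
move=> e0.
pose V t := tcos c K t ^+ 2 + tsin c K t ^+ 2.
have V0 t : 0 <= V t by rewrite addr_ge0 ?sqr_ge0.
have cV : continuous V.
  move=> t; have hC := @continuous_tcos R c K t; have hS := @continuous_tsin R c K t.
  exact: (cvgD (cvgM hC hC) (cvgM hS hS)).
have mV : measurable_fun D V by apply: measurable_funTS; exact: continuous_measurable_fun.
have mcos : measurable_fun D (fun t : R => cos (k%:R * t)).
  by apply: measurable_funTS; apply: continuous_measurable_fun; exact: continuous_cos_linear.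
have i1 : mu.-integrable D (EFin \o (fun t => cos (k%:R * t) * Delta t)).
  apply: (@le_integrable _ _ _ mu D _ _ (EFin \o Delta)) => //.
  - by apply/measurable_EFinP; exact: measurable_funM.
  - by move=> t _ /=; rewrite lee_fin normrM ler_piMl// cos_max.
have i1' : mu.-integrable D (EFin \o (fun t => 2 * pi * (cos (k%:R * t) * Delta t))).
  exact: (integrableZl _ _ i1).
have i2 : mu.-integrable D (EFin \o (fun t => cos (k%:R * t) * V t)).
  by apply: continuous_integrable_pi => t; apply: cvgM; [exact: continuous_cos_linear|exact: cV].
rewrite -integral_cos_nsq -RintegralZl// -RintegralB//.
have iB : mu.-integrable D
    (EFin \o (fun t => 2 * pi * (cos (k%:R * t) * Delta t) - cos (k%:R * t) * V t)).
  exact: (integrableB _ i1' i2).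
rewrite -lee_fin EFin_normr_Rintegral//.
have mB : measurable_fun D (fun t => 2 * pi * (cos (k%:R * t) * Delta t) - cos (k%:R * t) * V t).
  by apply: measurable_funB; [apply: measurable_funM => //; exact: measurable_funM|exact: measurable_funM].
apply: (le_trans (le_abse_integral _ _ _)) => //; first exact/measurable_EFinP.
have e1 : 0 <= 1 + e^-1 by rewrite addr_ge0 ?invr_ge0 ?(ltW e0).
have mq := mdist2 K mGR mGI.
have m1 : measurable_fun D (fun t => ((1 + e^-1)%:E * (dist2 GR GI K t)%:E)%E).
  by apply: measurable_funeM; exact/measurable_EFinP.
have m2 : measurable_fun D (fun t => (e%:E * (V t)%:E)%E).
  by apply: measurable_funeM; exact/measurable_EFinP.
apply: (@le_trans _ _ (\int[mu]_(t in D) ((1 + e^-1)%:E * (dist2 GR GI K t)%:E + e%:E * (V t)%:E))%E).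
  apply: ae_ge0_le_integral => //.
  - by apply/measurable_EFinP; apply: measurableT_comp.
  - by move=> t _; rewrite -!EFinM -EFinD lee_fin addr_ge0 ?mulr_ge0// ltW.
  - exact: emeasurable_funD.
  apply: (@filterS _ _ (ae_filter_ringOfSetsType _)) AR_nsq_density => t h Dt.
  rewrite /= -!EFinM -EFinD lee_fin.
  have -> : 2 * pi * (cos (k%:R * t) * Delta t) - cos (k%:R * t) * V t =
      cos (k%:R * t) * (2 * pi * Delta t - V t) by ring.
  rewrite normrM; apply: (@le_trans _ _ `|2 * pi * Delta t - V t|).
    by rewrite ler_piMl// cos_max.
  rewrite -(nsq_G (h Dt)) /dist2 /V.
  move: (GR t) (GI t) (tcos c K t) (tsin c K t) => x y u v.
  have [x' ex] : exists x', x = u + x' by exists (x - u); ring.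
  have [y' ey] : exists y', y = v + y' by exists (y - v); ring.
  rewrite ex ey (addrAC u) (addrAC v) !subrr !add0r.
  have -> : (u + x') ^+ 2 + (v + y') ^+ 2 - (u ^+ 2 + v ^+ 2) =
      (x' ^+ 2 + y' ^+ 2) + 2 * (u * x' + v * y') by ring.
  have amgm (p q : R) : `|2 * (p * q)| <= e^-1 * q ^+ 2 + e * p ^+ 2.
    have h1 : 0 <= e^-1 * (q - e * p) ^+ 2 by rewrite mulr_ge0 ?invr_ge0 ?sqr_ge0 ?(ltW e0).
    have h2 : 0 <= e^-1 * (q + e * p) ^+ 2 by rewrite mulr_ge0 ?invr_ge0 ?sqr_ge0 ?(ltW e0).
    have e1' : e^-1 * (q - e * p) ^+ 2 = e^-1 * q ^+ 2 + e * p ^+ 2 - 2 * (p * q).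
      by field; exact: lt0r_neq0.
    have e2' : e^-1 * (q + e * p) ^+ 2 = e^-1 * q ^+ 2 + e * p ^+ 2 + 2 * (p * q).
      by field; exact: lt0r_neq0.
    by rewrite e1' in h1; rewrite e2' in h2; rewrite ler_norml; apply/andP; split; lra.
  apply: le_trans (ler_normD _ _) _.
  rewrite ger0_norm ?addr_ge0 ?sqr_ge0// [(1 + e^-1) * _]mulrDl mul1r -[leRHS]addrA lerD2l.
  rewrite mulrDr; apply: le_trans (ler_normD _ _) _.
  apply: le_trans (lerD (amgm u x') (amgm v y')) _.
  by rewrite !mulrDr addrACA.
rewrite ge0_integralD//; first last.
- by move=> t _; rewrite -EFinM lee_fin mulr_ge0// ltW.
- by move=> t _; rewrite -EFinM lee_fin mulr_ge0.
rewrite ge0_integralZl//; [|exact/measurable_EFinP|by move=> t _; rewrite lee_fin].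
rewrite ge0_integralZl//; [|exact/measurable_EFinP|by move=> t _; rewrite lee_fin|by rewrite lee_fin ltW].
rewrite [leRHS]EFinD; apply: leeD.
  by rewrite EFinM; apply: lee_wpmul2l; [rewrite lee_fin|exact: boundary_dist].
rewrite Eintegral_nsq -EFinM lee_fin ler_wpM2l ?(ltW e0)// ler_wpM2l ?(ltW pi2_gt0)//.
exact: psum_sqnorm.
Qed.

Lemma density_cos_coefficient k : \int[mu]_(t in D) (cos (k%:R * t) * Delta t) = gram c 0 k.
Proof.
apply: (mulfI (lt0r_neq0 pi2_gt0)); apply/eqP; rewrite -subr_eq0 -normr_le0.
set I := 2 * pi * (\int[mu]_(t in _) _).
have sg : abs_summable (fun n => c n * shift_seq c k n).
  by apply: asumM => //; exact: sqsum_shift_seq.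
have gE : gram c 0 k = tsum (fun n => c n * shift_seq c k n).
  by apply: eq_tsum => n; rewrite /shift_seq leq0n subn0.
have sn := sqnorm_ge0 sc.
have key e : 0 < e -> `|I - 2 * pi * gram c 0 k| <= e * (2 * pi * sqnorm c).
  move=> e0.
  have h1 : `|I - 2 * pi * \sum_(0 <= n < K) c n * shift_seq c k n| @[K --> \oo] -->
      `|I - 2 * pi * gram c 0 k|.
    apply: cvg_norm; apply: cvgB; first exact: cvg_cst.
    by rewrite gE; apply: cvgM; [exact: cvg_cst|exact: (tsum_cvg sg)].
  have h2 : (1 + e^-1) * (2 * pi * tail K) + e * (2 * pi * sqnorm c) @[K --> \oo] -->
      (1 + e^-1) * (2 * pi * 0) + e * (2 * pi * sqnorm c).
    apply: cvgD; last exact: cvg_cst.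
    apply: cvgM; first exact: cvg_cst.
    by apply: cvgM; [exact: cvg_cst|exact: (tsum_tail_cvg sc)].
  rewrite !mulr0 add0r in h2.
  rewrite -(cvg_lim _ h1)// -(cvg_lim _ h2)//; apply: ler_lim.
  - by apply/cvg_ex; eexists; exact: h1.
  - by apply/cvg_ex; eexists; exact: h2.
  - by apply: nearW => K; exact: cos_density_dist.
apply/ler_addgt0Pr => e e0; rewrite add0r.
have d0 : 0 < 2 * pi * sqnorm c + 1 by rewrite ltr_wpDl// mulr_ge0// ltW.
(* The weight is chosen to make the bound of [key] at most e. *)
apply: (le_trans (key (e / (2 * pi * sqnorm c + 1)) _)); first by rewrite divr_gt0.
by rewrite mulrAC ler_pdivrMr// ler_wpM2l ?(ltW e0)// lerDl.
Qed.

End Szego_density.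

(** * Autocovariances and the predictor *)

Section normal_equations.
Context {R : realType}.
Local Notation mu := (@lebesgue_measure R).
Context disp (T : measurableType disp) (P : probability T R).

Lemma expectation_lincomb (F : nat -> T -> R) (w : nat -> R) (s : seq nat) :
  (forall j, F j \in Lfun P 1) ->
  (fun t => \sum_(j <- s) w j * F j t) \in Lfun P 1 /\
  'E_P[(fun t => \sum_(j <- s) w j * F j t)%R]%E = (\sum_(j <- s) w j * fine 'E_P[F j]%E)%:E.
Proof.
move=> FL; elim: s => [|j s [ihL ihE]].
  have -> : (fun t => \sum_(j <- [::]) w j * F j t) = cst 0 by apply/funext => t; rewrite big_nil.
  by rewrite big_nil expectation_cst; split => //; exact: Lfun_cst.
have L1 : (fun t => w j * F j t) \in Lfun P 1 by exact: (rpredZ (w j) (FL j)).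
have -> : (fun t => \sum_(i <- j :: s) w i * F i t) =
    (fun t => w j * F j t) \+ (fun t => \sum_(i <- s) w i * F i t).
  by apply/funext => t; rewrite big_cons.
split; first exact: rpredD.
rewrite expectationD// ihE big_cons EFinD EFinM fineK ?expectation_fin_num//.
congr (_ + _)%E; rewrite unlock; under eq_integral do rewrite EFinM.
by rewrite integralZl//; exact/Lfun1_integrable.
Qed.

Variables (X : int -> T -> R) (Delta : R -> R) (c a : nat -> R) (phi : nat -> nat -> R).
Hypothesis hX : stationary P X.
Hypothesis hDelta : is_spectral_density P X Delta.
Hypothesis hlog : positive_log_integrable Delta.
Hypothesis hc : MA_coefficients Delta c.
Hypothesis ha : AR_coefficients Delta a.
Hypothesis sa : abs_summable a.
Hypothesis sc : sqsummable c.
Hypothesis hphi : finite_predictor P X phi.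

Lemma autocovariance_gram (k : nat) : autocovariance P X k%:Z = gram c 0 k.
Proof.
have [_ _ Di /(_ k%:Z) h] := hDelta.
rewrite -(density_cos_coefficient hc ha sa sc Di hlog).
have -> : autocovariance P X k%:Z = complex.Re ((autocovariance P X k%:Z)%:C)%C by [].
rewrite h; apply: eq_Rintegral => t _.
by rewrite expiE /polar/= !mul1r mulr0 subr0 -pmulrn.
Qed.

Let L2 k : X k \in Lfun P 2%:E. Proof. by case: hX => + _ _. Qed.

Let L1 j k : X j \* X k \in Lfun P 1. Proof. exact: Lfun2_mul_Lfun1. Qed.

(** Stationarity translates the pair by i to the lag i - j, which is nonnegative after exchanging
    the indices if necessary. *)
Lemma covariance_gram (j i : nat) : fine 'E_P[(X (- j%:Z) \* X (- i%:Z))%R]%E = gram c j i.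
Proof.
wlog ji : j i / (j <= i)%N => [H|].
  have [/H//|/ltnW/H] := leqP j i.
  rewrite gramC => <-; congr (fine 'E_P[_])%E.
  by apply/funext => t /=; rewrite mulrC.
have [_ _ /(_ (- j%:Z) (- i%:Z) i%:Z)] := hX.
rewrite addNr [- _ + _]addrC subzn// => h.
have -> : gram c j i = gram c 0 (i - j) by rewrite -(gram_add 0 (i - j) j sc) add0n subnK.
by rewrite -autocovariance_gram /autocovariance -h.
Qed.

Lemma normal_equations (n i : nat) : (0 < n)%N -> (0 < i <= n)%N ->
  \sum_(1 <= j < n.+1) gram c j i * phi n j = gram c 0 i.
Proof.
move=> n0 /andP[i0 iN]; have [_ hW] := hphi n0.
(* The prediction error is tested against X_{-i}, which lies in the span by a combination with a
   single term and zero error. *)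
have cl : closed_span P X [set` `[- n%:Z, - 1]] (X (- i%:Z)).
  split => // e e0; exists [:: (- i%:Z)], (fun=> 1); split.
    move=> k; rewrite inE => /eqP -> /=; rewrite in_itv/=.
    by apply/andP; split; lia.
  have -> : (EFin \o (fun t => X (- i%:Z) t - \sum_(k <- [:: - i%:Z]) 1 * X k t)) = cst 0%E.
    by apply/funext => t /=; rewrite big_seq1 mul1r subrr.
  by rewrite Lnorm0 ?lte_fin.
have := hW _ cl.
set Z := fun t => _.
have [LZ EZ] := expectation_lincomb (phi n) (index_iota 1 n.+1) (fun j => L1 (- j%:Z) (- i%:Z)).
have -> : (X 0 - Z) * X (- i%:Z) = (X 0 \* X (- i%:Z)) \-
    (fun t => \sum_(j <- index_iota 1 n.+1) phi n j * (X (- j%:Z) \* X (- i%:Z)) t).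
  apply/funext => t; rewrite /= -[LHS]/((X 0 t - Z t) * X (- i%:Z) t) mulrBl; congr (_ - _).
  by rewrite /Z mulr_suml; apply: eq_bigr => j _; rewrite mulrA.
rewrite expectationB// EZ -[X in (X - _)%E]fineK ?expectation_fin_num//.
have := covariance_gram 0 i; rewrite oppr0 => ->.
rewrite -EFinB => /eqP; rewrite eqe subr_eq0 => /eqP ->.
by apply: eq_bigr => j _; rewrite covariance_gram mulrC.
Qed.

End normal_equations.

Theorem theorem2p9 (R : realType) (disp : measure_display)
    (T : measurableType disp) (P : probability T R) (X : int -> T -> R)
    (Delta : R -> R) (c a : nat -> R) (phi : nat -> nat -> R)
    (hX : stationary P X)
    (hPND : purely_nondeterministic P X)
    (hDelta : is_spectral_density P X Delta)
    (hlog : positive_log_integrable Delta)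
    (hc : MA_coefficients Delta c)
    (ha : AR_coefficients Delta a)
    (hA : condA1 c a \/ condA2 c a)
    (hphi : finite_predictor P X phi) :
  forall n : nat, (0 < n)%N ->
    [/\ forall j : nat, (1 <= j <= n)%N ->
          \sum_(1 <= k < M.+1) gcoef c a k n j @[M --> \oo] --> phi n j,
        forall v : nat, bcoef c a 1 n v = c 0%N * a v &
        forall k v : nat, (2 <= k)%N ->
          cvgn [normed series (fun u => a (v + u)%N * dcoef c a k.-1 n.+1 u)] /\
          bcoef c a k n v =
            c 0%N * limn (series (fun u => a (v + u)%N * dcoef c a k.-1 n.+1 u)) ].
Proof.
(* The alternative (A1) or (A2) enters only through these three consequences. *)
have [sa sc ht] := condA_tame hA.
have ac := conv_MA_AR hc ha sa sc.
move=> n n0; split => [j jn|v|k v k2].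
- apply: (predictor_sum_cvg sa sc ac ht) jn => i iN.
  exact: (normal_equations hX hDelta hlog hc ha sa sc hphi n0 iN).
- exact: bcoef1E.
- split; first exact/abs_summableP/asum_a_dcoef.
  by case: k k2 => // k _; exact: bcoefE.
Qed.
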